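(* Let $n,r\ge1$ be integers. The map $\eta:\mathbb{Z}\Sigma(n,r)/I_0(n,r)\to G(n,r)$ given by $\eta(E_{i,\underline d})=e_{i,\underline d}$, $\eta(F_{i,\underline d})=f_{i,\underline d}$ and $\eta(K_{\underline d})=k_{\underline d}$ is an isomorphism of $\mathbb{Z}$-algebras.
   Context: Generic algebra $G(n,r)$. Let $k$ be an algebraically closed field, $V$ an $r$-dimensional $k$-space, $\mathcal{F}$ the variety of $n$-step flags $f:\{0\}=V_0\subseteq\cdots\subseteq V_n=V$. $\mathrm{GL}(V)$-orbits $[f,f']$ in $\mathcal{F}\times\mathcal{F}$ (diagonal action) are in bijection with $n\times n$ matrices of non-negative integers with entries summing to $r$ via $A(f,f')_{ij}=\dim(V_{i-1}+V_i\cap V'_j)-\dim(V_{i-1}+V_i\cap V'_{j-1})$; $e_A$ is the orbit with matrix $A$. Let $S(A,A')=\{(f_1,f_2): \exists f\in\mathcal{F},\ (f_1,f)\in e_A,\ (f,f_2)\in e_{A'}\}$; if non-empty it contains a unique $\mathrm{GL}(V)$-orbit open in it (Zariski topology). $G(n,r)$ is the free $\mathbb{Z}$-module with basis the orbits $e_A$ and bilinear associative product $e_A\star e_{A'}$ equal to the open orbit in $S(A,A')$ if $S(A,A')\neq\emptyset$, and $0$ otherwise. $D(n,r)$ is the set of $n$-tuples $\underline d$ of non-negative integers with sum $r$; $\alpha_i$ is the $i$-th unit vector. In $G(n,r)$: $k_{\underline d}=e_{\mathrm{diag}(\underline d)}$; for $1\le i\le n-1$, $e_{i,\underline d}=e_A$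 with $A=\mathrm{diag}(\underline d)-E_{i+1,i+1}+E_{i,i+1}$ (if $d_{i+1}>0$), and $f_{i,\underline d}=e_A$ with $A=\mathrm{diag}(\underline d)-E_{i,i}+E_{i+1,i}$ (if $d_i>0$), where $E_{a,b}$ are elementary matrices. Quiver. $\Sigma(n,r)$ is the quiver with vertices $K_{\underline d}$, $\underline d\in D(n,r)$, and, for $1\le i\le n-1$, arrows $E_{i,\underline d}:K_{\underline d}\to K_{\underline d+\alpha_i-\alpha_{i+1}}$ (when $d_{i+1}>0$) and $F_{i,\underline d}:K_{\underline d}\to K_{\underline d-\alpha_i+\alpha_{i+1}}$ (when $d_i>0$). $\mathbb{Z}\Sigma(n,r)$ is the path algebra over $\mathbb{Z}$; $pp'$ means first $p'$, then $p$, and is zero if $p'$ does not end where $p$ starts; $K_{\underline d}$ are the trivial paths. Put $E_{i,\underline d}=0$, $F_{i,\underline d}=0$ when not defined as arrows, $K_{\underline d}=0$ if $\underline d\notin D(n,r)$, $E_i=\sum_{\underline d}E_{i,\underline d}$, $F_i=\sum_{\underline d}F_{i,\underline d}$. Relations. For $1\le i,j\le n-1$ let $P_{ij}(0)=E_i^2E_j-E_iE_jE_i$ if $i=j-1$; $P_{ij}(0)=-E_iE_jE_i+E_jE_i^2$ if $i=j+1$; $P_{ij}(0)=E_iE_j-E_jE_i$ otherwise; $N_{ij}(0)=-F_iF_jF_i+F_jF_i^2$ if $i=j-1$; $N_{ij}(0)=F_i^2F_j-F_iF_jF_i$ if $i=j+1$; $N_{ij}(0)=F_iF_j-F_jF_i$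 otherwise; $C_{ij}(0)=E_iF_j-F_jE_i-\delta_{ij}\sum_{\underline d}\lambda_{ij}(\underline d)K_{\underline d}$, where $\lambda_{ij}(\underline d)=1$ if $d_i>d_{i+1}=0$, $-1$ if $d_{i+1}>d_i=0$, and $0$ otherwise. Let $p_{ij}=2\alpha_i+\alpha_j-2\alpha_{i+1}-\alpha_{j+1}$ if $|i-j|=1$ and $p_{ij}=\alpha_i+\alpha_j-\alpha_{i+1}-\alpha_{j+1}$ otherwise. $I_0(n,r)\subseteq\mathbb{Z}\Sigma(n,r)$ is the two-sided ideal generated by all $K_{\underline d+p_{ij}}P_{ij}(0)K_{\underline d}$, $K_{\underline d-p_{ij}}N_{ij}(0)K_{\underline d}$ and $K_{\underline d+\alpha_i+\alpha_{j+1}-\alpha_{i+1}-\alpha_j}C_{ij}(0)K_{\underline d}$. *)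

(* Defs.v *)
From HB Require Import structures.
From mathcomp Require Import all_boot all_order all_algebra.
From mathcomp Require Import finmap.
From mathcomp Require Import boolp.
From mathcomp Require mpoly.
From mathcomp Require Import monalg.

Set Implicit Arguments.
Unset Strict Implicit.
Unset Printing Implicit Defensive.

Import GRing.Theory.
Local Open Scope ring_scope.

Section LinearExtension.
Variables (K : choiceType) (M : zmodType).
Implicit Types (f : K -> M) (x : {malg int[K]}).

(* The Z-linear map {malg int[K]} -> M extending f. *)
Definition lext f x : M := \sum_(k <- msupp x) f k *~ x@_k.

Lemma lextE f x (d : {fset K}) :
  {subset msupp x <= d} -> lext f x = \sum_(k <- d) f k *~ x@_k.
Proof.
move=> sxd; rewrite /lext; apply: big_fset_incl; first exact/fsubsetP.
by move=> k _ /mcoeff_outdom ->; rewrite mulr0z.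
Qed.

Lemma lext_is_zmod_morphism f : zmod_morphism (lext f).
Proof.
move=> x y; pose d := (msupp x `|` msupp y)%fset.
have sx : {subset msupp x <= d} by move=> k kx; rewrite in_fsetU kx.
have sy : {subset msupp y <= d} by move=> k ky; rewrite in_fsetU ky orbT.
have sxy : {subset msupp (x - y) <= d}.
  by apply/fsubsetP; rewrite /d; exact: msuppB_le.
rewrite (lextE f sx) (lextE f sy) (lextE f sxy) -sumrB.
by apply: eq_bigr => k _; rewrite raddfB mulrzBr.
Qed.

HB.instance Definition _ f :=
  GRing.isZmodMorphism.Build {malg int[K]} M (lext f) (lext_is_zmod_morphism f).

Lemma lextU f k : lext f << k >> = f k.
Proof.
rewrite (@lextE _ _ [fset k]%fset); last exact/fsubsetP/msuppU_le.
by rewrite big_seq_fset1 mcoeffU eqxx mulr1z.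
Qed.

Lemma malg_additive_ext (g h : {additive {malg int[K]} -> M}) :
  (forall k, g << k >> = h << k >>) -> g =1 h.
Proof.
move=> gh x; rewrite [x]monalgE !raddf_sum; apply: eq_bigr => k _.
have -> : << x@_k *g k >> = << k >> *~ x@_k :> {malg int[K]}.
  by rewrite -raddfMz intz.
by rewrite !raddfMz gh.
Qed.

End LinearExtension.

Section BilinearExtension.
Variables (K L : choiceType) (M : zmodType) (f : K -> L -> M).

Definition lext2 (x : {malg int[K]}) (y : {malg int[L]}) : M :=
  lext (fun k => lext (f k) y) x.

Lemma lext2Bl x x' y : lext2 (x - x') y = lext2 x y - lext2 x' y.
Proof. by rewrite /lext2 raddfB. Qed.

Lemma lext2Br x y y' : lext2 x (y - y') = lext2 x y - lext2 x y'.
Proof.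
rewrite /lext2 /lext -sumrB; apply: eq_bigr => k _.
by rewrite -!/(lext _ _) raddfB mulrzBl.
Qed.

HB.instance Definition _ x := GRing.isZmodMorphism.Build {malg int[L]} M
  (lext2 x) (fun y y' => lext2Br x y y').

Lemma lext2U k l : lext2 << k >> << l >> = f k l.
Proof. by rewrite /lext2 !lextU. Qed.

End BilinearExtension.

Record quiver := Quiver {
  vertex : finType;
  arrow : finType;
  source : arrow -> vertex;
  target : arrow -> vertex }.

Section PathAlgebra.
Variable Q : quiver.
Implicit Types (v : vertex Q) (s : seq (arrow Q)).

(* A path is given by its starting vertex and its arrows in the order in which
   they are traversed; the starting vertex distinguishes the trivial paths. *)
Fixpoint chain v s : bool :=
  if s is a :: s' then (source a == v) && chain (target a) s' else true.

Definition qpath := {p : vertex Q * seq (arrow Q) | chain p.1 p.2}.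

HB.instance Definition _ := SubType.on qpath.
HB.instance Definition _ := Choice.on qpath.

Implicit Types p q u : qpath.

Definition pstart p : vertex Q := (val p).1.
Definition parrows p : seq (arrow Q) := (val p).2.
Definition pend p : vertex Q := last (pstart p) (map (@target Q) (parrows p)).

Definition trivial_path v : qpath := Sub (v, [::]) isT.

Lemma arrow_path_subproof (a : arrow Q) : chain (source a) [:: a].
Proof. by rewrite /= eqxx. Qed.

Definition arrow_path (a : arrow Q) : qpath :=
  Sub (source a, [:: a]) (arrow_path_subproof a).

Lemma chain_cat v s1 s2 :
  chain v (s1 ++ s2) = chain v s1 && chain (last v (map (@target Q) s1)) s2.
Proof. by elim: s1 v => //= a s1 IHs v; rewrite IHs andbA. Qed.

(* First q, then p; only meaningful if q ends where p starts. *)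
Definition pcomp p q : qpath := insubd q (pstart q, parrows q ++ parrows p).

Lemma val_pcomp p q : pend q = pstart p ->
  val (pcomp p q) = (pstart q, parrows q ++ parrows p).
Proof.
move=> e; rewrite insubdK // unfold_in /= chain_cat -/(pend q) e.
by rewrite (valP q) (valP p).
Qed.

Lemma pstart_comp p q : pend q = pstart p -> pstart (pcomp p q) = pstart q.
Proof. by move=> e; rewrite {1}/pstart val_pcomp. Qed.

Lemma parrows_comp p q : pend q = pstart p ->
  parrows (pcomp p q) = parrows q ++ parrows p.
Proof. by move=> e; rewrite {1}/parrows val_pcomp. Qed.

Lemma pend_comp p q : pend q = pstart p -> pend (pcomp p q) = pend p.
Proof.
move=> e; rewrite /pend pstart_comp // parrows_comp // map_cat last_cat.
by rewrite -/(pend q) e.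
Qed.

Definition path_algebra := {malg int[qpath]}.

HB.instance Definition _ := GRing.Zmodule.on path_algebra.

Definition pmul p q : path_algebra :=
  if pend q == pstart p then << pcomp p q >> else 0.

Definition pa_mul : path_algebra -> path_algebra -> path_algebra := lext2 pmul.

Definition pa_one : path_algebra := \sum_(v : vertex Q) << trivial_path v >>.

Lemma pa_mulBl x x' y : pa_mul (x - x') y = pa_mul x y - pa_mul x' y.
Proof. exact: lext2Bl. Qed.

Lemma pa_mulBr x y y' : pa_mul x (y - y') = pa_mul x y - pa_mul x y'.
Proof. exact: lext2Br. Qed.

HB.instance Definition _ x := GRing.isZmodMorphism.Build path_algebra path_algebra
  (pa_mul x) (pa_mulBr x).

Definition pa_mulr y x : path_algebra := pa_mul x y.

HB.instance Definition _ y := GRing.isZmodMorphism.Build path_algebra path_algebra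
  (pa_mulr y) (fun x x' => pa_mulBl x x' y).

Lemma pa_mul0l y : pa_mul 0 y = 0. Proof. exact: (raddf0 (pa_mulr y)). Qed.
Lemma pa_mul0r x : pa_mul x 0 = 0. Proof. exact: (raddf0 (pa_mul x)). Qed.

Lemma pa_mulU p q : pa_mul << p >> << q >> = pmul p q.
Proof. exact: lext2U. Qed.

Lemma pa_mulA : associative pa_mul.
Proof.
move=> x y z.
apply: (@malg_additive_ext _ _ (pa_mulr (pa_mul y z))
  ((pa_mulr z) \o (pa_mulr y))) => p /=.
apply: (@malg_additive_ext _ _ (pa_mul << p >> \o (pa_mulr z))
  ((pa_mulr z) \o pa_mul << p >>)) => q /=.
apply: (@malg_additive_ext _ _ (pa_mul << p >> \o pa_mul << q >>)
  (pa_mul (pa_mul << p >> << q >>))) => u /=.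
rewrite !pa_mulU /pmul.
have [uq|uq] := eqVneq (pend u); have [qp|qp] := eqVneq (pend q).
- rewrite !pa_mulU /pmul pend_comp // pstart_comp // qp uq !eqxx.
  congr << _ >>; apply: val_inj.
  by rewrite !val_pcomp ?pstart_comp ?pend_comp ?parrows_comp // catA.
- rewrite pa_mul0l pa_mulU /pmul pend_comp //.
  by rewrite (negPf qp).
- rewrite pa_mul0r pa_mulU /pmul pstart_comp //.
  by rewrite (negPf uq).
- by rewrite pa_mul0r pa_mul0l.
Qed.

Lemma pa_mul1 : left_id pa_one pa_mul.
Proof.
apply: (@malg_additive_ext _ _ (pa_mul pa_one) idfun) => p /=.
have -> : pa_mul pa_one << p >> = \sum_v pa_mul << trivial_path v >> << p >>.
  by rewrite -[LHS]/(pa_mulr _ _) raddf_sum.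
rewrite (bigD1 (pend p)) //= pa_mulU /pmul eqxx.
rewrite big1 ?addr0 => [|v vp]; last first.
  by rewrite pa_mulU /pmul eq_sym (negPf vp).
congr << _ >>; apply: val_inj; rewrite val_pcomp // cats0.
by rewrite /pstart /parrows -surjective_pairing.
Qed.

Lemma pa_1mul : right_id pa_one pa_mul.
Proof.
apply: (@malg_additive_ext _ _ (pa_mulr pa_one) idfun) => p /=.
rewrite /pa_mulr raddf_sum (bigD1 (pstart p)) //= pa_mulU /pmul eqxx.
rewrite big1 ?addr0 => [|v vp]; last first.
  by rewrite pa_mulU /pmul (negPf vp).
congr << _ >>; apply: val_inj; rewrite val_pcomp //=.
by rewrite /pstart /parrows /= -surjective_pairing.
Qed.

Lemma pa_mulDl : left_distributive pa_mul +%R.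
Proof. by move=> x y z; exact: (raddfD (pa_mulr z)). Qed.

Lemma pa_mulDr : right_distributive pa_mul +%R.
Proof. by move=> x y z; exact: (raddfD (pa_mul x)). Qed.

HB.instance Definition _ := GRing.Zmodule_isPzRing.Build path_algebra
  pa_mulA pa_mul1 pa_1mul pa_mulDl pa_mulDr.

End PathAlgebra.

Section QuotientRing.
Variables (R : pzRingType) (X : R -> Prop).

Inductive gen_ideal : R -> Prop :=
  | gen_ideal0 : gen_ideal 0
  | gen_ideal_gen x : X x -> gen_ideal x
  | gen_idealB x y : gen_ideal x -> gen_ideal y -> gen_ideal (x - y)
  | gen_idealM a x b : gen_ideal x -> gen_ideal (a * x * b).

Definition idealp : {pred R} := fun x => `[< gen_ideal x >].

Lemma idealp_zmod_closed : zmod_closed idealp.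
Proof.
split; first exact/asboolP/gen_ideal0.
by move=> x y /asboolP ix /asboolP iy; apply/asboolP/gen_idealB.
Qed.

HB.instance Definition _ := GRing.isZmodClosed.Build R idealp idealp_zmod_closed.

Definition quot_ring := Quotient.quot idealp.

HB.instance Definition _ := GRing.Zmodule.on quot_ring.

Local Open Scope quotient_scope.

Definition qpi (x : R) : quot_ring := \pi_(Quotient.quot idealp) x.
Definition qone : quot_ring := qpi 1.
Definition qmul (a b : quot_ring) : quot_ring := qpi (repr a * repr b).

Lemma qpi_eq x y : (qpi x = qpi y) <-> gen_ideal (x - y).
Proof.
rewrite /qpi; split.
  by move/eqP; rewrite -Quotient.idealrBE unfold_in => /asboolP.
by move=> h; apply/eqP; rewrite -Quotient.idealrBE unfold_in; apply/asboolP.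
Qed.

Lemma qpi_surj a : exists x, a = qpi x.
Proof. by exists (repr a); rewrite /qpi reprK. Qed.

Lemma qpiD x y : qpi (x + y) = qpi x + qpi y.
Proof. by rewrite /qpi raddfD. Qed.

Lemma qmulE x y : qmul (qpi x) (qpi y) = qpi (x * y).
Proof.
have rx z : gen_ideal (repr (qpi z) - z).
  by apply/qpi_eq; rewrite /qpi reprK.
apply/qpi_eq; set x' := repr _; set y' := repr _.
have -> : x' * y' - x * y = 1 * (x' - x) * y' - - x * (y' - y) * 1.
  by rewrite mul1r mulr1 mulNr opprK mulrBl mulrBr addrA subrK.
by apply: gen_idealB; apply: gen_idealM; apply: rx.
Qed.

Lemma qmulA : associative qmul.
Proof.
move=> a b c; have [x ->] := qpi_surj a; have [y ->] := qpi_surj b.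
by have [z ->] := qpi_surj c; rewrite !qmulE mulrA.
Qed.

Lemma qmul1 : left_id qone qmul.
Proof. by move=> a; have [x ->] := qpi_surj a; rewrite qmulE mul1r. Qed.

Lemma q1mul : right_id qone qmul.
Proof. by move=> a; have [x ->] := qpi_surj a; rewrite qmulE mulr1. Qed.

Lemma qmulDl : left_distributive qmul +%R.
Proof.
move=> a b c; have [x ->] := qpi_surj a; have [y ->] := qpi_surj b.
by have [z ->] := qpi_surj c; rewrite -qpiD !qmulE -qpiD mulrDl.
Qed.

Lemma qmulDr : right_distributive qmul +%R.
Proof.
move=> a b c; have [x ->] := qpi_surj a; have [y ->] := qpi_surj b.
by have [z ->] := qpi_surj c; rewrite -qpiD !qmulE -qpiD mulrDr.
Qed.

HB.instance Definition _ := GRing.Zmodule_isPzRing.Build quot_ring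
  qmulA qmul1 q1mul qmulDl qmulDr.

End QuotientRing.

Section Sigma.
Variables n r : nat.

(* The entries of such a tuple are automatically at most r. *)
Definition dcomp := {d : {ffun 'I_n -> 'I_r.+1} | (\sum_i d i)%N == r}.

HB.instance Definition _ := SubType.on dcomp.
HB.instance Definition _ := Finite.on dcomp.

Implicit Types (d : dcomp) (i j : 'I_n.-1) (w : 'rV[int]_n).

Definition part d (a : 'I_n) : nat := val d a.

Definition vec d : 'rV[int]_n := \row_a (part d a)%:Z.

(* The ordinal i of 'I_n.-1 stands for the index i + 1 in {1, ..., n - 1};
   lo i and hi i stand for the indices i + 1 and i + 2 in {1, ..., n}. *)
Definition lo i : 'I_n := widen_ord (leq_pred n) i.

Lemma hi_subproof i : (i.+1 < n)%N.
Proof. by case: i; case: n. Qed.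

Definition hi i : 'I_n := Ordinal (hi_subproof i).

Definition alpha (a : 'I_n) : 'rV[int]_n := delta_mx 0 a.

Definition alphaB i : 'rV[int]_n := alpha (lo i) - alpha (hi i).

(* (true, i, d, d') is E_{i,d} and (false, i, d, d') is F_{i,d}, where d' is
   the end point; since d' has non-negative entries, it exists if and only if
   d_{i+1} > 0, respectively d_i > 0. *)
Definition is_arrow (a : bool * 'I_n.-1 * dcomp * dcomp) : bool :=
  let: (b, i, d, d') := a in
  vec d' == vec d + (if b then alphaB i else - alphaB i).

Definition sigma_arrow := {a : bool * 'I_n.-1 * dcomp * dcomp | is_arrow a}.

HB.instance Definition _ := SubType.on sigma_arrow.
HB.instance Definition _ := Finite.on sigma_arrow.

Definition Sigma : quiver :=
  @Quiver dcomp sigma_arrow (fun a => (val a).1.2) (fun a => (val a).2).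

Definition ZSigma := path_algebra Sigma.

HB.instance Definition _ := GRing.PzRing.on ZSigma.

Definition sK d : ZSigma := << trivial_path (d : vertex Sigma) >>.

(* K_w for an arbitrary integer vector w; zero if w is not in D(n,r). *)
Definition sKz w : ZSigma := \sum_(d | vec d == w) sK d.

(* The sums below have at most one term, and none if the arrow does not
   exist. *)
Definition sE i d : ZSigma :=
  \sum_(a : sigma_arrow | (val a).1 == (true, i, d))
     << arrow_path (a : arrow Sigma) >>.

Definition sF i d : ZSigma :=
  \sum_(a : sigma_arrow | (val a).1 == (false, i, d))
     << arrow_path (a : arrow Sigma) >>.

Definition tE i : ZSigma := \sum_d sE i d.
Definition tF i : ZSigma := \sum_d sF i d.

Definition relP i j : ZSigma :=
  if i.+1 == j :> nat then tE i ^+ 2 * tE j - tE i * tE j * tE i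
  else if i == j.+1 :> nat then - (tE i * tE j * tE i) + tE j * tE i ^+ 2
  else tE i * tE j - tE j * tE i.

Definition relN i j : ZSigma :=
  if i.+1 == j :> nat then - (tF i * tF j * tF i) + tF j * tF i ^+ 2
  else if i == j.+1 :> nat then tF i ^+ 2 * tF j - tF i * tF j * tF i
  else tF i * tF j - tF j * tF i.

(* lambda_{ii}(d); the Kronecker delta is in relC. *)
Definition lam i d : int :=
  if (0 < part d (lo i))%N && (part d (hi i) == 0%N) then 1
  else if (0 < part d (hi i))%N && (part d (lo i) == 0%N) then -1
  else 0.

Definition relC i j : ZSigma :=
  tE i * tF j - tF j * tE i
  - (if i == j then \sum_d sK d *~ lam i d else 0).

Definition pvec i j : 'rV[int]_n :=
  if (i.+1 == j :> nat) || (i == j.+1 :> nat)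
  then alphaB i *+ 2 + alphaB j
  else alphaB i + alphaB j.

Inductive I0_gen : ZSigma -> Prop :=
  | I0_P i j d : I0_gen (sKz (vec d + pvec i j) * relP i j * sK d)
  | I0_N i j d : I0_gen (sKz (vec d - pvec i j) * relN i j * sK d)
  | I0_C i j d :
      I0_gen (sKz (vec d + alphaB i - alphaB j) * relC i j * sK d).

Definition ZSigma_mod_I0 := quot_ring I0_gen.

HB.instance Definition _ := GRing.PzRing.on ZSigma_mod_I0.

Definition cls (x : ZSigma) : ZSigma_mod_I0 := qpi I0_gen x.

End Sigma.

Section Flags.
Variables (n : nat) (k : closedFieldType) (V : vectType k).

Definition pre (i : 'I_n) : 'I_n.+1 := widen_ord (leqnSn n) i.
Definition suc (i : 'I_n) : 'I_n.+1 := lift ord0 i.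

Definition is_flag (f : {ffun 'I_n.+1 -> {vspace V}}) : bool :=
  [&& f ord0 == 0%VS, f ord_max == fullv
    & [forall i : 'I_n, (f (pre i) <= f (suc i))%VS]].

Definition flag := {f : {ffun 'I_n.+1 -> {vspace V}} | is_flag f}.

Definition step (f : flag) (i : 'I_n.+1) : {vspace V} := val f i.

Definition relpos (f f' : flag) : 'M[nat]_n :=
  \matrix_(i, j)
    (\dim (step f (pre i) + (step f (suc i) :&: step f' (suc j)))
     - \dim (step f (pre i) + (step f (suc i) :&: step f' (pre j))))%N.

(* Elements of GL(V) are the injective linear endomorphisms of V. *)
Definition same_orbit (p q : flag * flag) : Prop :=
  exists2 g : 'End(V), lker g = 0%VS &
    forall i, (g @: step p.1 i)%VS = step q.1 i /\
              (g @: step p.2 i)%VS = step q.2 i.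

(* Pluecker coordinates with respect to the basis (vbasis {:V}): the point of
   P(/\^d V) given by a d-dimensional subspace U is represented by the maximal
   minors of a basis of U, up to a non-zero scalar. They are extended by zero
   to all of the exterior algebra, so that the Grassmannians of subspaces of
   all dimensions are simultaneously embedded in a single projective space, in
   which they are disjoint closed subsets. *)
Definition minor (X : seq V) (I : {set 'I_(\dim {:V})}) : k :=
  if #|I| == size X then
    \det (\matrix_(a < #|I|, b < #|I|) coord (vbasis {:V}) (enum_val b) X`_a)
  else 0.

Definition plucker (U : {vspace V}) (x : {set 'I_(\dim {:V})} -> k) : Prop :=
  exists c : k, exists X : seq V,
    [/\ c != 0, basis_of U X & forall I, x I = c * minor X I].

Definition pvar := (('I_n.+1 + 'I_n.+1) * {set 'I_(\dim {:V})})%type.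

Definition hcoords (p : flag * flag) (x : pvar -> k) : Prop :=
  forall i, plucker (step p.1 i) (fun I => x (inl i, I)) /\
            plucker (step p.2 i) (fun I => x (inr i, I)).

(* Zariski closed subsets of the square of the flag variety, as a subvariety
   of a product of projective spaces: zero loci of sets of polynomials, where a
   polynomial vanishes at a point if it vanishes at all its systems of
   homogeneous coordinates (as k is infinite, this means that all the
   multihomogeneous components vanish at the point). *)
Definition zclosed (Z : flag * flag -> Prop) : Prop :=
  exists P : mpoly.mpoly #|{: pvar}| k -> Prop,
    forall p, Z p <->
      (forall q x, P q -> hcoords p x ->
         mpoly.meval (fun i => x (enum_val i)) q = 0).

(* O is a subset of S and is open in S for the subspace topology. *)
Definition zopen_in (O S : flag * flag -> Prop) : Prop :=
  exists2 Z, zclosed Z & forall p, O p <-> S p /\ ~ Z p.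

End Flags.

(* n x n matrices of non-negative integers with entries summing to r; the
   entries are automatically at most r. *)
Definition orbmx (n r : nat) :=
  {A : 'M['I_r.+1]_n | (\sum_i \sum_j A i j)%N == r}.

HB.instance Definition _ n r := SubType.on (orbmx n r).
HB.instance Definition _ n r := Finite.on (orbmx n r).

(* The basis of orbits is indexed by the matrices of the orbits. *)
Definition Gnr (n r : nat) := {malg int[orbmx n r]}.

HB.instance Definition _ n r := GRing.Zmodule.on (Gnr n r).

Section GenericAlgebra.
Variables (n r : nat) (k : closedFieldType) (V : vectType k).
Implicit Types A B C : orbmx n r.

Definition nmx A : 'M[nat]_n := map_mx (@nat_of_ord _) (val A).

(* The GL(V)-orbit with matrix A, as a subset of the set of pairs of flags. *)
Definition orb A (p : flag n V * flag n V) : Prop :=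
  exists2 q, relpos q.1 q.2 = nmx A & same_orbit q p.

Definition orbS A B (p : flag n V * flag n V) : Prop :=
  exists f, orb A (p.1, f) /\ orb B (f, p.2).

Definition orb_mul A B : Gnr n r :=
  if `[< exists p, orbS A B p >] then
    if [pick C | `[< zopen_in (orb C) (orbS A B) >]] is Some C then << C >>
    else 0
  else 0.

Definition gen_mul : Gnr n r -> Gnr n r -> Gnr n r := lext2 orb_mul.

End GenericAlgebra.

Section GenericAlgebraElements.
Variables n r : nat.
Implicit Types (d : dcomp n r) (i : 'I_n.-1).

(* e_M, for M an integer matrix; zero if M is not the matrix of an orbit. *)
Definition gen_basis (M : 'M[int]_n) : Gnr n r :=
  \sum_(A : orbmx n r | map_mx Posz (nmx A) == M) << A >>.

Definition gen_k d : Gnr n r := gen_basis (diag_mx (vec d)).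

Definition gen_e i d : Gnr n r :=
  gen_basis (diag_mx (vec d) - delta_mx (hi i) (hi i) + delta_mx (lo i) (hi i)).

Definition gen_f i d : Gnr n r :=
  gen_basis (diag_mx (vec d) - delta_mx (lo i) (lo i) + delta_mx (hi i) (lo i)).

Definition gen_one : Gnr n r := \sum_d gen_k d.

End GenericAlgebraElements.

(* Main.v *)
Require Import Defs.
From HB Require Import structures.
From mathcomp Require Import all_boot all_order all_algebra all_fingroup.
From mathcomp Require Import boolp monalg zify.
From mathcomp Require Import (canonicals, coercions) mpoly.
Set Implicit Arguments.
Unset Strict Implicit.
Unset Printing Implicit Defensive.
Import GRing.Theory Order.TTheory Num.Theory.
Local Open Scope ring_scope.

(** The orbit of a pair [(f, f')] of flags is determined by the dimensions of the
    intersections of their steps ([relpos_transitive]), its rank function. The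
    proof first computes the product of orbits in terms of rank functions and
    then compares both algebras with monomials in normal form.

    Products. For flags [f1], [f], [f2], the intersection of step [i] of [f1] with
    step [j] of [f2] has at least the dimension forced by their traces on each
    step of [f] ([dcap_triangle]). Given [f1] and [f], a flag [f2] in prescribed
    position to [f] that attains this bound for all [i] and [j] is built vector
    by vector, each of them outside finitely many proper subspaces
    ([generic_flag]). Its orbit is open in [S(A, B)]: having the smallest
    intersections means having the largest sums of steps, and the span of
    subspaces can be read off from their Pluecker coordinates by polynomials
    ([contract_span], [separate_sum], [generic_orbit_open]). It is the only open
    orbit, as any two points of a fibre of [S(A, B)] are joined by a line of
    endomorphisms that stabilize [f], on which each open orbit omits finitely
    many points ([open_orbit_unique]). Hence the product is a tropical matrix
    product of rank functions ([orb_mul_tprod]): it is associative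
    ([tprod_assoc]), and [e_i] and [f_i] act by changing a single row of the rank
    function ([op], [tX_mul]).

    The homomorphism. In this form the relations become identities between
    piecewise linear operators on rank functions, which are verified row by row;
    so evaluation of paths factors through the quotient ([Phi_ideal]).

    Bijectivity. In the quotient every word in the generators, started at a
    vertex, is zero or a normal form ([word_nform]): a string of letters [E_i], a
    normal form in fewer letters, and a string of letters [F_i]. The exponents
    in the strings are partial sums of the last column and the last row of a
    matrix of non-negative integers, so the normal forms are indexed by orbit
    matrices, and they span ([spanned]). On the other side, every orbit off the
    diagonal is the product of some [e_i] or [f_i] with an orbit closer to the
    diagonal ([descent]); so every basis element is the image of a word, hence
    of a normal form. As a finite set of matrices indexes both the normal forms
    and the basis, the normal forms are mapped bijectively onto the basis. *)

(** * Strings of raising generators *)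

Section RaisingStrings.
Variables (R : pzRingType) (X : nat -> R).
Hypothesis relXXY : forall i, X i * X i * X i.+1 = X i * X i.+1 * X i.
Hypothesis relXYY : forall i, X i.+1 * X i * X i.+1 = X i * X i.+1 * X i.+1.
Hypothesis relXfar : forall i j, (i.+1 < j)%N -> X i * X j = X j * X i.

(** Exponents that increase weakly with the index make these strings a normal
    form: a monomial in the [X i] with [i < l] is such a string times a monomial
    in which [X l.-1] does not occur. *)
Fixpoint rstring l (m : nat -> nat) : R :=
  if l is l'.+1 then rstring l' m * X l' ^+ m l' else 1.

Definition incr_at i (m : nat -> nat) : nat -> nat := fun a => (m a + (a == i))%N.

Lemma incr_at_id i m : incr_at i m i = (m i).+1.
Proof. by rewrite /incr_at eqxx addn1. Qed.

Lemma incr_at_neq i m a : a != i -> incr_at i m a = m a.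
Proof. by rewrite /incr_at => /negPf ->; rewrite addn0. Qed.

Lemma eq_rstring l m m' :
  (forall i, (i < l)%N -> m i = m' i) -> rstring l m = rstring l m'.
Proof.
elim: l => //= l IHl mm'; rewrite mm' // IHl // => i il.
by apply: mm'; rewrite ltnS ltnW.
Qed.

Lemma comm_rstring l m j : (l < j)%N -> GRing.comm (rstring l m) (X j).
Proof.
elim: l => /= [|l IHl] lj; first exact/commr_sym/commr1.
apply/commr_sym/commrM; first by apply/commr_sym/IHl/ltnW.
by apply/commrX/commr_sym/relXfar.
Qed.

(* Both cubic relations say that a letter commutes with a pair of letters. *)
Let Z i := X i * X i.+1.

Lemma pair_comml i : GRing.comm (X i) (Z i).
Proof. by rewrite /GRing.comm /Z mulrA relXXY. Qed.

Lemma pair_commr i : GRing.comm (X i.+1) (Z i).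
Proof. by rewrite /GRing.comm /Z mulrA relXYY. Qed.

Lemma pairX i b : X i ^+ b * X i.+1 ^+ b = Z i ^+ b.
Proof.
elim: b => [|b IHb]; first by rewrite mulr1.
rewrite exprSr exprS mulrA -(mulrA _ (X i)) -/(Z i) -mulrA.
by rewrite (commrX b (commr_sym (pair_commr i))) mulrA IHb -exprSr.
Qed.

(** The factor [X i ^+ a * X i.+1 ^+ a] is a power of the pair [Z i], which
    commutes with [X i.+1]; this is why [a <= b] is needed. *)
Lemma raise_pass i a b : (a <= b)%N ->
  X i.+1 * (X i ^+ a * X i.+1 ^+ b) = X i ^+ a * X i.+1 ^+ b.+1.
Proof.
move=> ab; rewrite -(subnKC ab) -addnS !exprD !mulrA -(mulrA (X i.+1)) !pairX.
by rewrite (commrX a (pair_commr i)) -mulrA -exprS.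
Qed.

Lemma raise_absorb i b :
  X i ^+ b.+1 * X i.+1 ^+ b = X i ^+ b * X i.+1 ^+ b * X i.
Proof.
by rewrite exprS -mulrA pairX (commrX b (pair_comml i)).
Qed.

Definition weakly_incr l (m : nat -> nat) :=
  forall i, (i.+1 < l)%N -> (m i <= m i.+1)%N.

Lemma rstring_incr_ge l m i : (l <= i)%N ->
  rstring l (incr_at i m) = rstring l m.
Proof.
move=> li; apply: eq_rstring => a al; rewrite incr_at_neq //.
by rewrite ltn_eqF // (leq_trans al).
Qed.

Lemma raise_top l m : weakly_incr l.+1 m ->
  X l * rstring l.+1 m = rstring l.+1 (incr_at l m).
Proof.
case: l => [|l] wi; first by rewrite /= !mul1r incr_at_id exprS.
rewrite [RHS]/= rstring_incr_ge // incr_at_id incr_at_neq ?ltn_eqF //.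
rewrite [rstring l.+2 m]/= -!mulrA -raise_pass; last exact: wi.
by rewrite !mulrA (comm_rstring m (ltnSn l)).
Qed.

(** Raising the exponent of [X i] keeps the exponents weakly increasing unless
    it already equals the next one. In that case the powers of [X i] and
    [X i.+1] form a power of the pair [Z i], so [X i] passes to the right end;
    it is then not the last letter [X l.-1]. *)
Lemma raise_rstring l m i : weakly_incr l m -> (i < l)%N ->
  X i * rstring l m =
    if (i.+1 < l)%N && (m i == m i.+1) then rstring l m * X i
    else rstring l (incr_at i m).
Proof.
elim: l m => // l IHl m wi.
rewrite ltnS leq_eqVlt => /predU1P[->|il].
  by rewrite ltnn; exact: raise_top.
have {}IHl := IHl m (fun j jl => wi j (ltnW jl)) il.
rewrite ltnS il /=; case: (ltngtP i.+1 l) (il) => // [il1|il1] _.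
- rewrite mulrA IHl il1 /=; case: eqP => _.
    by rewrite -!mulrA (commrX (m l) (relXfar il1)).
  by rewrite [in RHS]incr_at_neq // gtn_eqF.
- rewrite -il1 mulrA -[rstring i.+1 m]/(rstring i.+1 m) raise_top; last first.
    by move=> j ji; apply: wi; rewrite -il1; apply: ltnW.
  rewrite /= rstring_incr_ge // incr_at_id incr_at_neq; last by rewrite gtn_eqF.
  case: (eqVneq (m i) (m i.+1)) => [<-|//].
  by rewrite -!mulrA; congr (_ * _); rewrite raise_absorb !mulrA.
Qed.

Lemma weakly_incr_incr l m i : weakly_incr l m ->
  ~~ ((i.+1 < l)%N && (m i == m i.+1)) -> weakly_incr l (incr_at i m).
Proof.
move=> wi ni j jl; rewrite /incr_at; have := wi j jl.
case: (eqVneq j i) ni => [<-|ji]; first by rewrite jl /= => *; lia.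
by move=> *; lia.
Qed.

Lemma sum_incr_at l m i : (i < l)%N ->
  (\sum_(a < l) incr_at i m a = (\sum_(a < l) m a).+1)%N.
Proof.
move=> il; rewrite big_split /= -addn1; congr (_ + _)%N.
rewrite (bigD1 (Ordinal il)) //= eqxx big1 // => a /eqP ai.
by case: eqP => // E; case: ai; apply: val_inj.
Qed.

End RaisingStrings.

(** * Words acting on weights *)

(** The change of weight effected by [E_i] ([b = true]) or [F_i] ([b = false]):
    one unit moves out of the index [taken b i] to its neighbour. *)
Definition shift (b : bool) (i : nat) (w : nat -> int) : nat -> int :=
  fun a => w a + (if b then 1 else -1) * ((a == i)%:Z - (a == i.+1)%:Z).

Definition taken (b : bool) (i : nat) : nat := if b then i.+1 else i.

Section WeightedWords.
Variables (R : pzRingType) (n : nat).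
Variables (X : bool -> nat -> R) (K : (nat -> int) -> R).

(** What the rewriting uses of the defining relations. Letters are indexed by
    all natural numbers and weights are integer functions, so that words can be
    handled without bounds on their letters; letters out of range can be
    set to zero. *)
Record presented : Prop := Presented {
  pr_ext : forall w w', (forall a, (a < n)%N -> w a = w' a) -> K w = K w';
  pr_neg : forall w a, (a < n)%N -> w a < 0 -> K w = 0;
  pr_shift : forall b i w, X b i * K w = K (shift b i w) * X b i;
  pr_swap_neq : forall b i j, i != j -> X b i * X (~~ b) j = X (~~ b) j * X b i;
  pr_swap : forall b i w, (i.+1 < n)%N -> 0 < w i -> 0 < w i.+1 ->
    X b i * X (~~ b) i * K w = X (~~ b) i * X b i * K w;
  pr_cancel : forall b i w, (i.+1 < n)%N ->
    0 < w (taken (~~ b) i) -> w (taken b i) = 0 ->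
    X b i * X (~~ b) i * K w = K w;
  pr_EEE1 : forall i, X true i * X true i * X true i.+1
                    = X true i * X true i.+1 * X true i;
  pr_EEE2 : forall i, X true i.+1 * X true i * X true i.+1
                    = X true i * X true i.+1 * X true i.+1;
  pr_FFF1 : forall i, X false i.+1 * X false i * X false i
                    = X false i * X false i.+1 * X false i;
  pr_FFF2 : forall i, X false i.+1 * X false i * X false i.+1
                    = X false i.+1 * X false i.+1 * X false i;
  pr_far : forall b i j, (i.+1 < j)%N -> X b i * X b j = X b j * X b i }.

Hypothesis PR : presented.

Definition word (s : seq (bool * nat)) : R := \prod_(x <- s) X x.1 x.2.
Definition mono b (u : seq nat) : R := word (map (pair b) u).

Definition wshift s (w : nat -> int) : nat -> int :=
  foldr (fun x => shift x.1 x.2) w s.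

Lemma word_cons x s : word (x :: s) = X x.1 x.2 * word s.
Proof. exact: big_cons. Qed.

Lemma word_cat s t : word (s ++ t) = word s * word t.
Proof. exact: big_cat. Qed.

Lemma word_nil : word [::] = 1. Proof. exact: big_nil. Qed.

Lemma mono_cons b i u : mono b (i :: u) = X b i * mono b u.
Proof. exact: word_cons. Qed.

Lemma word_nseq b i k : word (nseq k (b, i)) = X b i ^+ k.
Proof. by elim: k => [|k IHk]; rewrite ?word_nil //= word_cons exprS IHk. Qed.

Lemma mono_nseq b i k : mono b (nseq k i) = X b i ^+ k.
Proof. by rewrite /mono map_nseq word_nseq. Qed.

Lemma mono_nil b : mono b [::] = 1. Proof. exact: word_nil. Qed.

Lemma word_shift s w : word s * K w = K (wshift s w) * word s.
Proof.
elim: s => [|x s IHs]; first by rewrite word_nil mul1r mulr1.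
by rewrite word_cons -mulrA IHs mulrA pr_shift // mulrA.
Qed.

Lemma taken_neg b i w : (i.+1 < n)%N -> w (taken b i) <= 0 -> X b i * K w = 0.
Proof.
move=> i_n wi; rewrite pr_shift // (@pr_neg PR _ (taken b i)) ?mul0r //.
  by case: b {wi} => //=; apply: ltnW.
by rewrite /shift; case: b wi => /=; lia.
Qed.

(** The letter passes every letter of the opposite sign, except possibly the
    opposite letter [X (~~ b) i] of the same index. There the weight decides:
    if it has units at both ends the two letters commute, if the
    opposite letter cannot act the word is zero, and if after it the unit just
    moved is the only one that [X b i] can take, the pair cancels. *)
Lemma push_letter b i u w : (i.+1 < n)%N ->
  X b i * mono (~~ b) u * K w = 0 \/
  X b i * mono (~~ b) u * K w = mono (~~ b) u * X b i * K w \/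
  exists2 u', X b i * mono (~~ b) u * K w = mono (~~ b) u' * K w
    & size u = (size u').+1 /\ {subset u' <= u}.
Proof.
move=> i_n; elim: u => [|j u IHu]; first by right; left; rewrite mono_nil mulr1 mul1r.
rewrite mono_cons; have [eij|nij] := eqVneq i j; last first.
  rewrite mulrA (pr_swap_neq PR) // -!(mulrA (X (~~ b) j)).
  case: IHu => [->|[->|[u' -> [su su']]]]; first by left; rewrite mulr0.
    by right; left; rewrite !mulrA.
  right; right; exists (j :: u'); first by rewrite mono_cons !mulrA.
  split; first by rewrite /= su.
  by move=> a; rewrite !inE => /orP[->//|/su' ->]; rewrite orbT.
rewrite -{j}eij in IHu *.
have EK Y : Y * mono (~~ b) u * K w = Y * K (wshift (map (pair (~~ b)) u) w) * mono (~~ b) u.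
  by rewrite -mulrA word_shift mulrA.
rewrite !mulrA; set w' := wshift (map _ u) w in EK.
have i_n' c : (taken c i < n)%N by case: c => //; apply: ltnW.
have [le|gt] := leP (w' (taken (~~ b) i)) 0.
  by left; rewrite EK -(mulrA (X b i)) taken_neg // mulr0 mul0r.
case: (ltgtP (w' (taken b i)) 0) => [lt|gt'|e0].
- by left; rewrite EK -mulrA (pr_neg PR (i_n' b)) // ?mul0r mulr0.
- have -> : X b i * X (~~ b) i * mono (~~ b) u * K w =
    X (~~ b) i * (X b i * mono (~~ b) u * K w).
    rewrite !mulrA !EK; congr (_ * _).
    by rewrite (pr_swap PR) //; case: (b) gt gt'.
  case: IHu => [->|[->|[u' -> [su su']]]]; first by left; rewrite mulr0.
    by right; left; rewrite !mulrA.
  right; right; exists (i :: u'); first by rewrite mono_cons !mulrA.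
  split; first by rewrite /= su.
  by move=> a; rewrite !inE => /orP[->//|/su' ->]; rewrite orbT.
- right; right; exists u; last by split=> // a au; rewrite inE au orbT.
  by rewrite EK (pr_cancel PR) // word_shift.
Qed.

Definition idx_lt l (s : seq (bool * nat)) := all (fun x => x.2 < l)%N s.

(** Since a cancelled pair has one letter of each sign, the same number [t] is
    lost on both sides; this count is what later shows that a word gets
    shorter. *)
Lemma sort_word b s w : idx_lt n.-1 s ->
  word s * K w = 0 \/
  exists u v t, [/\ word s * K w = mono (~~ b) u * mono b v * K w,
    (forall i, i \in u -> (~~ b, i) \in s), (forall i, i \in v -> (b, i) \in s),
    (size u + t = count (fun x => x.1 != b) s)%N &
    (size v + t = count (fun x => x.1 == b) s)%N].
Proof.
elim: s => [|[c i] s IHs] /=.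
  by right; exists [::], [::], 0%N; rewrite !mono_nil word_nil !mulr1.
case/andP=> i_n /IHs {IHs} IHs; rewrite word_cons -mulrA.
case: IHs => [->|[u [v [t [-> ius ivs su sv]]]]]; first by left; rewrite mulr0.
have [ecb|ncb] := eqVneq c b; last first.
  have -> : c = ~~ b by case: (c) (b) ncb => -[].
  right; exists (i :: u), v, t; split.
  - by rewrite mono_cons !mulrA.
  - by move=> j; rewrite !inE => /predU1P[->|/ius ->]; rewrite ?eqxx ?orbT.
  - by move=> j /ivs; rewrite !inE => ->; rewrite orbT.
  - by rewrite /= addSn su; case: (b).
  - by rewrite sv; case: (b).
rewrite {c}ecb [X in X * _]/=.
have i_n' : (i.+1 < n)%N by move: i_n => /=; lia.
rewrite -[X in _ * X]mulrA word_shift !mulrA.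
set w' := wshift _ w.
case: (@push_letter b i u w' i_n') => [->|[->|[u' -> [uu' su']]]].
- by left; rewrite mul0r.
- right; exists u, (i :: v), t; split.
  + by rewrite mono_cons -!mulrA -word_shift !mulrA.
  + by move=> j /ius; rewrite !inE => ->; rewrite orbT.
  + by move=> j; rewrite !inE => /predU1P[->|/ivs ->]; rewrite ?eqxx ?orbT.
  + by rewrite su; case: (b).
  + by rewrite /= addSn sv; case: (b).
- right; exists u', v, t.+1; split.
  + by rewrite -mulrA -word_shift !mulrA.
  + by move=> j /su' /ius; rewrite !inE => ->; rewrite orbT.
  + by move=> j /ivs; rewrite !inE => ->; rewrite orbT.
  + by rewrite addnS -addSn -uu' su; case: (b).
  + by rewrite /= addnS sv; case: (b).
Qed.

End WeightedWords.

(** * Normal forms *)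

Section LoweringStrings.
Variables (R : pzRingType) (Y : nat -> R).

Fixpoint lstring l (m : nat -> nat) : R :=
  if l is l'.+1 then Y l' ^+ m l' * lstring l' m else 1.

(** Reversing products turns the relations between the [F_i] into those between
    the [E_i]. *)
Lemma lstring_converse l m : lstring l m = @rstring R^c Y l m.
Proof.
elim: l => //= l ->.
have -> : Y l ^+ m l = (Y l : R^c) ^+ m l; last by [].
by elim: (m l) => // k IHk; rewrite exprS [RHS]exprSr IHk.
Qed.

Hypothesis relYYX : forall i, Y i.+1 * Y i * Y i = Y i * Y i.+1 * Y i.
Hypothesis relYXX : forall i, Y i.+1 * Y i * Y i.+1 = Y i.+1 * Y i.+1 * Y i.
Hypothesis relYfar : forall i j, (i.+1 < j)%N -> Y i * Y j = Y j * Y i.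

Lemma raise_lstring l m i : weakly_incr l m -> (i < l)%N ->
  lstring l m * Y i =
    if (i.+1 < l)%N && (m i == m i.+1) then Y i * lstring l m
    else lstring l (incr_at i m).
Proof.
move=> wi il; rewrite !lstring_converse.
apply: (@raise_rstring R^c Y _ _ _ l m i wi il).
- by move=> j; apply: (etrans (mulrA _ _ _) (etrans (relYYX j) (esym (mulrA _ _ _)))).
- by move=> j; apply: (etrans (mulrA _ _ _) (etrans (relYXX j) (esym (mulrA _ _ _)))).
- by move=> j k jk; apply: (esym (relYfar jk)).
Qed.

End LoweringStrings.

Section NormalForms.
Variables (R : pzRingType) (n : nat).
Variables (X : bool -> nat -> R) (K : (nat -> int) -> R).
Hypothesis PR : presented n X K.
Local Notation E := (X true).
Local Notation F := (X false).
Local Notation word := (word X).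
Local Notation mono := (mono X).

Lemma rstring_word b l m : exists s, [/\ rstring (X b) l m = word s, idx_lt l s
   & size s = (\sum_(a < l) m a)%N].
Proof.
elim: l => [|l [s [e1 i1 s1]]].
  by exists [::]; split=> //=; rewrite ?word_nil ?big_ord0.
exists (s ++ nseq (m l) (b, l)); split.
- by rewrite word_cat -e1 word_nseq.
- rewrite /idx_lt all_cat all_nseq /= ltnSn orbT andbT.
  by apply: sub_all i1 => x /ltnW.
- by rewrite size_cat size_nseq s1 big_ord_recr.
Qed.

Lemma lstring_word b l m : exists s, [/\ lstring (X b) l m = word s, idx_lt l s
   & size s = (\sum_(a < l) m a)%N].
Proof.
elim: l => [|l [s [e1 i1 s1]]].
  by exists [::]; split=> //=; rewrite ?word_nil ?big_ord0.
exists (nseq (m l) (b, l) ++ s); split.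
- by rewrite word_cat -e1 word_nseq.
- rewrite /idx_lt all_cat all_nseq /= ltnSn orbT /=.
  by apply: sub_all i1 => x /ltnW.
- by rewrite size_cat size_nseq s1 big_ord_recr /= addnC.
Qed.

(** Multiply by the letters one at a time; those that come out on the right of
    the string have index smaller than [l] and form [v]. *)
Lemma mono_E_rstring l u : all (fun i => i < l.+1)%N u ->
  exists m v, [/\ weakly_incr l.+1 m, all (fun i => i < l)%N v,
    mono true u = rstring E l.+1 m * mono true v
    & size u = (size v + \sum_(a < l.+1) m a)%N].
Proof.
elim: u => [_|i u IHu /= /andP[il /IHu[m [v [wi lv eu su]]]]].
  exists (fun=> 0%N), [::]; split=> //=.
    by rewrite mono_nil mulr1 mulr1; elim: l => //= l <-; rewrite mulr1.
  by rewrite big1.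
have EE1 := pr_EEE1 PR; have EE2 := pr_EEE2 PR; have EEf := pr_far PR true.
rewrite mono_cons eu mulrA (raise_rstring EE1 EE2 (@EEf)) //.
case: ifP => [/andP[il' _]|/negbT nil].
  exists m, (i :: v); split=> //=; first by rewrite -ltnS il'.
  - by rewrite mono_cons mulrA.
  - by rewrite su.
exists (incr_at i m), v; split=> //; first exact: weakly_incr_incr.
by rewrite sum_incr_at // addnS su.
Qed.

Lemma mono_F_lstring l u : all (fun i => i < l.+1)%N u ->
  exists m v, [/\ weakly_incr l.+1 m, all (fun i => i < l)%N v,
    mono false u = mono false v * lstring F l.+1 m
    & size u = (size v + \sum_(a < l.+1) m a)%N].
Proof.
elim/last_ind: u => [_|u i IHu].
  exists (fun=> 0%N), [::]; split=> //=.
    by rewrite mono_nil mul1r mul1r; elim: l => //= l <-; rewrite mul1r.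
  by rewrite big1.
rewrite all_rcons => /= /andP[il /IHu[m [v [wi lv eu su]]]].
have FF1 := pr_FFF1 PR; have FF2 := pr_FFF2 PR; have FFf := pr_far PR false.
have mr w : mono false (rcons w i) = mono false w * F i.
  by rewrite /mono map_rcons -cats1 word_cat word_cons word_nil mulr1.
rewrite mr eu -mulrA (raise_lstring FF1 FF2 (@FFf)) //.
case: ifP => [/andP[il' _]|/negbT nil].
  exists m, (rcons v i); split=> //=; first by rewrite all_rcons /= -ltnS il'.
  - by rewrite mr mulrA.
  - by rewrite !size_rcons su.
exists (incr_at i m), v; split=> //; first exact: weakly_incr_incr.
by rewrite sum_incr_at // size_rcons addnS su.
Qed.

(** The monomial of an orbit matrix, of which only the off-diagonal entries
    among the indices [0, ..., l] occur. The [E]-string builds the last column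
    and the [F]-string the last row: a unit of the entry [(a, l)] is moved
    by all [E_i] with [a <= i < l], hence the partial sums as exponents. *)
Fixpoint nform l (A : nat -> nat -> nat) : R :=
  if l is l'.+1 then
    rstring E l (fun i => \sum_(a < i.+1) A a l)%N * nform l' A
    * lstring F l (fun j => \sum_(b < j.+1) A l b)%N
  else 1.

Lemma eq_lstring (Y : nat -> R) l m m' :
  (forall i, (i < l)%N -> m i = m' i) -> lstring Y l m = lstring Y l m'.
Proof.
elim: l => //= l IHl mm'; rewrite mm' // IHl // => i il.
by apply: mm'; rewrite ltnS ltnW.
Qed.

Lemma eq_nform l A B :
  (forall i j, (i <= l)%N -> (j <= l)%N -> A i j = B i j) ->
  nform l A = nform l B.
Proof.
elim: l => //= l IHl AB; congr (_ * _ * _).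
- apply: (@eq_rstring _ E l.+1) => i il; apply: eq_bigr => a _.
  by rewrite AB // -ltnS (leq_trans (ltn_ord a)) // ltnW.
- by apply: IHl => i j il jl; apply: AB; apply: leqW.
- apply: (@eq_lstring F l.+1) => j jl; apply: eq_bigr => b _.
  by rewrite AB // -ltnS (leq_trans (ltn_ord b)) // ltnW.
Qed.

Lemma sum_ord_trunc k (f : nat -> nat) : (k <= n)%N ->
  (forall i, (k <= i < n)%N -> f i = 0%N) ->
  (\sum_(i < n) f i = \sum_(i < k) f i)%N.
Proof.
move=> kn f0; rewrite -!(big_mkord xpredT) (@big_cat_nat _ _ _ k) //=.
by rewrite [X in (_ + X)%N = _]big_nat_cond [X in (_ + X)%N = _]big1 ?addn0 // => i /andP[/f0].
Qed.

(** Each factor takes one unit from the index [taken b i]. *)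
Lemma power_kill b i a w : (i.+1 < n)%N -> w (taken b i) < a%:Z ->
  X b i ^+ a * K w = 0.
Proof.
move=> i_n; elim: a w => [|a IHa] w wa.
  rewrite mul1r (pr_neg PR _ wa) //.
  by case: (b) => //=; apply: ltnW.
rewrite exprSr -mulrA (pr_shift PR) mulrA IHa ?mul0r //.
by rewrite /shift; case: b wa {IHa} => /=; lia.
Qed.

Lemma lstring_shift l m w :
  lstring F l m * K w =
  K (fun a => w a - (if (a < l)%N then (m a)%:Z else 0)
              + (if (0 < a <= l)%N then (m a.-1)%:Z else 0)) * lstring F l m.
Proof.
elim: l => [|l IHl] /=.
  rewrite mul1r mulr1; apply: (pr_ext PR) => a _.
  by case: a => [|a] //=; rewrite subr0 addr0.
have powS k w' : F l ^+ k * K w' =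
   K (fun a => w' a - k%:Z * ((a == l)%:Z - (a == l.+1)%:Z)) * F l ^+ k.
  elim: k w' => [|k IHk] w'.
    by rewrite mul1r mulr1; apply: (pr_ext PR) => a _; rewrite mul0r subr0.
  rewrite exprSr -mulrA (pr_shift PR) mulrA IHk -mulrA; congr (_ * _).
  by apply: (pr_ext PR) => a _; rewrite /shift; lia.
rewrite -mulrA IHl mulrA powS -mulrA; congr (_ * _).
apply: (pr_ext PR) => a _.
have [->|al] := eqVneq a l.
  rewrite ltnn ltnS leqnn leqnSn (ltn_eqF (ltnSn l)) andbT; lia.
have [->|al1] := eqVneq a l.+1.
  by rewrite !ltnn ltnNge leqnSn /= leqnn; lia.
have -> : (a < l.+1)%N = (a < l)%N by lia.
have -> : (a <= l.+1)%N = (a <= l)%N by lia.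
by rewrite mulr0 subr0.
Qed.

End NormalForms.

(** * Reduction of words to normal forms *)

Section Normalization.
Variables (R : pzRingType) (n : nat).
Variables (X : bool -> nat -> R) (K : (nat -> int) -> R).
Hypothesis PR : presented n X K.
Local Notation E := (X true).
Local Notation F := (X false).
Local Notation word := (word X).
Local Notation mono := (mono X).

Definition block l (A : nat -> nat -> nat) :=
  forall i j, i != j -> (l < i)%N || (l < j)%N -> A i j = 0%N.

(** Recovers from the exponents of the two strings, by taking differences, the
    last column and the last row of a matrix with one more index. The corner is
    what remains of the column sum [c]; it is a genuine entry if [m l <= c]. *)
Definition bordered l (A : nat -> nat -> nat) (m m' : nat -> nat) (c : nat) :=
  fun i j => if i == l.+1 then if j == l.+1 then (c - m l)%N
                  else if (j <= l)%N then (m' j - (if j is j'.+1 then m' j' else 0))%N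
                  else 0%N
             else if j == l.+1 then
                  if (i <= l)%N then (m i - (if i is i'.+1 then m i' else 0))%N else 0%N
             else A i j.

Lemma sum_differences l m i : weakly_incr l.+1 m -> (i <= l)%N ->
  (\sum_(a < i.+1) (m a - (if a : nat is a'.+1 then m a' else 0)) = m i)%N.
Proof.
move=> wi; elim: i => [|i IHi] il; first by rewrite big_ord1 subn0.
by rewrite big_ord_recr /= IHi 1?ltnW // subnKC // wi.
Qed.

Lemma nform_bordered l A m m' c :
  weakly_incr l.+1 m -> weakly_incr l.+1 m' ->
  nform X l.+1 (bordered l A m m' c) =
    rstring E l.+1 m * nform X l A * lstring F l.+1 m'.
Proof.
move=> wm wm'; rewrite [LHS]/=; congr (_ * _ * _).
- apply: (@eq_rstring _ E l.+1) => i il; rewrite -[RHS](@sum_differences l) //.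
  apply: eq_bigr => a _; have := ltn_ord a; rewrite /bordered => ai.
  have -> : (nat_of_ord a == l.+1) = false by lia.
  have -> : (nat_of_ord a <= l)%N by lia.
  by rewrite eqxx.
- apply: eq_nform => i j il jl; rewrite /bordered.
  have -> : (i == l.+1) = false by lia.
  by have -> : (j == l.+1) = false by lia.
- apply: (@eq_lstring _ F l.+1) => i il; rewrite -[RHS](@sum_differences l) //.
  apply: eq_bigr => a _; have := ltn_ord a; rewrite /bordered => ai.
  have -> : (nat_of_ord a == l.+1) = false by lia.
  have -> : (nat_of_ord a <= l)%N by lia.
  by rewrite eqxx.
Qed.

Lemma bordered_colsum l A m m' c j : (l.+1 < n)%N -> block l A ->
  weakly_incr l.+1 m -> (m l <= c)%N ->
  (\sum_(i < n) bordered l A m m' c i j =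
   if j == l.+1 then c else
   \sum_(i < n) A i j + (if j <= l then m' j - (if j is j'.+1 then m' j' else 0) else 0))%N.
Proof.
move=> ln bA wm mc; case: eqP => [->|/eqP jl].
  rewrite (sum_ord_trunc (k := l.+2) (f := (bordered l A m m' c)^~ l.+1)) //; last first.
    move=> i /andP[li _]; rewrite /bordered eqxx.
    have -> : (i == l.+1) = false by lia.
    by have -> : (i <= l)%N = false by lia.
  rewrite big_ord_recr /= {2}/bordered eqxx.
  rewrite (eq_bigr (fun a : 'I_l.+1 => m a - (if a : nat is a'.+1 then m a' else 0))%N).
    by rewrite (sum_differences wm) // subnKC.
  move=> a _; rewrite /bordered eqxx; have := ltn_ord a => al.
  have -> : (nat_of_ord a == l.+1) = false by lia.
  by have -> : (nat_of_ord a <= l)%N by lia.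
rewrite (bigD1 (Ordinal ln)) //= [in RHS](bigD1 (Ordinal ln)) //=.
rewrite {1}/bordered eqxx (negPf jl) (bA l.+1 j) ?leqnn //; last by rewrite eq_sym.
rewrite add0n addnC; congr (_ + _)%N; apply: eq_bigr => i /eqP il.
rewrite /bordered (negPf jl); case: eqP => // E1.
by case: il; apply: val_inj.
Qed.

Lemma bordered_block l A m m' c : block l A -> block l.+1 (bordered l A m m' c).
Proof.
move=> bA i j ij lij; rewrite /bordered.
case: eqP => [il|_]; last case: eqP => [jl|_].
- have -> : (j == l.+1) = false by apply/eqP => jl; rewrite il jl eqxx in ij.
  by have -> : (j <= l)%N = false by lia.
- by have -> : (i <= l)%N = false by lia.
- by apply: bA => //; lia.
Qed.

Lemma wshift_fix s w a : idx_lt a.-1 s -> wshift s w a = w a.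
Proof.
elim: s => //= x s IHs /andP[xl /IHs IH]; rewrite -[RHS]IH.
by rewrite /shift; case: (x.1); lia.
Qed.

Lemma mono_swap b u (i : nat) k : i \notin u ->
  X b i ^+ k * mono (~~ b) u = mono (~~ b) u * X b i ^+ k.
Proof.
move=> iu; apply/commr_sym/commrX/commr_sym.
elim: u iu => [_|j u IHu]; first by rewrite mono_nil; apply: commr1.
rewrite inE negb_or mono_cons => /andP[ij iu].
by apply: commrM (IHu iu); apply: pr_swap_neq PR _ _ _ ij.
Qed.

(** Sort the word into powers of [F_i] and of [E_i], in this order. If no pair
    cancels, all the [E_i] act first and there are not enough units at [i.+1]
    for them; otherwise the result is shorter. *)
Lemma power_reduce i a b w : (i.+1 < n)%N -> w i.+1 < a%:Z ->
  E i ^+ a * F i ^+ b * K w = 0 \/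
  exists a' b', (a' + b' < a + b)%N /\
    E i ^+ a * F i ^+ b * K w = F i ^+ b' * E i ^+ a' * K w.
Proof.
move=> i_n wa; pose s := nseq a (true, i) ++ nseq b (false, i).
have is' : idx_lt n.-1 s by rewrite /idx_lt all_cat !all_nseq /=; lia.
rewrite -!word_nseq -word_cat -/s.
case: (sort_word PR true w is') => [|[u [v [t [es ius ivs su sv]]]]]; first by left.
move: su sv; rewrite !count_cat !count_nseq /= mul1n mul0n add0n mul1n mul0n addn0 => su sv.
have eu : u = nseq (size u) i.
  apply/all_pred1P/allP => j /ius; rewrite mem_cat !mem_nseq /=.
  by rewrite !xpair_eqE /= andbF => /andP[].
have ev : v = nseq (size v) i.
  apply/all_pred1P/allP => j /ivs; rewrite mem_cat !mem_nseq /=.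
  by rewrite !xpair_eqE /= andbF orbF => /andP[].
rewrite es eu ev !mono_nseq /=; case: t su sv => [|t] su sv.
  left; rewrite -mulrA (power_kill PR) ?mulr0 //.
  by move: sv; rewrite addn0 => ->.
right; exists (size v), (size u); split; first by lia.
by [].
Qed.

Lemma count_sides b (s : seq (bool * nat)) :
  (count (fun x => x.1 != b) s + count (fun x => x.1 == b) s = size s)%N.
Proof. by rewrite addnC -(count_predC (fun x : bool * nat => x.1 == b) s). Qed.

(** Sort the word as a monomial in the [E_i] times one in the [F_i], split off
    the strings that contain the last letters [E l] and [F l], and apply
    induction on [l] to the middle. This gives a normal form if the corner
    entry is non-negative. If it is negative, sort the middle the other way;
    then the powers of [E l] and [F l] in the two strings can be brought
    together and shortened by [power_reduce], so that induction on the length of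
    the word applies. *)
Theorem word_nform l s w : (l < n)%N -> idx_lt l s ->
  word s * K w = 0 \/
  exists A, [/\ block l A, (forall j, (j < n)%N -> w j = (\sum_(i < n) A i j)%N%:Z)
    & word s * K w = nform X l A * K w].
Proof.
elim: l s w => [|l IHl] s w ln.
  case: s => // _; rewrite word_nil mul1r.
  have [/existsP[a wa]|/existsPn wpos] := boolP [exists a : 'I_n, w a < 0].
    by left; apply: (pr_neg PR (ltn_ord a) wa).
  right; exists (fun i j => if i == j then `|w j|%N else 0%N); split.
  - by move=> i j /negPf ->.
  - move=> j jn; rewrite (bigD1 (Ordinal jn)) //= eqxx big1 ?addn0.
      have := wpos (Ordinal jn); rewrite -leNgt /= => w0.
      by rewrite gez0_abs.
    by move=> i /eqP ij; case: eqP => // e; case: ij; apply: val_inj.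
  - by rewrite /= ?mul1r.
have [N] := ubnP (size s); elim: N s => // N IHN s; rewrite ltnS => sN ls.
have ls' : idx_lt n.-1 s by apply: sub_all ls => x /=; lia.
case: (sort_word PR false w ls') => [|[u [v [t [-> ius ivs su sv]]]]]; first by left.
have {ius} lu : all (fun i => i < l.+1)%N u.
  by apply/allP => i /ius /(allP ls).
have {ivs} lv : all (fun i => i < l.+1)%N v.
  by apply/allP => i /ivs /(allP ls).
have suv : (size u + size v <= N)%N.
  by apply: leq_trans sN; rewrite -(count_sides false) -su -sv; lia.
move: su sv => _ _.
have [m [u' [wm lu' -> su]]] := mono_E_rstring PR lu.
have [m' [v' [wm' lv' -> sv]]] := mono_F_lstring PR lv.
set U := rstring E _ _; set V := lstring F _ _.
pose W := map (pair true) u' ++ map (pair false) v'.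
have -> : U * mono true u' * (mono false v' * V) * K w = U * word W * V * K w.
  by rewrite word_cat !mulrA.
have sW : size W = (size u' + size v')%N by rewrite size_cat !size_map.
have lW : idx_lt l W.
  by rewrite /idx_lt all_cat !all_map lu' lv'.
have EV : V * K w = _ := lstring_shift PR l.+1 m' w.
move: EV; set w' := fun a => _; move=> EV.
have EUW : U * word W * V * K w = U * (word W * K w') * V.
  by rewrite -(mulrA _ V) EV (mulrA _ (K w')) -(mulrA U).
(* w' is the weight reached after the F-string has acted. *)
have [mle|mgt] := leP (m l)%:Z (w l.+1).
  rewrite EUW.
  case: (IHl W w' (ltnW ln) lW) => [->|[A [bA cA ->]]].
    by left; rewrite mulr0 mul0r.
  right; exists (bordered l A m m' `|w l.+1|%N); split.
  - exact: bordered_block.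
  - have wl : `|w l.+1|%N = w l.+1 :> int by rewrite gez0_abs //; lia.
    have mc : (m l <= `|w l.+1|%N)%N by lia.
    move=> j jn; rewrite bordered_colsum //.
    case: eqP => [->|/eqP jl]; first by rewrite wl.
    have := cA j jn; rewrite /w' ltnS => cj; rewrite PoszD -cj.
    case: (leqP j l) => jl2; last first.
      have -> : (j <= l.+1)%N = false by lia.
      by rewrite andbF; lia.
    case: j jn jl cj jl2 => [|j] jn jl cj jl2; first by rewrite /= ; lia.
    have := wm' j jl2; have -> : (j.+1 <= l.+1)%N by lia.
    by rewrite /=; lia.
  - rewrite nform_bordered // -/U -/V -(mulrA _ V) EV (mulrA _ (K w')).
    by rewrite (mulrA U).
have lW' : idx_lt n.-1 W by apply: sub_all lW => x /=; lia.
case: (sort_word PR true w' lW') => [e0|[u2 [v2 [t' [eW iu2 iv2 su2 sv2]]]]].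
  by left; rewrite EUW e0 mulr0 mul0r.
have sW2 : (size u2 + size v2 <= size W)%N.
  by rewrite -(count_sides true W) -su2 -sv2; lia.
have [sU [eU iU szU]] := rstring_word X true l m.
have [sV [eV iV szV]] := lstring_word X false l m'.
pose T := map (pair true) v2 ++ sV.
have lu2 : idx_lt l (map (pair false) u2).
  by rewrite /idx_lt all_map; apply/allP => i /iu2 /(allP lW).
have lv2 : idx_lt l (map (pair true) v2).
  by rewrite /idx_lt all_map; apply/allP => i /iv2 /(allP lW).
have Eu2 : E l ^+ m l * mono false u2 = mono false u2 * E l ^+ m l.
  by apply: (@mono_swap true); apply/negP => /iu2 /(allP lW); rewrite /= ltnn.
have Fv2 : mono true v2 * F l ^+ m' l = F l ^+ m' l * mono true v2.
  symmetry; apply: (@mono_swap false).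
  by apply/negP => /iv2 /(allP lW); rewrite /= ltnn.
have -> : U * word W * V * K w =
    word sU * mono false u2 * (E l ^+ m l * F l ^+ m' l * K (wshift T w)) * word T.
  have eUU : U = word sU * E l ^+ m l by rewrite -eU.
  have eVV : V = F l ^+ m' l * word sV by rewrite -eV.
  rewrite EUW eW -(mulrA U) -(mulrA _ (K w') V) -EV eVV eUU -!mulrA.
  rewrite (mulrA (E l ^+ m l)) Eu2 -!mulrA.
  congr (_ * (_ * (_ * _))).
  by rewrite !mulrA Fv2 -!mulrA -(word_shift PR) word_cat !mulrA.
(* The letters of T have index less than l and leave the weight at l.+1 alone. *)
have wT : wshift T w l.+1 = w l.+1.
  by apply: wshift_fix; rewrite /idx_lt /= all_cat; apply/andP.
have := @power_reduce l (m l) (m' l) (wshift T w) ln; rewrite wT => /(_ mgt).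
case=> [->|[a [b [ab ->]]]]; first by left; rewrite mulr0 mul0r.
pose s' := sU ++ map (pair false) u2 ++ nseq b (false, l) ++ nseq a (true, l) ++ T.
have -> : word sU * mono false u2 * (F l ^+ b * E l ^+ a * K (wshift T w)) * word T
    = word s' * K w.
  rewrite -(mulrA _ _ (word T)) -(mulrA (F l ^+ b * E l ^+ a)) -(word_shift PR).
  by rewrite !word_cat !word_nseq !mulrA.
apply: IHN.
  rewrite !size_cat !size_nseq !size_map szU szV.
  move: su sv suv ab sW2; rewrite sW !big_ord_recr /=; clear; lia.
have wid x : idx_lt l x -> all (fun x => x.2 < l.+1)%N x.
  by apply: sub_all => y /ltnW.
by rewrite /idx_lt !all_cat !all_nseq /= ltnSn !orbT !wid.
Qed.

End Normalization.

(** * Rank functions of orbit matrices *)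

Section PartialSums.
Variable n : nat.
Implicit Types (f g : 'I_n -> nat).

Definition psum f (i : nat) : nat := (\sum_(a < n | (a < i)%N) f a)%N.

Lemma psum0 f : psum f 0 = 0%N.
Proof. by rewrite /psum big_pred0. Qed.

Lemma psumS f (a : 'I_n) : psum f a.+1 = (psum f a + f a)%N.
Proof.
rewrite /psum (bigD1 a) ?ltnSn //= addnC; congr (_ + _)%N; apply: eq_bigl => b.
by rewrite ltnS [in RHS]ltn_neqAle andbC.
Qed.

Lemma psum_full f : psum f n = (\sum_a f a)%N.
Proof. by apply: eq_bigl => a; rewrite ltn_ord. Qed.

Lemma eq_psum f g i : f =1 g -> psum f i = psum g i.
Proof. by move=> fg; apply: eq_bigr. Qed.

Lemma psumD f g i : psum (fun a => f a + g a)%N i = (psum f i + psum g i)%N.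
Proof. exact: big_split. Qed.

Lemma psum_le f i j : (i <= j)%N -> (psum f i <= psum f j)%N.
Proof.
move=> ij; rewrite /psum [leqRHS](bigID (fun a : 'I_n => a < i)%N) /=.
rewrite [X in (_ <= X + _)%N](eq_bigl (fun a : 'I_n => (a < i)%N)) ?leq_addr // => a.
by case: (ltnP a i) => ai; rewrite ?andbF // (leq_trans ai ij).
Qed.

Lemma psum_eq_of_zero f i j : (i <= j)%N -> (forall a : 'I_n, (i <= a)%N -> f a = 0%N) ->
  psum f j = psum f i.
Proof.
move=> ij f0; rewrite /psum (bigID (fun a : 'I_n => a < i)%N) /=.
rewrite [X in (_ + X)%N]big1 ?addn0 => [|a]; last by rewrite -leqNgt => /andP[_ /f0].
apply: eq_bigl => a.
by case: (ltnP a i) => ai; rewrite ?andbF // (leq_trans ai ij).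
Qed.

Lemma psum_delta (a : 'I_n) i : psum (fun b => (b == a)%N : nat) i = (a < i)%N.
Proof.
rewrite /psum big_mkcond (bigD1 a) //= eqxx big1 ?addn0 => [|b /negPf ->].
  by case: ifP.
by rewrite if_same.
Qed.

End PartialSums.

Section Rank.
Variable n : nat.
Implicit Types M : 'M[nat]_n.

(** For the matrix of the orbit of [(f, f')] this is the dimension of the
    intersection of step [i] of [f] with step [j] of [f']. *)
Definition rk M (i j : nat) : nat := psum (fun a => psum (M a) j) i.

Lemma rk0l M j : rk M 0 j = 0%N. Proof. exact: psum0. Qed.

Lemma rk0r M i : rk M i 0 = 0%N.
Proof. by rewrite /rk /psum big1 // => a _; rewrite -/(psum _ _) psum0. Qed.

Lemma rkS M (a : 'I_n) j : rk M a.+1 j = (rk M a j + psum (M a) j)%N.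
Proof. exact: psumS. Qed.

Lemma rk_entry M (a b : 'I_n) :
  (rk M a.+1 b.+1 + rk M a b = rk M a b.+1 + rk M a.+1 b + M a b)%N.
Proof. by rewrite !rkS psumS; lia. Qed.

Lemma rk_lel M i i' j : (i <= i')%N -> (rk M i j <= rk M i' j)%N.
Proof. exact: psum_le. Qed.

Lemma rk_ler M i j j' : (j <= j')%N -> (rk M i j <= rk M i j')%N.
Proof. by move=> jj; apply: leq_sum => a _; apply: psum_le. Qed.

(** Non-negativity of the entries in the rows from [i] to [i'] and the columns
    from [j] to [j']. *)
Lemma rk_super M i i' j j' : (i <= i' <= n)%N -> (j <= j')%N ->
  (rk M i' j + rk M i j' <= rk M i' j' + rk M i j)%N.
Proof.
move=> /andP[ii' i'n] jj'; elim: i' ii' i'n => [|i' IHi].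
  by rewrite leqn0 => /eqP -> _; rewrite addnC.
rewrite leq_eqVlt ltnS => /predU1P[-> _|ii' i'n]; first by rewrite addnC.
have := IHi ii' (ltnW i'n); rewrite !(rkS _ (Ordinal i'n)) /=.
by have := @psum_le n (M (Ordinal i'n)) j j' jj'; lia.
Qed.

Lemma rk_full M : rk M n n = (\sum_i \sum_j M i j)%N.
Proof.
by rewrite /rk psum_full; apply: eq_bigr => a _; rewrite psum_full.
Qed.

Lemma rkD M (N : 'M[nat]_n) i j :
  rk (\matrix_(a, b) (M a b + N a b)%N) i j = (rk M i j + rk N i j)%N.
Proof.
rewrite /rk -psumD; apply: eq_psum => a; rewrite -psumD.
by apply: eq_psum => b; rewrite mxE.
Qed.

Definition dmx (x y : 'I_n) : 'M[nat]_n := \matrix_(a, b) ((a == x) && (b == y) : nat).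

Lemma rk_dmx x y i j : rk (dmx x y) i j = ((x < i) && (y < j))%N.
Proof.
rewrite /rk (eq_psum _ (g := fun a => (y < j) * (a == x)%N)%N); last first.
  move=> a; rewrite -(psum_delta y) mulnC /psum big_distrr /=.
  by apply: eq_bigr => b _; rewrite mxE mulnb.
by rewrite /psum -big_distrr /= -/(psum (fun a => (a == x)%N : nat) i) psum_delta mulnb andbC.
Qed.

Lemma rk_diag (f : 'I_n -> nat) i j :
  rk (\matrix_(a, b) (if a == b then f a else 0%N)) i j = minn (psum f i) (psum f j).
Proof.
have row a : psum ((\matrix_(a, b) (if a == b then f a else 0%N)) a) j =
    if (a < j)%N then f a else 0%N.
  rewrite (eq_psum _ (g := fun b => f a * (b == a))%N) => [|b].
    by rewrite /psum -big_distrr /= -/(psum _ _) psum_delta; case: ifP; lia.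
  by rewrite mxE eq_sym; case: eqP; lia.
have -> : minn (psum f i) (psum f j) = psum f (minn i j).
  by case: (leqP i j) => [|/ltnW] /(psum_le f) ij; [apply/minn_idPl | apply/minn_idPr].
rewrite /rk (eq_psum _ row) /psum -big_mkcondr /=.
by apply: eq_bigl => a; rewrite leq_min.
Qed.

Lemma rk_inj M (N : 'M[nat]_n) :
  (forall i j, (i <= n)%N -> (j <= n)%N -> rk M i j = rk N i j) -> M = N.
Proof.
move=> MN; apply/matrixP => a b.
have := rk_entry M a b; have := rk_entry N a b.
have ? := ltn_ord a; have ? := ltn_ord b.
by rewrite !MN; lia.
Qed.

End Rank.

Section OrbitMatrices.
Variables n r : nat.
Implicit Types (A B C D : orbmx n r) (d : dcomp n r).

Definition ork A := rk (nmx A).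

Lemma ork_full A : ork A n n = r.
Proof.
rewrite /ork rk_full -[RHS](eqP (valP A)); apply: eq_bigr => i _.
by apply: eq_bigr => j _; rewrite mxE.
Qed.

Lemma nmx_inj : injective (@nmx n r).
Proof.
move=> A B AB; apply/val_inj/matrixP => i j; apply: val_inj.
by have /matrixP/(_ i j) := AB; rewrite !mxE.
Qed.

Lemma ork_inj A B :
  (forall i j, (i <= n)%N -> (j <= n)%N -> ork A i j = ork B i j) -> A = B.
Proof. by move=> AB; apply/nmx_inj/rk_inj. Qed.

Lemma orbmx_of (M : 'M[nat]_n) : (\sum_i \sum_j M i j)%N = r ->
  exists A, nmx A = M.
Proof.
move=> sM; have Mr i j : (M i j <= r)%N.
  by rewrite -sM (bigD1 i) //= (bigD1 j) //= -addnA leq_addr.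
pose A : 'M['I_r.+1]_n := \matrix_(i, j) inord (M i j).
have EA i j : A i j = M i j :> nat by rewrite mxE inordK // ltnS.
have sA : (\sum_i \sum_j A i j)%N == r.
  by rewrite -[X in _ == X]sM; apply/eqP; do 2!apply: eq_bigr => ? _.
by exists (Sub A sA); apply/matrixP => i j; rewrite mxE SubK.
Qed.

Definition psd d i : nat := psum (part d) i.

Lemma psd_full d : psd d n = r.
Proof. by rewrite /psd psum_full; exact: (eqP (valP d)). Qed.

Lemma psd_le d m : (psd d m <= r)%N.
Proof.
rewrite -[X in (_ <= X)%N](psd_full d); case: (leqP m n) => [mn|/ltnW nm].
  exact: psum_le.
by rewrite /psd (psum_eq_of_zero nm) // => a; rewrite leqNgt ltn_ord.
Qed.

Lemma psd_inj d d' : (forall i, (i <= n)%N -> psd d i = psd d' i) -> d = d'.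
Proof.
move=> dd; apply/val_inj/ffunP => a; apply: val_inj.
rewrite -[LHS]/(part d a) -[RHS]/(part d' a).
have := psumS (part d) a; have := psumS (part d') a.
by rewrite -!/(psd _ _) !dd //; [lia | exact: ltnW].
Qed.

Lemma dcomp_of (f : 'I_n -> nat) : (\sum_a f a)%N = r -> exists d, part d =1 f.
Proof.
move=> sf; have fr a : (f a <= r)%N by rewrite -sf (bigD1 a) //= leq_addr.
pose d : {ffun 'I_n -> 'I_r.+1} := [ffun a => inord (f a)].
have Ed a : d a = f a :> nat by rewrite ffunE inordK // ltnS.
have sd : (\sum_a d a)%N == r by rewrite -[X in _ == X]sf; apply/eqP; exact: eq_bigr.
by exists (Sub d sd) => a; rewrite /part SubK Ed.
Qed.

Lemma row_dcomp A : exists d, forall i, psd d i = ork A i n.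
Proof.
have [d Ed] := @dcomp_of (fun a => psum (nmx A a) n)
  (etrans (esym (psum_full _)) (ork_full A)).
by exists d => i; apply: eq_psum => a.
Qed.

(** Let [f1, f, f2] be flags with [(f1, f)] in the orbit [A] and [(f, f2)] in the
    orbit [B]. The intersection of step [i] of [f1] with step [j] of [f2] contains
    the intersection of their traces on step [m] of [f], a space of dimension
    [ork B m n]. So its dimension is at least
    [ork A i m + ork B m j - ork B m n] for every [m], and it is the maximum over
    [m] if [f2] is generic: a product of matrices with sums replaced by maxima. *)
Definition tprod A B C := forall i j, (i <= n)%N -> (j <= n)%N ->
  (forall m, (m <= n)%N -> (ork A i m + ork B m j <= ork C i j + ork B m n)%N) /\
  (exists2 m, (m <= n)%N & (ork A i m + ork B m j = ork C i j + ork B m n)%N).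

Definition composable A B := forall m, (m <= n)%N -> ork A n m = ork B m n.

Lemma tprod_unique A B C C' : tprod A B C -> tprod A B C' -> C = C'.
Proof.
move=> P P'; apply: ork_inj => i j i_n j_n.
have [L [m mn E]] := P i j i_n j_n; have [L' [m' mn' E']] := P' i j i_n j_n.
by have := L m' mn'; have := L' m mn; lia.
Qed.

Lemma tprod_row A B C i : tprod A B C -> (i <= n)%N -> ork C i n = ork A i n.
Proof.
move=> P i_n; have [L [m mn E]] := P i n i_n (leqnn n).
by have := L n (leqnn n); have : (ork A i m <= ork A i n)%N := rk_ler _ _ mn; lia.
Qed.

Lemma tprod_col A B C j : tprod A B C -> composable A B -> (j <= n)%N ->
  ork C n j = ork B n j.
Proof.
move=> P AB jn; have [L [m mn E]] := P n j (leqnn n) jn.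
have := L n (leqnn n); have : (ork B m j <= ork B n j)%N := rk_lel _ _ mn.
by rewrite (AB _ mn) in E *; rewrite AB //; lia.
Qed.

(** Both sides are the maximum over pairs of middle indices. *)
Lemma tprod_assoc A B C D D' E E' :
  tprod A B D -> tprod D C E -> tprod B C D' -> tprod A D' E' -> E = E'.
Proof.
move=> ABD DCE BCD' AD'E'; apply: ork_inj => i j i_n j_n.
have rB m : (m <= n)%N -> ork D' m n = ork B m n := tprod_row BCD'.
have [L1 [m mn E1]] := DCE i j i_n j_n.
have [L2 [p pn E2]] := ABD i m i_n mn.
have [L3 [q qn E3]] := AD'E' i j i_n j_n.
have [L4 [s sn E4]] := BCD' q j qn j_n.
have [L5 _] := BCD' p j pn j_n; have [L6 _] := ABD i s i_n sn.
have := L5 m mn; have := L3 p pn; have := L6 q qn; have := L1 s sn.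
by rewrite !rB // in E3 *; lia.
Qed.

(** As far as dimensions are concerned, step [i] of the first flag contains all
    the steps of the middle flag up to step [u] and lies in step [u.+1]. By
    supermodularity of [ork B] the maximum over [m] is then attained at [u] or
    [u.+1]. *)
Lemma tprod_generic_row X B C i u t j : tprod X B C -> (i <= n)%N -> (j <= n)%N ->
  (forall m, (m <= n)%N -> ork X i m = minn t (ork B m n)) ->
  (u < n)%N -> (ork B u n <= t <= ork B u.+1 n)%N ->
  (ork C i j + ork B u.+1 n = maxn (ork B u j + ork B u.+1 n) (ork B u.+1 j + t))%N.
Proof.
move=> P i_n j_n EX un ut; have [L [m mn E]] := P i j i_n j_n.
have Lu := L u (ltnW un); have Lu1 := L u.+1 un.
rewrite !EX // in Lu Lu1 E; last by apply: ltnW.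
case: (leqP m u) => mu.
  have m1 : (ork B m j <= ork B u j)%N := rk_lel _ _ mu.
  have m2 : (ork B m n <= ork B u n)%N := rk_lel _ _ mu.
  by lia.
have umn : (u.+1 <= m <= n)%N by rewrite mu.
have m2 : (ork B u.+1 n <= ork B m n)%N := rk_lel _ _ mu.
have : (ork B m j + ork B u.+1 n <= ork B m n + ork B u.+1 j)%N := rk_super _ umn j_n.
by lia.
Qed.

End OrbitMatrices.

(** * Generators acting on rank functions *)

Section RankOperators.
Variable n : nat.
Implicit Type rho : nat -> nat -> nat.

(** Multiplying an orbit on the left by [e_i] or [f_i] changes step [i.+1] of its
    first flag and nothing else: [e_i] adds a generic line inside step [i.+2],
    and [f_i] passes to a generic hyperplane that contains step [i]. The value
    in column [j] is the generic dimension of the intersection with step [j] of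
    the second flag. *)
Definition op (b : bool) (i : nat) rho : nat -> nat -> nat := fun a j =>
  if a == i.+1 then
    if b then maxn (rho i.+1 j) (rho i.+2 j + (rho i.+1 n).+1 - rho i.+2 n)
    else maxn (rho i j) (rho i.+1 j).-1
  else rho a j.

Definition acts (b : bool) (i : nat) rho : bool :=
  if b then (rho i.+1 n < rho i.+2 n)%N else (rho i n < rho i.+1 n)%N.

(** The inequalities between adjacent rows of a rank function from which the
    relations follow. *)
Definition rank_fun rho :=
  [/\ forall i j, (i < n)%N -> (rho i j <= rho i.+1 j)%N
    & forall i j, (i < n)%N -> (j <= n)%N -> (rho i.+1 j + rho i n <= rho i.+1 n + rho i j)%N].

Lemma rank_fun_rk (M : 'M[nat]_n) : rank_fun (rk M).
Proof.
split=> [i j i_n|i j i_n jn]; first exact: rk_lel.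
have ii : (i <= i.+1 <= n)%N by rewrite leqnSn.
exact: (rk_super M ii jn).
Qed.

End RankOperators.

Section Descent.
Variables n r : nat.
Implicit Types (A B C : orbmx n r).

(** The measure that the descent to diagonal matrices lowers; one of the two
    truncated differences is zero. *)
Definition spread (M : 'M[nat]_n) : nat :=
  (\sum_(x : 'I_n * 'I_n) M x.1 x.2 * ((x.1 - x.2) + (x.2 - x.1)))%N.

Lemma move_entry B (x y q : 'I_n) : x != y -> (0 < nmx B x q)%N ->
  exists A, (forall i j, (ork A i j + ((x < i) && (q < j))
                          = ork B i j + ((y < i) && (q < j)))%N)
   /\ (spread (nmx A) + ((x - q) + (q - x)) = spread (nmx B) + ((y - q) + (q - y)))%N.
Proof.
have rB : rk (nmx B) n n = r := ork_full B.
move=> xy; rewrite /ork; move: (nmx B) rB => M rM Bxq.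
pose M' : 'M[nat]_n := \matrix_(a, b) (M a b - dmx x q a b + dmx y q a b)%N.
have EM : \matrix_(a, b) (M' a b + dmx x q a b)%N = \matrix_(a, b) (M a b + dmx y q a b)%N.
  apply/matrixP => a b; rewrite /M' !mxE.
  case: (eqVneq a x) => [->|_] /=; last by lia.
  case: (eqVneq b q) => [->|_] /=; last by rewrite andbF; lia.
  by rewrite (negPf xy) /=; move: Bxq; lia.
have Erk i j : (rk M' i j + ((x < i) && (q < j)) = rk M i j + ((y < i) && (q < j)))%N.
  by rewrite -!rk_dmx -!rkD EM.
have sM' : (\sum_i \sum_j M' i j)%N = r.
  by rewrite -rk_full; have := Erk n n; rewrite !ltn_ord /=; move: rM; lia.
have [A EA] := orbmx_of sM'; exists A; rewrite EA; split=> //.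
have sp (N : 'M[nat]_n) z : spread (\matrix_(a, b) (N a b + dmx z q a b)%N)
    = (spread N + ((z - q) + (q - z)))%N.
  rewrite /spread; under eq_bigr do rewrite mxE mulnDl.
  rewrite big_split /=; congr (_ + _)%N.
  rewrite (bigD1 (z, q)) //= mxE !eqxx mul1n big1 ?addn0 //.
  move=> [a b] /=; rewrite xpair_eqE negb_and mxE.
  by case: (a == z); case: (b == q).
by rewrite -!sp EM.
Qed.

Lemma row_tail_zero (M : 'M[nat]_n) (a : 'I_n) j : (j <= n)%N ->
  (forall b : 'I_n, (j <= b)%N -> M a b = 0%N) ->
  (rk M a.+1 n + rk M a j = rk M a.+1 j + rk M a n)%N.
Proof.
by move=> jn M0; rewrite !rkS (psum_eq_of_zero jn M0); lia.
Qed.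

Lemma row_head_zero (M : 'M[nat]_n) (a : 'I_n) j :
  (forall b : 'I_n, (b < j)%N -> M a b = 0%N) -> rk M a.+1 j = rk M a j.
Proof. by move=> M0; rewrite rkS /psum big1 ?addn0. Qed.

Lemma diagonal_rank B : (forall a b : 'I_n, a != b -> nmx B a b = 0%N) ->
  exists d : dcomp n r, forall i j, ork B i j = minn (psd d i) (psd d j).
Proof.
move=> B0; have [d Ed] := row_dcomp B.
have dB a : part d a = nmx B a a.
  have := psumS (part d) a; rewrite -!/(psd _ _) !Ed /ork rkS => /addnI <-.
  rewrite psum_full (bigD1 a) //= big1 ?addn0 // => b ba.
  by rewrite B0 // eq_sym.
exists d => i j; rewrite /ork -rk_diag; congr (rk _ i j).
by apply/matrixP => a b; rewrite [RHS]mxE; case: (eqVneq a b) => [<-|/B0].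
Qed.

(** If there are entries above the diagonal, take the last column that has one
    and in it the lowest such entry, and move a unit of it one row down. Since
    the row below has no entries further to the right, [e_i] undoes this move.
    If all the entries off the diagonal are below it, the first column and in it
    the highest entry do the same for [f_i]. *)
Lemma descent B :
  (exists d : dcomp n r, forall i j, ork B i j = minn (psd d i) (psd d j)) \/
  exists b (i : 'I_n.-1) A, [/\ (spread (nmx A) < spread (nmx B))%N, acts n b i (ork A)
    & forall a j, (a <= n)%N -> (j <= n)%N -> ork B a j = op n b i (ork A) a j].
Proof.
pose up (x : 'I_n * 'I_n) := (x.1 < x.2)%N && (0 < nmx B x.1 x.2)%N.
pose down (x : 'I_n * 'I_n) := (x.2 < x.1)%N && (0 < nmx B x.1 x.2)%N.
have [/existsP[x0 ux0]|/existsPn noup] := boolP [exists x, up x].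
  (* The weight n * column + row orders the positions by column, then by row. *)
  right; case: (@arg_maxnP _ x0 up (fun x => x.2 * n + x.1)%N ux0).
  move=> [lo q] /andP[/= loq Bq] mx.
  have hi_n : (lo.+1 < n)%N by apply: leq_ltn_trans loq (ltn_ord q).
  pose hi := Ordinal hi_n; have i_n : (lo < n.-1)%N by lia.
  have lohi : lo != hi by apply/eqP => /(congr1 val) /=; lia.
  have [A [EA sA]] := move_entry lohi Bq.
  have tail (b : 'I_n) : (q < b)%N -> nmx B hi b = 0%N.
    move=> qb; apply/eqP; rewrite -leqn0 leqNgt; apply/negP => Bb.
    have := mx (hi, b); rewrite /up /= Bb andbT => /(_ (leq_ltn_trans loq qb)).
    have := ltn_ord lo; nia.
  exists true, (Ordinal i_n), A; split.
  - by rewrite /= in sA; lia.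
  - rewrite /acts /=; have := EA lo.+1 n; have := EA lo.+2 n; rewrite /= ltnSn ltn_ord.
    have := rk_lel (nmx B) n (leqnSn lo.+1); rewrite -!/(ork B _ _).
    have -> : (lo < lo.+2)%N by lia.
    by rewrite ltnSn ltnn /=; lia.
  - move=> a j an jn; rewrite /op /=; have := EA a j; case: eqP => [->|/eqP al].
      have := EA lo.+2 j; have := EA lo.+1 n; have := EA lo.+2 n.
      rewrite /= !ltnSn ltn_ord ltnn.
      have -> : (lo < lo.+2)%N by lia.
      have lohi2 : (lo.+1 <= lo.+2 <= n)%N by rewrite leqnSn.
      have := rk_super (nmx B) lohi2 jn; rewrite -!/(ork B _ _) /=.
      case: (ltnP q j) => qj /=; last by lia.
      have := @row_tail_zero (nmx B) hi j jn; rewrite -!/(ork B _ _) /=.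
      by move=> /(_ (fun b jb => tail b (leq_trans qj jb))); lia.
    have -> : (hi < a)%N = (lo < a)%N by rewrite /=; lia.
    by lia.
have [/existsP[x0 dx0]|/existsPn nodown] := boolP [exists x, down x].
  right; case: (@arg_minnP _ x0 down (fun x => x.2 * n + x.1)%N dx0).
  move=> [hi q] /andP[/= qhi Bq] mn.
  have lo_n : (hi.-1 < n)%N by have := ltn_ord hi; lia.
  pose lo := Ordinal lo_n; have i_n : (lo < n.-1)%N by have := ltn_ord hi; rewrite /=; lia.
  have hlo : hi = lo.+1 :> nat by rewrite /=; lia.
  have hilo : hi != lo by apply/eqP => /(congr1 val) /=; lia.
  have [A [EA sA]] := move_entry hilo Bq.
  have head (b : 'I_n) : (b < q)%N -> nmx B lo b = 0%N.
    move=> bq; apply/eqP; rewrite -leqn0 leqNgt; apply/negP => Bb.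
    have := mn (lo, b); rewrite /down Bb andbT.
    have blo : (b < lo)%N by rewrite /=; lia.
    move=> /(_ blo) /=; have := ltn_ord hi; nia.
  exists false, (Ordinal i_n), A; split.
  - by rewrite /= in sA; lia.
  - rewrite /acts; have := EA lo n; have := EA lo.+1 n.
    have := rk_lel (nmx B) n (leqnSn lo); rewrite -!/(ork B _ _) hlo ltn_ord !ltnn ltnSn.
    have -> : (lo.+1 < lo)%N = false by lia.
    by rewrite /=; lia.
  - move=> a j an jn; rewrite /op; have := EA a j; case: eqP => [->|/eqP al].
      have := EA lo j; rewrite hlo ltnSn !ltnn.
      have -> : (lo.+1 < lo)%N = false by lia.
      have := rk_lel (nmx B) j (leqnSn lo); rewrite -!/(ork B _ _) /=.
      case: (ltnP q j) => qj; first by rewrite /=; lia.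
      have := @row_head_zero (nmx B) lo j (fun b bj => head b (leq_trans bj qj)).
      by rewrite -!/(ork B _ _) /=; lia.
    have -> : (lo < a)%N = (hi < a)%N by move: al; rewrite /=; lia.
    by lia.
left; apply: diagonal_rank => a b ab; apply/eqP; rewrite -leqn0 leqNgt; apply/negP => Bab.
have := noup (a, b); have := nodown (a, b); rewrite /up /down /= Bab !andbT -!leqNgt.
by move=> h1 h2; case/eqP: ab; apply/val_inj/anti_leq/andP.
Qed.

End Descent.

(** * Relative positions of flags *)

Section RelativePosition.
Variables (n : nat) (k : closedFieldType) (V : vectType k).
Implicit Types (f g : flag n V) (U W : {vspace V}).

(** Steps indexed by natural numbers, so that [i] and [i.+1] have the same type. *)
Definition st f (i : nat) : {vspace V} := step f (inord i).

Lemma step_st f (i : 'I_n.+1) : step f i = st f i.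
Proof. by rewrite /st inord_val. Qed.

Lemma st0 f : st f 0 = 0%VS.
Proof.
have /and3P[/eqP f0 _ _] := valP f; rewrite /st -[RHS]f0; congr (step f _).
by apply: val_inj; rewrite /= inordK.
Qed.

Lemma st_full f : st f n = fullv.
Proof.
have /and3P[_ /eqP f0 _] := valP f; rewrite /st -[RHS]f0; congr (step f _).
by apply: val_inj; rewrite /= inordK.
Qed.

Lemma st_stepS f i : (i < n)%N -> (st f i <= st f i.+1)%VS.
Proof.
move=> i_n; have /and3P[_ _ /forallP/(_ (Ordinal i_n))] := valP f.
rewrite -!/(step f _) !step_st /=; congr (_ <= st f _)%VS.
Qed.

Lemma st_le f i j : (i <= j <= n)%N -> (st f i <= st f j)%VS.
Proof.
move=> /andP[ij jn]; elim: j ij jn => [|j IHj]; first by rewrite leqn0 => /eqP->.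
rewrite leq_eqVlt ltnS => /predU1P[->//|ij] jn.
by apply: subv_trans (IHj ij (ltnW jn)) (st_stepS f jn).
Qed.

Lemma flag_of (W : nat -> {vspace V}) : W 0%N = 0%VS -> W n = fullv ->
  (forall i, (i < n)%N -> (W i <= W i.+1)%VS) ->
  exists f, forall i, (i <= n)%N -> st f i = W i.
Proof.
move=> W0 Wn WS; pose f := [ffun i : 'I_n.+1 => W i].
have Pf : is_flag f.
  rewrite /is_flag !ffunE W0 Wn !eqxx /=; apply/forallP => i.
  by rewrite !ffunE /= WS.
by exists (Sub f Pf) => i i_n; rewrite /st /step SubK ffunE inordK.
Qed.

Definition dcap f g i j : nat := \dim (st f i :&: st g j).

(** As [V_i] meets [V_{i+1} :&: V'_j] in [V_i :&: V'_j], the dimension of the sum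
    of these two spaces is given by those of intersections alone; so an entry of
    the matrix is a second difference of dimensions of intersections. *)
Lemma dcap_relpos f g (i j : 'I_n) :
  (dcap f g i.+1 j.+1 + dcap f g i j
   = dcap f g i j.+1 + dcap f g i.+1 j + relpos f g i j)%N.
Proof.
rewrite mxE !step_st /= /bump leq0n !add1n /dcap.
set U := st f i; set U' := st f i.+1; set W := st g j; set W' := st g j.+1.
have UU' : (U <= U')%VS by apply: st_stepS.
have WW' : (W <= W')%VS by apply: st_stepS.
have E T : (U :&: (U' :&: T) = U :&: T)%VS by rewrite capvA (capv_idPl UU').
have := dimv_sum_cap U (U' :&: W'); have := dimv_sum_cap U (U' :&: W).
have : (\dim (U + U' :&: W) <= \dim (U + U' :&: W'))%N.
  by apply/dimvS/addvS/capvS => //; apply: subvv.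
by rewrite !E; lia.
Qed.

Lemma relpos_rk f g (M : 'M[nat]_n) :
  relpos f g = M <->
  (forall i j, (i <= n)%N -> (j <= n)%N -> dcap f g i j = rk M i j).
Proof.
split=> [<-|H]; last first.
  apply/matrixP => i j; have := dcap_relpos f g i j; have := rk_entry M i j.
  have ? := ltn_ord i; have ? := ltn_ord j.
  by rewrite !H; lia.
elim=> [|i IHi] j i_n jn; first by rewrite rk0l /dcap st0 cap0v dimv0.
elim: j jn => [|j IHj] jn; first by rewrite rk0r /dcap st0 capv0 dimv0.
have := dcap_relpos f g (Ordinal i_n) (Ordinal jn).
have := rk_entry (relpos f g) (Ordinal i_n) (Ordinal jn); rewrite /=.
by rewrite IHj 1?ltnW // !IHi // 1?ltnW //; lia.
Qed.

(** Inside step [m] of [g], the traces of the two outer steps meet in a subspace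
    of their intersection. *)
Lemma dcap_triangle f g h i m j :
  (dcap f g i m + dcap g h m j <= dcap f h i j + \dim (st g m))%N.
Proof.
rewrite /dcap; set A := st f i; set B := st g m; set C := st h j.
have := dimv_sum_cap (A :&: B) (B :&: C).
have : (\dim (A :&: B + B :&: C) <= \dim B)%N.
  by apply: dimvS; rewrite subv_add capvSl capvSr.
have : (\dim ((A :&: B) :&: (B :&: C)) <= \dim (A :&: C))%N.
  by apply: dimvS; rewrite capvS ?capvSl ?capvSr.
by lia.
Qed.

Lemma dcap_dimr f g j : (j <= n)%N -> dcap f g n j = \dim (st g j).
Proof. by move=> jn; rewrite /dcap st_full capfv. Qed.

Lemma dcap_diml f g i : (i <= n)%N -> dcap f g i n = \dim (st f i).
Proof. by move=> i_n; rewrite /dcap st_full capvf. Qed.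

Lemma same_orbitP (p q : flag n V * flag n V) : same_orbit p q <->
  exists2 g : 'End(V), lker g = 0%VS &
    forall i, (i <= n)%N -> (g @: st p.1 i)%VS = st q.1 i /\
                            (g @: st p.2 i)%VS = st q.2 i.
Proof.
split=> -[g g0 Hg]; exists g => // i; last by rewrite !step_st; apply: Hg; rewrite -ltnS.
by move=> _; have := Hg (inord i).
Qed.

Lemma same_orbit_refl (p : flag n V * flag n V) : same_orbit p p.
Proof.
exists \1%VF; last by move=> i; rewrite !lim1g.
by apply/eqP/lker0P => u v; rewrite !id_lfunE.
Qed.

Lemma dcap_lim (g : 'End(V)) f h f' h' i j : lker g = 0%VS ->
  (g @: st f i)%VS = st f' i -> (g @: st h j)%VS = st h' j ->
  dcap f h i j = dcap f' h' i j.
Proof.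
move=> /eqP g0 fi hj; rewrite /dcap -fi -hj -lker0_img_cap //.
by rewrite limg_dim_eq // (eqP g0) capv0.
Qed.

Lemma same_orbit_relpos (p q : flag n V * flag n V) : same_orbit p q ->
  relpos p.1 p.2 = relpos q.1 q.2.
Proof.
move=> /same_orbitP[g g0 Hg]; symmetry; apply/relpos_rk => i j i_n jn.
rewrite -(proj1 (relpos_rk p.1 p.2 _) erefl) //.
by rewrite (dcap_lim g0 (proj1 (Hg i i_n)) (proj2 (Hg j jn))).
Qed.

(** A complement of what lies in earlier steps; the steps of both flags are sums
    of these pieces. *)
Definition piece f g (x : 'I_n * 'I_n) : {vspace V} :=
  (st f x.1.+1 :&: st g x.2.+1)
   :\: (st f x.1 :&: st g x.2.+1 + st f x.1.+1 :&: st g x.2).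

Lemma piece_split f g (i j : 'I_n) :
  (st f i.+1 :&: st g j.+1 =
   piece f g (i, j) + (st f i :&: st g j.+1 + st f i.+1 :&: st g j))%VS.
Proof.
rewrite addv_diff /=; apply/esym/addv_idPl.
by rewrite subv_add !capvS ?subvv ?st_stepS.
Qed.

Lemma dim_piece f g (x : 'I_n * 'I_n) : \dim (piece f g x) = relpos f g x.1 x.2.
Proof.
case: x => i j /=; have := dcap_relpos f g i j; rewrite /dcap /=.
set U := st f i; set U' := st f i.+1; set W := st g j; set W' := st g j.+1.
have UU' : (U <= U')%VS by apply: st_stepS.
have WW' : (W <= W')%VS by apply: st_stepS.
have E : ((U :&: W') :&: (U' :&: W) = U :&: W)%VS.
  apply/eqP; rewrite eqEsubv !subv_cap !capvSl !capvSr.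
  rewrite (subv_trans (capvSl _ _)) ?capvSl // (subv_trans (capvSr _ _)) ?capvSr //=.
  by rewrite (subv_trans (capvSr _ _) WW') (subv_trans (capvSl _ _) UU').
have := dimv_sum_cap (U :&: W') (U' :&: W); rewrite E.
have S : (U :&: W' + U' :&: W <= U' :&: W')%VS.
  by rewrite subv_add !capvS ?subvv.
have := dimv_cap_compl (U' :&: W') (U :&: W' + U' :&: W).
by rewrite (capv_idPr S) -/(piece f g (i, j)); lia.
Qed.

Lemma cap_pieces f g i j : (i <= n)%N -> (j <= n)%N ->
  (st f i :&: st g j =
   \sum_(x : 'I_n * 'I_n | (x.1 < i)%N && (x.2 < j)%N) piece f g x)%VS.
Proof.
elim: i j => [|i IHi] j i_n jn; first by rewrite st0 cap0v big_pred0.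
elim: j jn => [|j IHj] jn.
  by rewrite st0 capv0 big_pred0 // => x; rewrite andbF.
rewrite (piece_split f g (Ordinal i_n) (Ordinal jn)) /= IHj 1?ltnW // IHi ?(ltnW i_n) //.
apply/eqP; rewrite eqEsubv !subv_add; apply/andP; split.
  apply/and3P; split.
  - by apply: (sumv_sup (Ordinal i_n, Ordinal jn)); rewrite ?subvv //= !ltnSn.
  - apply/subv_sumP => x /andP[xi xj]; apply: (sumv_sup x); rewrite ?subvv //.
    by rewrite ltnS (ltnW xi).
  - apply/subv_sumP => x /andP[xi xj]; apply: (sumv_sup x); rewrite ?subvv //.
    by rewrite xi ltnS (ltnW xj).
apply/subv_sumP => x /andP[]; rewrite !ltnS => xi xj.
move: (xi) (xj); rewrite leq_eqVlt => /predU1P[xi1|xi1].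
  rewrite leq_eqVlt => /predU1P[xj1|xj1].
    have -> : x = (Ordinal i_n, Ordinal jn).
      by case: x xi1 xj1 {xi xj} => a b /= *; congr (_, _); apply: val_inj.
    exact: addvSl.
  apply: subv_trans (addvSr _ _); apply: subv_trans (addvSr _ _).
  by apply: (sumv_sup x); rewrite ?subvv // ltnS xi.
move=> _; apply: subv_trans (addvSr _ _); apply: subv_trans (addvSl _ _).
by apply: (sumv_sup x); rewrite ?subvv // xi1.
Qed.

Lemma pieces_full f g : (\sum_(x : 'I_n * 'I_n) piece f g x = fullv)%VS.
Proof.
rewrite -[RHS](capvv fullv) -{1}(st_full f) -(st_full g) cap_pieces //.
by apply: eq_bigl => x; rewrite !ltn_ord.
Qed.

(** The dimensions of the pieces are the entries of the matrix, and these add up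
    to [\dim V]. *)
Lemma pieces_direct f g : directv (\sum_(x : 'I_n * 'I_n) piece f g x).
Proof.
rewrite directvE /= pieces_full; apply/eqP.
under [RHS]eq_bigr do rewrite dim_piece.
rewrite -(pair_bigA _ (fun i j => relpos f g i j)) /= -rk_full.
rewrite -(proj1 (relpos_rk f g _) erefl) //.
by rewrite /dcap !st_full capvv.
Qed.

(** A linear map that sends a basis of each piece of the one pair to a basis of
    the corresponding piece of the other. *)
Theorem relpos_transitive (p q : flag n V * flag n V) :
  relpos p.1 p.2 = relpos q.1 q.2 -> same_orbit p q.
Proof.
move=> pq; pose P x := piece p.1 p.2 x; pose Q x := piece q.1 q.2 x.
have dPQ x : \dim (P x) = \dim (Q x) by rewrite !dim_piece pq.
pose b := \big[cat/[::]]_(x : 'I_n * 'I_n) (vbasis (P x) : seq V).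
pose c := \big[cat/[::]]_(x : 'I_n * 'I_n) (vbasis (Q x) : seq V).
have bP : basis_of fullv b.
  rewrite -(pieces_full p.1 p.2); apply: bigcat_basis; first exact: pieces_direct.
  by move=> x _; apply: vbasisP.
have Ef F : \big[cat/[::]]_(x : 'I_n * 'I_n) (F x : seq V) =
    flatten [seq F x | x <- index_enum ('I_n * 'I_n)%type].
  by rewrite /flatten foldrE big_map.
have [h Hh] := linear_of_free b c.
have shE F G (s : seq ('I_n * 'I_n)) : (forall x, size (F x : seq V) = size (G x : seq V)) ->
    shape [seq F x | x <- s] = shape [seq G x | x <- s].
  by move=> FG; rewrite /shape -!map_comp; apply: eq_map.
have szbc : size c = size b.
  rewrite /b /c !Ef !size_flatten (shE _ (fun x => vbasis (P x))) // => x.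
  by rewrite !size_tuple dPQ.
have {}Hh := Hh (basis_free bP) szbc.
have hv x : map h (vbasis (P x)) = vbasis (Q x).
  have : flatten [seq map h (vbasis (P x)) | x <- index_enum ('I_n * 'I_n)%type]
       = flatten [seq (vbasis (Q x) : seq V) | x <- index_enum ('I_n * 'I_n)%type].
    by rewrite -Ef -/c -Hh /b Ef map_flatten -map_comp.
  move/eq_from_flatten_shape => H; have {}H := H _.
  suff /H/eq_in_map : shape [seq map h (vbasis (P x)) | x <- index_enum ('I_n * 'I_n)%type]
    = shape [seq (vbasis (Q x) : seq V) | x <- index_enum ('I_n * 'I_n)%type].
    by apply; rewrite mem_index_enum.
  by apply: shE => y; rewrite size_map !size_tuple dPQ.
pose g := linfun h.
have gP x : (g @: P x = Q x)%VS.
  rewrite -(span_basis (vbasisP (P x))) limg_span -(span_basis (vbasisP (Q x))).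
  by rewrite -hv; congr <<_>>%VS; apply: eq_map => v; rewrite lfunE.
have gst i j : (i <= n)%N -> (j <= n)%N ->
    (g @: (st p.1 i :&: st p.2 j) = st q.1 i :&: st q.2 j)%VS.
  by move=> i_n jn; rewrite !cap_pieces // limg_sum; apply: eq_bigr => x _; apply: gP.
apply/same_orbitP; exists g.
  have := limg_ker_dim g fullv; rewrite capfv.
  have := gst n n (leqnn n) (leqnn n); rewrite !st_full capvv => ->.
  move=> /eqP; rewrite -[X in _ == X]add0n eqn_add2r dimv_eq0 => /eqP //.
move=> i i_n; have := gst i n i_n (leqnn n); have := gst n i (leqnn n) i_n.
by rewrite !st_full !capvf !capfv.
Qed.

End RelativePosition.

(** * Flags in generic position *)

Section Avoidance.
Variables (k : closedFieldType) (V : vectType k).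
Implicit Types (U W T : {vspace V}).

Lemma fresh_scalar (s : seq k) : exists t, t \notin s.
Proof.
have : \prod_(a <- s) ('X - a%:P) != 0 :> {poly k}.
  by rewrite monic_neq0 // monic_prod_XsubC.
by case/closed_nonrootP => t; rewrite root_prod_XsubC; exists t.
Qed.

Lemma line_avoid (S : seq {vspace V}) (v w : V) :
  (forall U, U \in S -> w \notin U) ->
  exists bad : seq k, forall t, t \notin bad -> forall U, U \in S -> w + t *: v \notin U.
Proof.
elim: S => [|U S IHS] wS; first by exists [::].
have [|bad Hbad] := IHS; first by move=> W WS; apply: wS; rewrite inE WS orbT.
have [[t0 wt0]|no] := pselect (exists t, w + t *: v \in U); last first.
  exists bad => t tb W; rewrite inE => /predU1P[->|]; last exact: Hbad.
  by apply/negP => wt; apply: no; exists t.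
exists (t0 :: bad) => t; rewrite inE negb_or => /andP[tt0 tb] W.
rewrite inE => /predU1P[->|]; last exact: Hbad.
apply/negP => wt; have /negP := wS U (mem_head _ _); apply.
have : (t - t0) *: v \in U.
  have -> : (t - t0) *: v = (w + t *: v) - (w + t0 *: v).
    by rewrite scalerBl opprD addrACA subrr add0r.
  exact: rpredB.
rewrite rpredZeq subr_eq0 (negPf tt0) /= => vU.
by have := rpredB wt0 (rpredZ t0 vU); rewrite addrK.
Qed.

(** A vector space over an infinite field is not a finite union of proper
    subspaces: a line through a vector outside all the subspaces but [U], in a
    direction outside [U], meets each of them in at most one point. *)
Lemma avoid_subspaces T (S : seq {vspace V}) :
  (forall U, U \in S -> ~~ (T <= U)%VS) ->
  exists2 w, w \in T & forall U, U \in S -> w \notin U.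
Proof.
elim: S => [|U S IHS] TS; first by exists 0; rewrite ?mem0v.
have [|w wT wS] := IHS; first by move=> W WS; apply: TS; rewrite inE WS orbT.
have [wU|wU] := boolP (w \in U); last first.
  by exists w => // W; rewrite inE => /predU1P[->|/wS].
have /subvPn[v vT vU] := TS U (mem_head _ _).
have [bad Hbad] := line_avoid v wS.
have [t] := fresh_scalar (0 :: bad); rewrite inE negb_or => /andP[t0 tb].
exists (w + t *: v); first by rewrite rpredD ?rpredZ.
move=> W; rewrite inE => /predU1P[->|]; last exact: Hbad.
by rewrite rpredDl // rpredZeq (negPf t0).
Qed.

Lemma cap_add_line U W w : w \notin (U + W)%VS -> ((U + <[w]>) :&: W = U :&: W)%VS.
Proof.
move=> wUW; apply/eqP; rewrite eqEsubv; apply/andP; split; last first.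
  by rewrite capvS ?addvSl ?subvv.
apply/subvP => x /memv_capP[/memv_addP[u uU [_ /vlineP[c ->] ->]] xW].
rewrite memv_cap xW andbT.
have [->|c0] := eqVneq c 0; first by rewrite scale0r addr0.
case/negP: wUW; have : c *: w \in (U + W)%VS.
  have -> : c *: w = - u + (u + c *: w) by rewrite addrA addNr add0r.
  by rewrite memv_add // rpredN.
by rewrite rpredZeq (negPf c0).
Qed.

Lemma dim_add_line U w : w \notin U -> \dim (U + <[w]>)%VS = (\dim U).+1.
Proof.
move=> wU; have w0 : w != 0 by apply: contraNneq wU => ->; rewrite mem0v.
have := dimv_sum_cap U <[w]>; rewrite dim_vline w0 addn1.
have -> : (U :&: <[w]> = 0)%VS; last by rewrite dimv0 addn0.
rewrite capvC -[X in (X :&: _)%VS]add0v cap_add_line ?cap0v //.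
by rewrite add0v.
Qed.

End Avoidance.

Section GenericFlag.
Variables (n : nat) (k : closedFieldType) (V : vectType k).
Variables (f1 f : flag n V).
Local Notation U := (st f1).
Local Notation T := (st f).

(** Equality in the inequality [dcap_triangle] for at least one [m'], so that the
    intersection of [U i] with [W j] is as small as the middle flag permits. *)
Definition generic_upto m (W : nat -> {vspace V}) := forall i j,
  (i <= n)%N -> (j <= n)%N -> exists2 m', (m' <= m)%N &
  (\dim (U i :&: T m') + \dim (W j :&: T m') = \dim (U i :&: W j) + \dim (T m'))%N.

Definition filtration_in m (W : nat -> {vspace V}) :=
  [/\ W 0%N = 0%VS, (forall j, (j < n)%N -> (W j <= W j.+1)%VS)
    & forall j, (j <= n)%N -> (W j <= T m)%VS].

Lemma filtration_le m W i j : filtration_in m W -> (i <= j <= n)%N -> (W i <= W j)%VS.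
Proof.
move=> [_ WS _] /andP[ij jn]; elim: j ij jn => [|j IHj]; first by rewrite leqn0 => /eqP->.
rewrite leq_eqVlt ltnS => /predU1P[->//|ij] jn.
by apply: subv_trans (IHj ij (ltnW jn)) (WS j jn).
Qed.

(** The vector added to the steps of [W] after [b] avoids step [m] of the middle
    flag plus [W n], so that the earlier intersections stay unchanged. It also
    avoids every [U i :&: T m.+1 + W j] that is not all of [T m.+1], so that
    [U i :&: W j] grows only when those two spaces already span [T m.+1]; that is
    the case of equality for [m' = m.+1]. *)
Lemma generic_add_line m W (b : 'I_n) : (m < n)%N ->
  filtration_in m.+1 W -> generic_upto m.+1 W ->
  ~~ (T m.+1 <= T m + W n)%VS ->
  exists W', [/\ filtration_in m.+1 W', generic_upto m.+1 W',
    (forall m' j, (m' <= m)%N -> (j <= n)%N -> (W' j :&: T m' = W j :&: T m')%VS)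
    & forall j, (j <= n)%N -> \dim (W' j) = (\dim (W j) + (b < j))%N].
Proof.
move=> mn FW GW nTW; have [W0 WS WT] := FW.
pose C i := (U i :&: T m.+1)%VS.
pose S := (T m + W n)%VS :: [seq X <- [seq (C ij.1 + W ij.2)%VS |
  ij <- allpairs pair (iota 0 n.+1) (iota 0 n.+1)] | ~~ (T m.+1 <= X)%VS].
have [|w wT wS] := @avoid_subspaces _ _ (T m.+1) S.
  by move=> X; rewrite inE mem_filter => /predU1P[->//|/andP[]].
have wTW : w \notin (T m + W n)%VS by apply: wS; apply: mem_head.
have wC i j : (i <= n)%N -> (j <= n)%N ->
    ~~ (T m.+1 <= C i + W j)%VS -> w \notin (C i + W j)%VS.
  move=> i_n jn nT; apply: wS; rewrite inE mem_filter nT; apply/orP; right.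
  by apply/mapP; exists (i, j) => //; apply/allpairsP; exists (i, j); rewrite !mem_iota.
have wW j : (j <= n)%N -> w \notin W j.
  move=> jn; apply: contra wTW => wWj; apply: subvP (addvSr _ _) _ _.
  by apply: subvP _ _ wWj; apply: filtration_le FW _; rewrite jn /=.
pose W' j := if (b < j)%N then (W j + <[w]>)%VS else W j.
have W'T j : (j <= n)%N -> (W' j <= T m.+1)%VS.
  by move=> jn; rewrite /W'; case: ifP => _; rewrite ?subv_add WT //= -memvE.
have W'cap m' j : (m' <= m)%N -> (j <= n)%N -> (W' j :&: T m' = W j :&: T m')%VS.
  move=> m'm jn; rewrite /W'; case: ifP => // _; apply: cap_add_line.
  apply: contra wTW; apply/subvP; rewrite addvC addvS //; first by apply: st_le; rewrite m'm ltnW.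
  by apply: filtration_le FW _; rewrite jn /=.
exists W'; split=> //.
- split=> //.
  move=> j jn; rewrite /W'; case: (ltnP b j) => bj.
    by rewrite ltnS (ltnW bj) addvS ?subvv ?WS.
  by case: ifP => _; last exact: WS; apply: subv_trans (WS j jn) (addvSl _ _).
- move=> i j i_n jn; rewrite /W'; case: ifP => bj; last exact: GW.
  have := W'T j jn; have := W'cap _ j _ jn; rewrite /W' bj => {}W'cap {}W'T.
  have UC Y : (Y <= T m.+1)%VS -> (U i :&: Y = C i :&: Y)%VS.
    by move=> YT; rewrite /C -capvA (capv_idPr YT).
  have [TC|nTC] := boolP (T m.+1 <= C i + W j)%VS.
    exists m.+1; rewrite // (capv_idPl W'T) (UC _ W'T) -/(C i).
    rewrite -(dimv_sum_cap (C i)) addnC; congr (_ + \dim _)%N.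
    apply/eqP; rewrite eqEsubv subv_add capvSr W'T /=.
    by apply: subv_trans TC _; rewrite addvS ?subvv ?addvSl.
  have wCW := wC i j i_n jn nTC.
  have E : (U i :&: (W j + <[w]>) = U i :&: W j)%VS.
    by rewrite !UC ?WT // capvC cap_add_line 1?addvC // capvC.
  rewrite E; have [m' m'm Em'] := GW i j i_n jn; exists m' => //.
  move: m'm; rewrite leq_eqVlt ltnS => /predU1P[m'E|m'm]; last by rewrite W'cap.
  case/negP: nTC; rewrite m'E in Em'.
  have CT : (C i + W j <= T m.+1)%VS by rewrite subv_add capvSr WT.
  have := dimv_leqif_eq CT; move=> [_ /esym]; rewrite eqEsubv CT /= => ->.
  have := dimv_sum_cap (C i) (W j); rewrite -UC ?WT //.
  by move: Em'; rewrite (capv_idPl (WT j jn)) -/(C i); lia.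
- move=> j jn; rewrite /W'; case: ifP => bj; last by rewrite addn0.
  by rewrite dim_add_line ?addn1 // wW.
Qed.

(** Vectors are added one at a time, [rho b] of them for each column [b]. *)
Lemma generic_add_row m W0 (rho : 'I_n -> nat) : (m < n)%N ->
  filtration_in m W0 -> generic_upto m W0 -> W0 n = T m ->
  (\sum_b rho b <= \dim (T m.+1) - \dim (T m))%N ->
  exists W, [/\ filtration_in m.+1 W, generic_upto m.+1 W,
    (forall m' j, (m' <= m)%N -> (j <= n)%N -> (W j :&: T m' = W0 j :&: T m')%VS)
    & forall j, (j <= n)%N -> \dim (W j) = (\dim (W0 j) + psum rho j)%N].
Proof.
move=> mn FW GW W0n; move: {2}(\sum_b rho b)%N (erefl (\sum_b rho b)%N) => N.
elim: N rho => [|N IHN] rho rN rle.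
  exists W0; split=> //.
  - case: FW => W00 W0S W0T; split=> // j jn.
    by apply: subv_trans (W0T j jn) (st_stepS f mn).
  - by move=> i j i_n jn; have [m' m'm E] := GW i j i_n jn; exists m' => //; apply: leqW.
  - move=> j jn; rewrite /psum big1 ?addn0 // => b _; apply/eqP.
    by rewrite -leqn0 -rN (bigD1 b) //= leq_addr.
have [b rb] : exists b, (0 < rho b)%N.
  apply/existsP; apply: contraPT rN => /existsPn r0; rewrite big1 // => b _.
  by have := r0 b; rewrite -eqn0Ngt => /eqP.
pose rho' a := (rho a - (a == b))%N.
have Er a : rho a = (rho' a + (a == b))%N.
  by rewrite /rho' subnK //; case: eqP => // ->.
have Es j : psum rho j = (psum rho' j + (b < j))%N.
  by rewrite (eq_psum _ Er) psumD psum_delta.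
have rN' : (\sum_a rho' a)%N = N.
  by have := Es n; rewrite !psum_full ltn_ord rN addn1 => -[].
have [|W [FW1 GW1 EW dW]] := IHN rho' rN'; first by rewrite rN' in rle *; lia.
have [|W' [FW' GW' EW' dW']] := @generic_add_line m W b mn FW1 GW1.
  apply/negP => /dimvS; have [_ _ WT] := FW1.
  have WTm : (T m <= W n)%VS.
    have := EW m n (leqnn m) (leqnn n); rewrite W0n capvv => <-; exact: capvSl.
  rewrite (addv_idPr WTm) dW // psum_full rN' W0n; have := dimvS (st_stepS f mn).
  by move: rle; rewrite rN; lia.
exists W'; split=> //.
- by move=> m' j m'm jn; rewrite EW' // EW.
- by move=> j jn; rewrite dW' // dW // Es addnA.
Qed.

(** The third flag is built by going up the middle flag [T]: on passing from
    [T m] to [T m.+1], the entries of row [m] of the matrix say how many vectors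
    of [T m.+1] must be added to the steps of the third flag, and these are
    chosen generic. *)
Theorem generic_flag (M : 'M[nat]_n) :
  (forall m, (m <= n)%N -> rk M m n = \dim (T m)) ->
  exists f2, (forall i j, (i <= n)%N -> (j <= n)%N -> dcap f f2 i j = rk M i j) /\
   (forall i j, (i <= n)%N -> (j <= n)%N -> exists2 m, (m <= n)%N &
     (dcap f1 f i m + dcap f f2 m j = dcap f1 f2 i j + \dim (T m))%N).
Proof.
move=> dT; have main m : (m <= n)%N -> exists W, [/\ filtration_in m W, generic_upto m W
    & forall m' j, (m' <= m)%N -> (j <= n)%N -> \dim (W j :&: T m') = rk M m' j].
  elim: m => [_|m IHm mn].
    exists (fun=> 0%VS); split.
    - by split=> // j _; apply: sub0v.
    - by move=> i j _ _; exists 0%N; rewrite ?st0 ?cap0v ?capv0.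
    - by move=> m' j; rewrite leqn0 => /eqP -> _; rewrite cap0v dimv0 rk0l.
  have [W0 [FW GW dW]] := IHm (ltnW mn).
  have [W00 W0S W0T] := FW.
  have W0n : W0 n = T m.
    apply/eqP; rewrite eqEdim W0T //= -(dT m (ltnW mn)) -(dW m n) //.
    by rewrite (capv_idPl (W0T n (leqnn n))).
  have rho_le : (\sum_b M (Ordinal mn) b <= \dim (T m.+1) - \dim (T m))%N.
    rewrite -(dT m (ltnW mn)) -(dT m.+1 mn) (rkS _ (Ordinal mn)) /= psum_full.
    by rewrite addKn.
  have [W [FW1 GW1 EW dW1]] := generic_add_row mn FW GW W0n rho_le.
  exists W; split=> // m' j; rewrite leq_eqVlt ltnS => /predU1P[->|m'm] jn.
    have [_ _ WT] := FW1; rewrite (capv_idPl (WT j jn)) dW1 //.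
    by rewrite (rkS _ (Ordinal mn)) /= -dW // (capv_idPl (W0T j jn)).
  by rewrite EW // dW.
have [W [[W0 WS WT] GW dW]] := main n (leqnn n).
have Wn : W n = fullv.
  apply/eqP; rewrite eqEdim subvf /= -(st_full f) -(dT n (leqnn n)) -(dW n n) //.
  by rewrite st_full capvf.
have [f2 Ef2] := flag_of W0 Wn WS; exists f2; split=> i j i_n jn.
  by rewrite /dcap Ef2 // capvC dW.
have [m mn E] := GW i j i_n jn; exists m => //.
by rewrite /dcap !Ef2 // (capvC (T m)).
Qed.

Lemma flag_of_dims (s : nat -> nat) : s 0%N = 0%N -> s n = \dim {: V} ->
  (forall i, (i < n)%N -> (s i <= s i.+1)%N) ->
  exists g : flag n V, forall i, (i <= n)%N -> \dim (st g i) = s i.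
Proof.
move=> s0 sn sS; pose W i := <<take (s i) (vbasis {: V})>>%VS.
have sle i : (i <= n)%N -> (s i <= \dim {: V})%N.
  rewrite -sn => i_n; suff H N : (i <= N <= n)%N -> (s i <= s N)%N by apply: H; rewrite i_n /=.
  case/andP=> iN Nn; elim: N iN Nn => [|N IHN]; first by rewrite leqn0 => /eqP->.
  rewrite leq_eqVlt ltnS => /predU1P[->//|iN] Nn.
  by apply: leq_trans (IHN iN (ltnW Nn)) (sS N Nn).
have [|||g Eg] := @flag_of n k V W.
- by rewrite /W s0 take0 span_nil.
- rewrite /W sn take_oversize ?size_tuple //; exact: span_basis (vbasisP _).
- move=> i i_n; apply: sub_span => v.
  by rewrite -(take_takel _ (sS i i_n)) => /mem_take.
exists g => i i_n; rewrite Eg // /W.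
have fr : free (take (s i) (vbasis {: V})).
  have := basis_free (vbasisP {: V}); rewrite -{1}(cat_take_drop (s i) (vbasis _)).
  exact: catl_free.
by move: fr; rewrite /free => /eqP ->; rewrite size_takel // size_tuple sle.
Qed.

End GenericFlag.

(** * Recovering a subspace from its Pluecker coordinates *)

Section PluckerSpan.
Variables (k : closedFieldType) (V : vectType k).
Local Notation rV := (\dim {: V}).
Local Notation e := (vbasis {: V}).
Implicit Types (X : seq V) (U : {vspace V}).

Definition cmx m X (t : 'I_m -> 'I_rV) : 'M[k]_m :=
  \matrix_(a, b) coord e (t b) X`_a.

Lemma coord_all_eq0 v : (forall b, coord e b v = 0) -> v = 0.
Proof.
by move=> v0; rewrite (coord_vbasis (memvf v)) big1 // => b _; rewrite v0 scale0r.
Qed.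

Lemma mul_cmx m X (t : 'I_m -> 'I_rV) (c : 'rV[k]_m) b :
  (c *m cmx X t) 0 b = coord e (t b) (\sum_a c 0 a *: X`_a).
Proof.
by rewrite mxE linear_sum; apply: eq_bigr => a _; rewrite mxE linearZ.
Qed.

Lemma free_det (X : rV.-tuple V) : free X = (\det (cmx X id) != 0).
Proof.
apply/idP/idP => [fX|].
  apply/negP => /det0P[c c0 /rowP cX]; case/eqP: c0; apply/rowP => a.
  have : \sum_a c 0 a *: X`_a = 0.
    by apply: coord_all_eq0 => b; rewrite -(mul_cmx X id) cX mxE.
  by move/(elimT freeP fX (fun a => c 0 a)) => ->; rewrite mxE.
rewrite -unitfE => dX; apply/freeP => c cX a.
have : (\row_a c a) *m cmx X id = 0.
  apply/rowP => b; rewrite mul_cmx mxE (eq_bigr (fun a => c a *: X`_a)).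
    by rewrite cX linear0.
  by move=> a' _; rewrite mxE.
move=> /(congr1 (fun M => M *m invmx (cmx X id))).
rewrite mulmxK // mul0mx => /rowP/(_ a).
by rewrite !mxE.
Qed.

Lemma free_minor_exists X : free X ->
  exists2 t : 'I_(size X) -> 'I_rV, injective t & \det (cmx X t) != 0.
Proof.
move=> fX; pose A : 'M[k]_(size X, rV) := \matrix_(a, b) coord e b X`_a.
have rA : row_full A^T.
  rewrite /row_full mxrank_tr -/(row_free A) -kermx_eq0; apply/rowV0P => c /sub_kermxP cA.
  apply/rowP => a; rewrite mxE; apply: (elimT (freeP (X := in_tuple X)) fX (fun a => c 0 a)).
  apply: coord_all_eq0 => b; have /rowP/(_ b) := cA.
  rewrite !mxE => E; rewrite linear_sum -[RHS]E.
  by apply: eq_bigr => i _; rewrite mxE linearZ.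
exists (fullrankfun rA); first exact: fullrankfun_inj.
have := fullrowsub_unit rA; rewrite unitmxE unitfE -det_tr; congr (\det _ != 0).
by apply/matrixP => a b; rewrite !mxE.
Qed.

(** The sign of the permutation that relates the two enumerations. *)
Lemma minor_perm m m' (s : 'I_m -> 'I_rV) (t : 'I_m' -> 'I_rV) :
  m = m' -> injective s -> injective t -> (forall i, exists j, s j = t i) ->
  exists2 eps : k, eps != 0 & forall X, \det (cmx X t) = eps * \det (cmx X s).
Proof.
move=> em; case: _ / em t => t s_inj t_inj /choice[h sh].
have h_inj : injective h by move=> i j hij; apply: t_inj; rewrite -!sh hij.
pose sg := perm h_inj; exists ((-1) ^+ (sg^-1)%g); first by rewrite signr_eq0.
move=> X; have -> : cmx X t = col_perm sg (cmx X s).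
  by apply/matrixP => a b; rewrite !mxE permE sh.
by rewrite col_permE det_mulmx det_perm mulrC.
Qed.

(** The enumeration of [m |: J] that starts with [m]; determinants taken in this
    order can be expanded along the first column. *)
Definition cons_idx (J : {set 'I_rV}) (m : 'I_rV) (i : 'I_(#|J|.+1)) : 'I_rV :=
  if unlift ord0 i is Some j then enum_val j else m.

Lemma cons_idx_sign (J : {set 'I_rV}) m : m \notin J ->
  exists2 eps : k, eps != 0 & forall X,
    \det (cmx X (@cons_idx J m))
    = eps * \det (cmx X (fun b : 'I_#|m |: J| => enum_val b)).
Proof.
move=> mJ; apply: minor_perm.
- by rewrite cardsU1 mJ.
- exact: enum_val_inj.
- move=> i j; rewrite /cons_idx; case: unliftP => [i'|] ->; case: unliftP => [j'|] ->//.
  + by move/enum_val_inj ->.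
  + by move=> E; rewrite -E enum_valP in mJ.
  + by move=> E; rewrite E enum_valP in mJ.
- move=> i; have iI : cons_idx m i \in m |: J.
    rewrite /cons_idx; case: unliftP => [i'|] _; rewrite !inE ?eqxx //.
    by rewrite enum_valP orbT.
  by exists (enum_rank_in iI (cons_idx m i)); rewrite enum_rankK_in.
Qed.

Lemma signs_exist : exists eps : {set 'I_rV} -> 'I_rV -> k,
  forall (J : {set 'I_rV}) m, m \notin J ->
  eps J m != 0 /\ forall X, \det (cmx X (@cons_idx J m))
    = eps J m * \det (cmx X (fun b : 'I_#|m |: J| => enum_val b)).
Proof.
have H (Jm : {set 'I_rV} * 'I_rV) : exists eps : k, Jm.2 \notin Jm.1 ->
  eps != 0 /\ forall X, \det (cmx X (@cons_idx Jm.1 Jm.2))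
    = eps * \det (cmx X (fun b : 'I_#|Jm.2 |: Jm.1| => enum_val b)).
  have [mJ|mJ] := boolP (Jm.2 \in Jm.1); first by exists 0.
  by have [eps e0 E] := cons_idx_sign mJ; exists eps.
by have [eps E] := choice H; exists (fun J m => eps (J, m)) => J m; apply: (E (J, m)).
Qed.

Variable eps : {set 'I_rV} -> 'I_rV -> k.
Hypothesis epsP : forall (J : {set 'I_rV}) m, m \notin J ->
  eps J m != 0 /\ forall X, \det (cmx X (@cons_idx J m))
    = eps J m * \det (cmx X (fun b : 'I_#|m |: J| => enum_val b)).

(** The contraction of a multivector with coordinates [y] by the exterior product
    of the coordinate forms of index in [J]. *)
Definition contract (y : {set 'I_rV} -> k) (J : {set 'I_rV}) : V :=
  \sum_(m | m \notin J) (eps J m * y (m |: J)) *: e`_m.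

Lemma coord_contract y J b :
  coord e b (contract y J) = if b \in J then 0 else eps J b * y (b |: J).
Proof.
rewrite /contract linear_sum /= (eq_bigr (fun m => (eps J m * y (m |: J)) *+ (b == m))).
  case: ifPn => bJ; last first.
    rewrite (bigD1 b) //= eqxx big1 ?addr0 // => m /andP[_ mb].
    by rewrite eq_sym (negPf mb).
  by rewrite big1 // => m mJ; case: eqP => // E; rewrite -E bJ in mJ.
move=> m _; rewrite linearZ /= coord_free ?(basis_free (vbasisP _)) //.
by rewrite mulr_natr eq_sym.
Qed.

Lemma minorE X (I : {set 'I_rV}) : #|I| = size X ->
  minor X I = \det (cmx X (fun b : 'I_#|I| => enum_val b)).
Proof. by move=> sI; rewrite /minor; case: eqP. Qed.

Lemma minor_neq X (I : {set 'I_rV}) : #|I| != size X -> minor X I = 0.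
Proof. by rewrite /minor => /negPf ->. Qed.

(** Up to the factor [c], the coordinate of the contraction at [m] is the
    determinant of the columns [m, J] of the coordinates of a basis [X] of [U].
    Expanding along the column [m] writes the contraction as a combination of
    the vectors in [X], with coefficients that do not depend on [m]. *)
Lemma contract_mem U y J : plucker U y -> contract y J \in U.
Proof.
move=> [c [X [c0 bX yE]]].
have [sX|sX] := eqVneq (size X) #|J|.+1; last first.
  rewrite /contract big1 ?rpred0 // => m mJ.
  by rewrite yE minor_neq ?mulr0 ?scale0r // cardsU1 mJ add1n eq_sym.
have -> : contract y J = c *: \sum_m \det (cmx X (@cons_idx J m)) *: e`_m.
  rewrite scaler_sumr /contract [RHS](bigID (fun m => m \in J)) /=.
  rewrite [X in _ = X + _]big1 ?add0r.
    apply: eq_bigr => m mJ; rewrite scalerA yE minorE; last by rewrite sX cardsU1 mJ.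
    by rewrite (proj2 (epsP mJ)); congr (_ *: _); rewrite mulrCA.
  move=> m mJ; rewrite -det_tr.
  rewrite (determinant_alternate (i1 := ord0) (i2 := lift ord0 (enum_rank_in mJ m))) //.
    by rewrite scale0r scaler0.
  by move=> a; rewrite !mxE /cons_idx unlift_none liftK enum_rankK_in.
apply: rpredZ; pose N : 'M[k]_(#|J|.+1, #|J|) := \matrix_(a, b) coord e (enum_val b) X`_a.
pose kappa (i : 'I_(#|J|.+1)) := (-1) ^+ (i + (ord0 : 'I_(#|J|.+1))) * \det (row' i N).
have Edet m : \det (cmx X (@cons_idx J m)) = \sum_(i < #|J|.+1) coord e m X`_i * kappa i.
  rewrite (expand_det_col _ ord0); apply: eq_bigr => i _.
  rewrite mxE /cons_idx unlift_none; congr (_ * (_ * \det (row' _ _))).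
  by apply/matrixP => a b; rewrite !mxE /cons_idx liftK.
have -> : \sum_m \det (cmx X (@cons_idx J m)) *: e`_m
    = \sum_(i < #|J|.+1) kappa i *: X`_i.
  rewrite (eq_bigr (fun m : 'I_rV => \sum_(i < #|J|.+1) kappa i *: (coord e m X`_i *: e`_m))).
    rewrite exchange_big; apply: eq_bigr => i _; rewrite -scaler_sumr.
    by rewrite -coord_vbasis ?memvf.
  move=> m _; rewrite Edet scaler_suml; apply: eq_bigr => i _.
  by rewrite scalerA mulrC.
apply: rpred_sum => i _; apply: rpredZ; rewrite -(span_basis bX).
by apply/memv_span/mem_nth; rewrite sX.
Qed.

(** Some set [I] of columns carries a non-zero minor. The contraction by [I] less
    an element [i] has [i] as its only non-zero coordinate in [I], and an element
    of [U] is determined by its coordinates in [I]. *)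
Lemma contract_span U y : plucker U y ->
  <<[seq contract y J | J <- enum {set 'I_rV}]>>%VS = U.
Proof.
move=> yU; apply/eqP; rewrite eqEsubv; apply/andP; split.
  by apply/span_subvP => _ /mapP[J _ ->]; apply: contract_mem.
have [c [X [c0 bX yE]]] := yU; have fX := basis_free bX.
have [t t_inj dt] := free_minor_exists fX.
pose I := [set t j | j in 'I_(size X)].
have cI : #|I| = size X by rewrite card_imset // card_ord.
have yI : y I != 0.
  rewrite yE mulf_neq0 // minorE //.
  have [||i|d d0 dE] := @minor_perm _ _ (fun b : 'I_#|I| => enum_val b) t cI.
  - exact: enum_val_inj.
  - exact: t_inj.
  - have tI : t i \in I by apply: imset_f.
    by exists (enum_rank_in tI (t i)); rewrite enum_rankK_in.
  by apply: contraNneq dt => E; rewrite dE E mulr0.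
apply/subvP => v vU.
pose w := \sum_(j < size X) (coord e (t j) v / (eps (I :\ t j) (t j) * y I))
   *: contract y (I :\ t j).
have tI j : t j \in I by apply: imset_f.
have wS : w \in <<[seq contract y J | J <- enum {set 'I_rV}]>>%VS.
  apply: rpred_sum => j _; apply: rpredZ; apply: memv_span.
  by apply: map_f; rewrite mem_enum.
suff -> : v = w by [].
apply/eqP; rewrite -subr_eq0; apply/eqP.
have dU : v - w \in U.
  by apply: rpredB => //; apply: rpred_sum => j _; apply/rpredZ/contract_mem.
have d0 i : coord e (t i) (v - w) = 0.
  rewrite linearB linear_sum /= (bigD1 i) //= linearZ /= coord_contract.
  have tn : t i \notin I :\ t i by rewrite !inE eqxx.
  rewrite (negPf tn) setD1K // big1 ?addr0.
    by rewrite mulfVK ?subrr // mulf_neq0 // (proj1 (epsP tn)).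
  move=> j ji; rewrite linearZ /= coord_contract.
  by rewrite !inE tI (inj_eq t_inj) eq_sym ji /= mulr0.
move: dU; rewrite -(span_basis bX) => /(coord_span (X := in_tuple X)) E.
rewrite E; set q := fun i => coord (in_tuple X) i (v - w) in E *.
have : (\row_a q a) *m cmx X t = 0.
  apply/rowP => b; rewrite mul_cmx mxE (eq_bigr (fun a => q a *: X`_a)) -?E //.
  by move=> a _; rewrite mxE.
move: dt; rewrite -unitfE => dt /(congr1 (fun M => M *m invmx (cmx X t))).
rewrite mulmxK // mul0mx => /rowP qa; rewrite big1 // => a _.
by have := qa a; rewrite !mxE /q => ->; rewrite scale0r.
Qed.

End PluckerSpan.

(** * Polynomial functions on pairs of flags *)

Section PolynomialFunctions.
Variables (n : nat) (k : closedFieldType) (V : vectType k).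
Local Notation rV := (\dim {: V}).
Local Notation e := (vbasis {: V}).
Local Notation pv := (pvar n V).

Definition ev (q : mpoly.mpoly #|{: pv}| k) (x : pv -> k) : k :=
  mpoly.meval (fun i => x (enum_val i)) q.

Definition polyfun (phi : (pv -> k) -> k) : Prop := exists q, forall x, ev q x = phi x.

Lemma polyfun_const c : polyfun (fun=> c).
Proof. by exists (mpoly.mpolyC _ c) => x; apply: mpoly.mevalC. Qed.

Lemma polyfun_var v : polyfun (fun x => x v).
Proof.
exists (mpoly.mpolyX k (mpoly.mnm1 (enum_rank v))) => x.
by rewrite /ev mpoly.mevalXU enum_rankK.
Qed.

Lemma polyfunD p q : polyfun p -> polyfun q -> polyfun (fun x => p x + q x).
Proof.
by move=> [P EP] [Q EQ]; exists (P + Q) => x; rewrite /ev mpoly.mevalD -!/(ev _ _) EP EQ.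
Qed.

Lemma polyfunM p q : polyfun p -> polyfun q -> polyfun (fun x => p x * q x).
Proof.
by move=> [P EP] [Q EQ]; exists (P * Q) => x; rewrite /ev mpoly.mevalM -!/(ev _ _) EP EQ.
Qed.

Lemma polyfun_sum (I : Type) (s : seq I) (P : pred I) F :
  (forall i, polyfun (F i)) -> polyfun (fun x => \sum_(i <- s | P i) F i x).
Proof.
move=> HF; elim: s => [|i s [q Eq]].
  by have [q Eq] := polyfun_const 0; exists q => x; rewrite big_nil.
case Pi : (P i).
  have [q' Eq'] := polyfunD (HF i) (ex_intro _ q Eq).
  by exists q' => x; rewrite big_cons Pi.
by exists q => x; rewrite big_cons Pi.
Qed.

Lemma polyfun_prod (I : Type) (s : seq I) (P : pred I) F :
  (forall i, polyfun (F i)) -> polyfun (fun x => \prod_(i <- s | P i) F i x).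
Proof.
move=> HF; elim: s => [|i s [q Eq]].
  by have [q Eq] := polyfun_const 1; exists q => x; rewrite big_nil.
case Pi : (P i).
  have [q' Eq'] := polyfunM (HF i) (ex_intro _ q Eq).
  by exists q' => x; rewrite big_cons Pi.
by exists q => x; rewrite big_cons Pi.
Qed.

Lemma polyfun_det m (M : (pv -> k) -> 'M[k]_m) :
  (forall a b, polyfun (fun x => M x a b)) -> polyfun (fun x => \det (M x)).
Proof.
move=> HM; apply: polyfun_sum => s; apply: polyfunM; first exact: polyfun_const.
by apply: polyfun_prod => i; apply: HM.
Qed.

Lemma ev_curve q (P : pv -> {poly k}) :
  exists Q : {poly k}, forall t, ev q (fun v => (P v).[t]) = Q.[t].
Proof.
exists (\sum_(m <- mpoly.msupp q)
  (mpoly.mcoeff m q)%:P * \prod_i P (enum_val i) ^+ (m i)) => t.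
rewrite /ev mpoly.mevalE horner_sum; apply: eq_bigr => m _.
rewrite hornerM hornerC horner_prod; congr (_ * _).
by apply: eq_bigr => i _; rewrite horner_exp.
Qed.

Definition pstep (p : flag n V * flag n V) (i : 'I_n.+1 + 'I_n.+1) : {vspace V} :=
  match i with inl i => step p.1 i | inr i => step p.2 i end.

Lemma hcoords_exist (p : flag n V * flag n V) : exists x, hcoords p x.
Proof.
exists (fun v => minor (vbasis (pstep p v.1)) v.2) => i.
split; [exists 1; exists (vbasis (step p.1 i)) | exists 1; exists (vbasis (step p.2 i))].
  by split=> [||I /=]; [exact: oner_neq0 | exact: vbasisP | rewrite mul1r].
by split=> [||I /=]; [exact: oner_neq0 | exact: vbasisP | rewrite mul1r].
Qed.

Lemma hcoords_plucker p x i : hcoords p x -> plucker (pstep p i) (fun I => x (i, I)).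
Proof. by move=> Hx; case: i => i; have [] := Hx i. Qed.

Lemma free_subfamily (T : eqType) (v : T -> V) (s : seq T) :
  exists s' : seq T, [/\ free (map v s'), <<map v s'>>%VS = <<map v s>>%VS
    & {subset s' <= s}].
Proof.
elim: s => [|a s [s' [fs' Es' ss']]]; first by exists [::]; rewrite ?nil_free.
have [av|av] := boolP (v a \in <<map v s'>>%VS).
  exists s'; split=> // [|b bs]; last by rewrite inE ss' ?orbT.
  by rewrite /= span_cons -Es'; apply/esym/addv_idPr; rewrite -memvE.
exists (a :: s'); split; first by rewrite /= free_cons av.
  by rewrite /= !span_cons Es'.
by move=> b; rewrite !inE => /predU1P[->|/ss' ->]; rewrite ?eqxx ?orbT.
Qed.

(** The contractions of the Pluecker vectors of the two steps span their sum.
    Choose some of them that form a basis of the sum for the pair [p], and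
    complete it by fixed vectors to a basis of [V]: the determinant of this
    family is a polynomial in the coordinates that vanishes wherever the sum has
    a smaller dimension. *)
Lemma separate_sum p x i j : hcoords p x ->
  exists phi, [/\ polyfun phi, phi x != 0 &
    forall p' x', hcoords p' x' ->
      (\dim (pstep p' i + pstep p' j) < \dim (pstep p i + pstep p j))%N -> phi x' = 0].
Proof.
move=> Hx; have [eps epsP] := signs_exist V.
pose tag := (('I_n.+1 + 'I_n.+1) * {set 'I_rV})%type.
pose vec (x : pv -> k) (s : tag) := contract eps (fun I => x (s.1, I)) s.2.
pose tags : seq tag := [seq (i, J) | J <- enum {set 'I_rV}]
                    ++ [seq (j, J) | J <- enum {set 'I_rV}].
have span_tags p' x' : hcoords p' x' ->
    <<map (vec x') tags>>%VS = (pstep p' i + pstep p' j)%VS.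
  move=> Hx'; rewrite map_cat span_cat -(map_comp (vec x') (pair i)) 
    -(map_comp (vec x') (pair j)); congr (_ + _)%VS.
    exact: (contract_span epsP (hcoords_plucker i Hx')).
  exact: (contract_span epsP (hcoords_plucker j Hx')).
set W := (pstep p i + pstep p j)%VS.
have [s [fs Es ssub]] := free_subfamily (vec x) tags.
rewrite (span_tags p x Hx) -/W in Es.
pose L x' := map (vec x') s ++ vbasis W^C.
have ss : size s = \dim W by rewrite -Es -(size_map (vec x)); apply/esym/eqP.
have sL x' : size (L x') == rV.
  by rewrite size_cat size_map size_tuple ss dimv_compl subnKC // dimvS ?subvf.
pose phi x' := \det (cmx (L x') (fun b : 'I_rV => b)).
have phi_free x' : (phi x' != 0) = free (L x') by rewrite -(free_det (Tuple (sL x'))).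
exists phi; split.
- apply: polyfun_det => a b.
  have [as_|as_] := ltnP a (size s).
    have E x' : cmx (L x') (fun b : 'I_rV => b) a b = coord e b (vec x' (nth (i, set0) s a)).
      by rewrite mxE nth_cat size_map as_ (nth_map (i, set0)).
    case: (nth _ s a) E => c J E; have [bJ|bJ] := boolP (b \in J).
      have [q Eq] := polyfun_const 0; exists q => x'.
      by rewrite Eq E /vec coord_contract bJ.
    have [q Eq] := polyfunM (polyfun_const (eps J b)) (polyfun_var (c, b |: J)).
    by exists q => x'; rewrite Eq E /vec coord_contract (negPf bJ).
  have [q Eq] := polyfun_const (coord e b (vbasis W^C)`_(a - size s)).
  by exists q => x'; rewrite Eq mxE nth_cat size_map ltnNge as_.
- rewrite phi_free cat_free; apply/and3P; split=> //; first exact: basis_free (vbasisP _).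
  rewrite Es (span_basis (vbasisP _)); apply/directv_addP.
  exact: capv_compl.
move=> p' x' Hx' lt; apply/eqP; apply: contraTT lt; rewrite phi_free -leqNgt.
move/catl_free => fs'; rewrite -ss -(size_map (vec x')).
have /eqP <- := fs'; apply: dimvS; rewrite -(span_tags p' x' Hx').
by apply: sub_span => _ /mapP[t ts ->]; apply: map_f; apply: ssub.
Qed.

End PolynomialFunctions.

(** * The open orbit *)

Section Curves.
Variables (n : nat) (k : closedFieldType) (V : vectType k).
Local Notation rV := (\dim {: V}).
Local Notation e := (vbasis {: V}).
Variables g0 g1 : 'End(V).
Local Notation h t := (g0 + t *: g1).

Lemma minor_curve m (Y : seq V) (s : 'I_m -> 'I_rV) :
  exists Q : {poly k}, forall t, \det (cmx (map (h t) Y) s) = Q.[t].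
Proof.
pose M : 'M[{poly k}]_m := \matrix_(a, b)
  ((coord e (s b) (g0 Y`_a))%:P + 'X * (coord e (s b) (g1 Y`_a))%:P).
exists (\det M) => t; rewrite -[RHS]/(horner_eval t _) -det_map_mx; congr (\det _).
apply/matrixP => a b; rewrite /M !mxE /= /horner_eval !hornerE.
have -> : (map (h t) Y)`_a = h t Y`_a.
  have [aY|aY] := ltnP a (size Y); first by rewrite (nth_map 0).
  by rewrite !nth_default ?size_map // linear0.
by rewrite add_lfunE scale_lfunE linearD linearZ.
Qed.

Lemma inj_curve t0 : lker (h t0) = 0%VS ->
  exists2 D : {poly k}, D != 0 & forall t, D.[t] != 0 -> lker (h t) = 0%VS.
Proof.
move=> ht0; have [D ED] := minor_curve e (fun b : 'I_rV => b).
have Efree t : (D.[t] != 0) = free (map (h t) e).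
  by rewrite -ED -(free_det [tuple of map (h t) e]).
exists D => [|t].
  apply/eqP => D0; suff : D.[t0] != 0 by rewrite D0 horner0 eqxx.
  rewrite Efree; apply: basis_free (limg_basis_of _ (vbasisP {: V})).
  by rewrite ht0 capv0.
rewrite Efree => ft; have := limg_ker_dim (h t) fullv; rewrite capfv.
rewrite -(span_basis (vbasisP {: V})) limg_span (eqP ft) size_map size_tuple.
rewrite (span_basis (vbasisP {: V})) => /eqP.
by rewrite -[X in _ == X]add0n eqn_add2r dimv_eq0 => /eqP.
Qed.

(** The maps [h t] form a line in the space of endomorphisms. The coordinates of
    the image of [f] under [h t] are polynomial in [t], and so is the value of
    an equation of [Z] that does not hold at [t0]; it has finitely many roots. *)
Lemma curve_avoid (Z : flag n V * flag n V -> Prop) (f1 f f0 : flag n V) t0 :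
  zclosed Z -> lker (h t0) = 0%VS -> (forall i, step f0 i = h t0 @: step f i)%VS ->
  ~ Z (f1, f0) ->
  exists2 Q : {poly k}, Q != 0 & forall t (ft : flag n V), Q.[t] != 0 -> lker (h t) = 0%VS ->
    (forall i, step ft i = h t @: step f i)%VS -> ~ Z (f1, ft).
Proof.
move=> [P HP] ht0 Ef0 nZ.
have [q [x [Pq Hx qx]]] : exists q x, [/\ P q, hcoords (f1, f0) x & ev q x != 0].
  apply: contrapT => no; apply: nZ; apply/HP => q x Pq Hx; apply: contrapT => /eqP qx.
  by apply: no; exists q, x.
have /choice[c /choice[X HX]] : forall i, exists c : k, exists X : seq V,
    [/\ c != 0, basis_of (step f0 i) X & forall I, x (inr i, I) = c * minor X I].
  by move=> i; have [_ H] := Hx i.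
(* A basis of the step of f whose image under h t0 is the given one. *)
pose Y i := map (h t0)^-1%VF (X i).
have EY i : map (h t0) (Y i) = X i.
  rewrite -map_comp -[RHS]map_id; apply: eq_map => v /=.
  by rewrite lker0_lfunVK // ht0.
have bY i : basis_of (step f i) (Y i).
  have [_ bX _] := HX i; have := basis_free bX; rewrite -EY => fX.
  rewrite /basis_of; apply/andP; split.
    have : (h t0 @: <<Y i>> = h t0 @: step f i)%VS.
      by rewrite limg_span EY (span_basis bX) Ef0.
    move=> E; have hk : lker (h t0) == 0%VS by apply/eqP.
    rewrite eqEsubv -(limg_ker0 <<Y i>> (step f i) hk).
    by rewrite -(limg_ker0 (step f i) <<Y i>> hk) E subvv.
  by have := fX; rewrite /free size_map -limg_span limg_dim_eq // ht0 capv0.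
have /choice[mn Emn] : forall iI : 'I_n.+1 * {set 'I_rV}, exists Q : {poly k},
    forall t, minor (map (h t) (Y iI.1)) iI.2 = Q.[t].
  move=> [i I]; have [sI|sI] := eqVneq #|I| (size (Y i)).
    have [Q EQ] := minor_curve (Y i) (fun b : 'I_#|I| => enum_val b).
    by exists Q => t; rewrite /= minorE // [size (map _ (Y i))]size_map.
  by exists 0 => t; rewrite /= horner0 minor_neq // [size (map _ (Y i))]size_map.
pose Pc (v : pvar n V) : {poly k} :=
  match v.1 with inl i => (x v)%:P | inr i => (c i)%:P * mn (i, v.2) end.
have [Q EQ] := ev_curve q Pc.
have coords t (ft : flag n V) : lker (h t) = 0%VS ->
    (forall i, step ft i = h t @: step f i)%VS -> hcoords (f1, ft) (fun v => (Pc v).[t]).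
  move=> ht Eft i; split; rewrite /Pc /=.
    have [[c' [X' [c0 bX xE]]] _] := Hx i.
    by exists c', X'; split=> // I; rewrite hornerC xE.
  have [c0 _ _] := HX i; exists (c i), (map (h t) (Y i)); split=> //.
    by rewrite Eft; apply: limg_basis_of (bY i); rewrite ht capv0.
  by move=> I; rewrite hornerM hornerC -(Emn (i, I)).
exists Q => [|t ft Qt ht Eft].
  apply: contraNneq qx => Q0; have := EQ t0; rewrite Q0 horner0 => <-.
  rewrite /ev; apply/eqP; congr (mpoly.meval _ _); apply: funext => a.
  case: (enum_val a) => -[i|i] I; rewrite /Pc /=; first by rewrite hornerC.
  by have [_ _ ->] := HX i; rewrite hornerM hornerC -(Emn (i, I)) /= EY.
move/HP => /(_ q _ Pq (coords t ft ht Eft)) E.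
by move/eqP: Qt; apply; rewrite -EQ; apply: E.
Qed.

End Curves.

Section OpenOrbit.
Variables (n r : nat) (k : closedFieldType) (V : vectType k).
Hypothesis dimV : \dim {: V} = r.
Implicit Types (A B C : orbmx n r) (p : flag n V * flag n V).

Lemma orbP A p : orb A p <-> relpos p.1 p.2 = nmx A.
Proof.
split=> [[q qA /same_orbit_relpos <-//]|pA].
by exists p => //; apply: same_orbit_refl.
Qed.

Lemma orb_dcap A p : orb A p <->
  (forall i j, (i <= n)%N -> (j <= n)%N -> dcap p.1 p.2 i j = ork A i j).
Proof. by rewrite orbP; exact: relpos_rk. Qed.

Lemma flag_image (g : 'End(V)) (f : flag n V) : lker g = 0%VS ->
  exists f' : flag n V, forall i, (i <= n)%N -> st f' i = (g @: st f i)%VS.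
Proof.
move=> g0; apply: (@flag_of n k V (fun i => g @: st f i)%VS).
- by rewrite st0 limg0.
- by rewrite st_full lker0_limgf // g0.
- by move=> i i_n; apply/limgS/st_stepS.
Qed.

Lemma orbS_orb A B p : orbS A B p -> exists f, [/\ orb A (p.1, f), orb B (f, p.2) &
  forall m, (m <= n)%N -> \dim (st f m) = ork B m n].
Proof.
move=> [f [fA fB]]; exists f; split=> // m mn.
by move/orb_dcap: fB => /(_ m n mn (leqnn n)) <-; rewrite dcap_diml.
Qed.

(** Move the second pair by [GL(V)] so that both share the flags [f1] and [f].
    Their last flags then differ by an automorphism [h] that stabilizes [f]. The
    line through the identity and [h] consists of endomorphisms that preserve
    [f]; all but finitely many of them are invertible and send the last flag of
    the first pair to one that forms with [f1] a pair in both orbits. *)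
Theorem open_orbit_unique A B C C' p p' :
  zopen_in (@orb n r k V C) (orbS A B) -> zopen_in (@orb n r k V C') (orbS A B) ->
  orb C p -> orb C' p' -> C = C'.
Proof.
move=> [Z cZ HZ] [Z' cZ' HZ'] Cp Cp'.
have [[f [fA fB]] nZ] := proj1 (HZ p) Cp.
have [[f' [fA' fB']] nZ'] := proj1 (HZ' p') Cp'.
have /same_orbitP[g gk Hg] : same_orbit (p'.1, f') (p.1, f).
  by apply: relpos_transitive => /=; move/orbP: fA => /= ->; move/orbP: fA'.
have [f2' Ef2'] := flag_image p'.2 gk.
have C2' : orb C' (p.1, f2').
  apply/orb_dcap => i j i_n jn; move/orb_dcap: Cp' => /(_ i j i_n jn) <- /=.
  by symmetry; apply: dcap_lim gk (proj1 (Hg i i_n)) _; rewrite Ef2'.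
have B2' : orb B (f, f2').
  apply/orb_dcap => i j i_n jn; move/orb_dcap: fB' => /(_ i j i_n jn) <- /=.
  by symmetry; apply: dcap_lim gk (proj2 (Hg i i_n)) _; rewrite Ef2'.
have /same_orbitP[h hk Hh] : same_orbit (f, p.2) (f, f2').
  by apply: relpos_transitive => /=; move/orbP: fB => /= ->; move/orbP: B2'.
have nZ2' : ~ Z' (p.1, f2') by have [] := proj1 (HZ' _) C2'.
pose c t : 'End(V) := \1%VF + t *: (h - \1%VF).
have c0 : c 0 = \1%VF by rewrite /c scale0r addr0.
have c1 : c 1 = h by rewrite /c scale1r addrC subrK.
have k1 : lker (\1%VF : 'End(V)) = 0%VS.
  by apply/eqP/lker0P => u v; rewrite !id_lfunE.
have [|D D0 HD] := @inj_curve k V \1%VF (h - \1%VF) 0; first by rewrite -/(c 0) c0.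
have [|||Q Q0 HQ] := @curve_avoid n k V \1%VF (h - \1%VF) Z p.1 p.2 p.2 0 cZ.
- by rewrite -/(c 0) c0.
- by move=> i; rewrite -/(c 0) c0 lim1g.
- by case: (p) nZ.
have [|||Q' Q'0 HQ'] := @curve_avoid n k V \1%VF (h - \1%VF) Z' p.1 p.2 f2' 1 cZ'.
- by rewrite -/(c 1) c1.
- move=> i; rewrite -/(c 1) c1 !step_st; have i_n : (i <= n)%N by rewrite -ltnS.
  by have [_ ->] := Hh i i_n.
- exact: nZ2'.
have /closed_nonrootP[t] : D * (Q * Q') != 0 by rewrite !mulf_neq0.
rewrite /root !hornerM !mulf_eq0 !negb_or => /and3P[Dt Qt Q't].
have ct := HD t Dt; have [ft Eft] := flag_image p.2 ct.
have Eft' i : step ft i = (c t @: step p.2 i)%VS.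
  by rewrite !step_st Eft // -ltnS.
have cf i : (i <= n)%N -> (c t @: st f i = st f i)%VS.
  move=> i_n; apply/eqP; rewrite eqEdim limg_dim_eq ?ct ?capv0 // leqnn andbT.
  apply/subvP => _ /memv_imgP[v vf ->].
  rewrite /c add_lfunE scale_lfunE add_lfunE opp_lfunE !id_lfunE rpredD // rpredZ // rpredB //.
  by have [<- _] := Hh i i_n; apply: memv_img.
have St : orbS A B (p.1, ft).
  exists f; split=> //; apply/orb_dcap => i j i_n jn; move/orb_dcap: fB => /(_ i j i_n jn) <-.
  by symmetry; apply: dcap_lim ct (cf i i_n) _; rewrite Eft.
have /orbP Ct : orb C (p.1, ft) by apply/HZ; split=> //; apply: HQ Qt ct Eft'.
have /orbP Ct' : orb C' (p.1, ft) by apply/HZ'; split=> //; apply: HQ' Q't ct Eft'.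
by apply: nmx_inj; rewrite -Ct.
Qed.

(** In [S(A, B)] the dimensions of the steps are fixed, and those of all
    intersections are at least the ones in the orbit [C]. So a pair outside [C]
    has a smaller sum of two steps somewhere. For a given point of [C], the
    product of the polynomials of [separate_sum] is non-zero at that point and
    vanishes on all of [S(A, B)] outside [C]. *)
Theorem generic_orbit_open A B C : tprod A B C ->
  (forall p, orb C p -> @orbS n r k V A B p) -> zopen_in (@orb n r k V C) (orbS A B).
Proof.
move=> tC CS; pose P (q : mpoly.mpoly #|{: pvar n V}| k) :=
  forall p x, orbS A B p -> ~ orb C p -> hcoords p x -> ev q x = 0.
exists (fun p => forall q x, P q -> hcoords p x -> ev q x = 0); first by exists P.
move=> p; split=> [Cp|[Sp nZ]]; last first.
  by apply: contrapT => nC; apply: nZ => q x Pq; apply: Pq.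
split; first exact: CS.
have dims (q : flag n V * flag n V) : orbS A B q -> forall i, (i <= n)%N ->
    \dim (st q.1 i) = ork A i n /\ \dim (st q.2 i) = ork B n i.
  move=> [f [fA fB]] i i_n; move/orb_dcap: fA => fA; move/orb_dcap: fB => fB; split.
    by rewrite -fA // dcap_diml.
  by rewrite -fB // dcap_dimr.
have [x Hx] := hcoords_exist p.
have sep (ij : 'I_n.+1 * 'I_n.+1) := separate_sum (inl ij.1) (inr ij.2) Hx.
have [phi Hphi] := choice sep.
have [q Eq] : polyfun (fun y => \prod_(ij : 'I_n.+1 * 'I_n.+1) phi ij y).
  by apply: polyfun_prod => ij; have [] := Hphi ij.
move=> /(_ q x) H; have : ev q x = 0.
  apply: H => // p' x' Sp' nCp' Hx'; rewrite Eq.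
  have [i [j [i_n jn neq]]] : exists i j, [/\ (i <= n)%N, (j <= n)%N
      & dcap p'.1 p'.2 i j != ork C i j].
    apply: contrapT => no; apply: nCp'; apply/orb_dcap => i j i_n jn.
    by apply/eqP/negPn/negP => neq; apply: no; exists i, j.
  have ge : (ork C i j <= dcap p'.1 p'.2 i j)%N.
    have [f [fA fB df]] := orbS_orb Sp'.
    have [_ [m mn E]] := tC i j i_n jn.
    have := dcap_triangle p'.1 f p'.2 i m j; rewrite df //.
    move/orb_dcap: fA => ->//; move/orb_dcap: fB => ->//.
    by rewrite E leq_add2r.
  rewrite (bigD1 (inord i, inord j)) //=.
  have [_ _ /(_ p' x' Hx') -> //] := Hphi (inord i, inord j); first by rewrite mul0r.
  rewrite /= !step_st !inordK //; have Sp := CS p Cp.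
  have := dimv_sum_cap (st p'.1 i) (st p'.2 j).
  have := dimv_sum_cap (st p.1 i) (st p.2 j).
  have [-> _] := dims _ Sp' i i_n; have [_ ->] := dims _ Sp' j jn.
  have [-> _] := dims _ Sp i i_n; have [_ ->] := dims _ Sp j jn.
  move/orb_dcap: Cp => /(_ i j i_n jn); rewrite /dcap => ->.
  by move: ge neq; rewrite /dcap; lia.
apply/eqP; rewrite Eq; apply/prodf_neq0 => ij _.
by have [] := Hphi ij.
Qed.

Lemma orb_nonempty C : exists p, @orb n r k V C p.
Proof.
have [|||g Eg] := @flag_of_dims n k V (fun i => ork C i n).
- exact: rk0l.
- by rewrite dimV; exact: ork_full.
- by move=> i _; apply: rk_lel.
have [f2 [E _]] := @generic_flag n k V g g (nmx C) (fun m mn => esym (Eg m mn)).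
by exists (g, f2); apply/orb_dcap.
Qed.

(** The triple given by [generic_flag] lies over a point of the orbit [C], and
    [GL(V)] moves it over all of [C]; so [C] is contained in [S(A, B)]. *)
Theorem orb_mul_tprod A B : composable A B ->
  exists2 C, tprod A B C & orb_mul V A B = << C >>.
Proof.
move=> AB; have [[f1 f] fA] := orb_nonempty A.
have df m : (m <= n)%N -> \dim (st f m) = ork B m n.
  move=> mn; rewrite -AB //; move/orb_dcap: fA => <- //=.
  by rewrite dcap_dimr.
have [f2 [E2 G2]] := @generic_flag n k V f1 f (nmx B) (fun m mn => esym (df m mn)).
have fB : orb B (f, f2) by apply/orb_dcap.
have [C EC] : exists C : orbmx n r, nmx C = relpos f1 f2.
  apply: orbmx_of; rewrite -rk_full -(proj1 (relpos_rk f1 f2 _) erefl) //.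
  by rewrite /dcap !st_full capvv dimV.
have fC : orb C (f1, f2) by apply/orbP.
have tC : tprod A B C.
  move=> i j i_n jn; move/orb_dcap: (fA) => /= dA; move/orb_dcap: (fB) => /= dB.
  move/orb_dcap: (fC) => /= dC; split.
    move=> m mn; rewrite -dA // -(dB m j) // -dC // -df //; exact: dcap_triangle.
  have [m mn E] := G2 i j i_n jn; exists m => //.
  by rewrite -dA // -(dB m j) // -dC // -df.
exists C => //.
have CS p : orb C p -> orbS A B p.
  move=> /orbP pC; have /same_orbitP[g gk Hg] : same_orbit (f1, f2) p.
    by apply: relpos_transitive; rewrite pC; move/orbP: fC.
  have [f' Ef'] := flag_image f gk; exists f'; split; apply/orb_dcap => i j i_n jn /=.
    move/orb_dcap: fA => /(_ i j i_n jn) <- /=; symmetry.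
    by apply: dcap_lim gk (proj1 (Hg i i_n)) _; rewrite Ef'.
  move/orb_dcap: fB => /(_ i j i_n jn) <- /=; symmetry.
  by apply: dcap_lim gk _ (proj2 (Hg j jn)); rewrite Ef'.
have oC := generic_orbit_open tC CS.
rewrite /orb_mul; case: asboolP => [_|]; last by case; exists (f1, f2); exists f.
case: pickP => [C' /asboolP oC'|/(_ C)/asboolP//].
have [p' Cp'] := orb_nonempty C'.
by rewrite (open_orbit_unique oC oC' fC Cp').
Qed.

Theorem orb_mul_eq0 A B : ~ composable A B -> orb_mul V A B = 0.
Proof.
move=> nAB; rewrite /orb_mul; case: asboolP => // -[p [f [fA fB]]]; case: nAB => m mn.
move/orb_dcap: fA => <- //=; move/orb_dcap: fB => <- //=.
by rewrite dcap_dimr // dcap_diml.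
Qed.

End OpenOrbit.

(** * The generic algebra *)

Section GeneratorOrbits.
Variables n r : nat.
Implicit Types (A B C : orbmx n r) (d : dcomp n r).

Fact orbit_elt_key : {f : orbmx n r -> Gnr n r | forall A, f A = << A >>}.
Proof. by exists (fun A => << A >>). Qed.

(** The basis element of [A], sealed to prevent comparisons of basis elements by
    computation in the free module. *)
Definition orbit_elt : orbmx n r -> Gnr n r := sval orbit_elt_key.

Lemma orbit_eltE A : orbit_elt A = << A >>. Proof. exact: (svalP orbit_elt_key). Qed.

Lemma orbit_elt_inj A B : orbit_elt A = orbit_elt B -> A = B.
Proof.
pose f C : int := (C == A)%:R.
have lf C : lext f (orbit_elt C) = f C by rewrite orbit_eltE lextU.
by move/(congr1 (lext f)); rewrite !lf /f eqxx; case: eqP => [->|].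
Qed.

Lemma gen_basisE A : gen_basis r (map_mx Posz (nmx A)) = orbit_elt A.
Proof.
rewrite orbit_eltE /gen_basis (big_pred1 A) // => B /=.
apply/eqP/eqP => [E|-> //]; apply: nmx_inj.
by apply/matrixP => i j; have /matrixP/(_ i j) := E; rewrite !mxE => -[].
Qed.

Lemma gen_k_orbit d : exists2 A, gen_k d = orbit_elt A &
  forall i j, ork A i j = minn (psd d i) (psd d j).
Proof.
pose M : 'M[nat]_n := \matrix_(a, b) (if a == b then part d a else 0%N).
have sM : (\sum_i \sum_j M i j)%N = r by rewrite -rk_full rk_diag minnn; exact: psd_full.
have [A EA] := orbmx_of sM; exists A; last by move=> i j; rewrite /ork EA rk_diag.
rewrite -gen_basisE EA; congr (gen_basis r _); apply/matrixP => a b.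
by rewrite /M !mxE; case: (eqVneq a b) => [->|_].
Qed.

Lemma gen_move_orbit d (x y : 'I_n) : x != y -> (0 < part d y)%N ->
  exists2 A, gen_basis r (diag_mx (vec d) - delta_mx y y + delta_mx x y) = orbit_elt A &
  forall i j, (ork A i j + ((y < i) && (y < j))
               = minn (psd d i) (psd d j) + ((x < i) && (y < j)))%N.
Proof.
move=> xy dy; pose D : 'M[nat]_n := \matrix_(a, b) (if a == b then part d a else 0%N).
pose M : 'M[nat]_n := \matrix_(a, b) (D a b - dmx y y a b + dmx x y a b)%N.
have Dy a b : (dmx y y a b <= D a b)%N.
  rewrite /D !mxE; case: (eqVneq a y) => //= ->; case: (eqVneq b y) => //= ->.
have EM : \matrix_(a, b) (M a b + dmx y y a b)%N = \matrix_(a, b) (D a b + dmx x y a b)%N.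
  apply/matrixP => a b; rewrite mxE [RHS]mxE [M a b]mxE.
  by rewrite addnAC subnK.
have Erk i j : (rk M i j + ((y < i) && (y < j))
               = minn (psd d i) (psd d j) + ((x < i) && (y < j)))%N.
  by rewrite -!rk_dmx -[minn _ _](rk_diag (part d)) -!rkD EM.
have sM : (\sum_i \sum_j M i j)%N = r.
  by rewrite -rk_full; have := Erk n n; rewrite !ltn_ord minnn psd_full /=; lia.
have [A EA] := orbmx_of sM; exists A; last by move=> i j; rewrite /ork EA.
rewrite -gen_basisE EA; congr (gen_basis r _); apply/matrixP => a b.
rewrite [RHS]mxE [M a b]mxE PoszD -subzn // !mxE.
rewrite (eq_sym a b); case: (eqVneq b a) => [->|_].
  by rewrite mulr1n; congr (_ - _ + _); case: (_ && _).
by rewrite mulr0n; congr (_ - _ + _); case: (_ && _).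
Qed.

(** The only partial sum that changes along an arrow of index [i] is the one at
    [i.+1]. *)
Lemma psd_arrow (b : bool) (i : 'I_n.-1) d d' : is_arrow (b, i, d, d') ->
  [/\ (0 < part d (if b then hi i else lo i))%N,
      (forall m, m != i.+1 -> psd d' m = psd d m)
    & (psd d' i.+1 = if b then (psd d i.+1).+1 else (psd d i.+1).-1)%N].
Proof.
move=> /eqP E; pose x := if b then lo i else hi i; pose y := if b then hi i else lo i.
have xy : x != y.
  by apply/eqP => /(congr1 val); rewrite /x /y; case: (b) => /=; lia.
have Ep a : (part d' a + (a == y) = part d a + (a == x))%N.
  have := congr1 (fun v : 'rV[int]_n => v 0 a) E; rewrite !mxE /alphaB /alpha.
  by rewrite /x /y; case: b {E x y xy} => /=; rewrite !mxE /=; lia.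
have Es m : (psd d' m + (y < m) = psd d m + (x < m))%N.
  by rewrite -!psum_delta -!psumD; apply: eq_psum.
have py : (0 < part d y)%N by have := Ep y; rewrite eqxx eq_sym (negPf xy); lia.
split=> //.
  by move=> m mi; have := Es m; rewrite /x /y; case: (b) => /=; lia.
have := Es i.+1; have := psumS (part d) (lo i); rewrite -!/(psd _ _) /=.
by move: py; rewrite /x /y; case: (b) => /=; lia.
Qed.

Definition agen (a : sigma_arrow n r) : Gnr n r :=
  let: (b, i, d, _) := val a in if b then gen_e i d else gen_f i d.

(** The orbit of a pair of flags that differ in a single step, where one contains
    the other: all their steps are comparable, so the smaller dimension is that
    of the intersection. *)
Lemma agen_orbit (a : sigma_arrow n r) : exists2 A, agen a = orbit_elt A &
  forall i j, ork A i j = minn (psd (val a).2 i) (psd (val a).1.2 j).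
Proof.
rewrite /agen; case: a => -[[[b i] d] d'] /= Ha; have [py Ed Ei] := psd_arrow Ha.
have lohi : lo i != hi i by apply/eqP => /(congr1 val) /=; lia.
have mono m m' : (m <= m')%N -> (psd d m <= psd d m')%N by apply: psum_le.
have slo := psumS (part d) (lo i); have shi := psumS (part d) (hi i).
rewrite -!/(psd _ _) /= in slo shi.
have main A x y : (forall p q, (ork A p q + ((y < p) && (y < q))
               = minn (psd d p) (psd d q) + ((x < p) && (y < q)))%N) ->
    x = (if b then lo i else hi i) :> nat -> y = (if b then hi i else lo i) :> nat ->
    forall p q, ork A p q = minn (psd d' p) (psd d q).
  move=> EA ex ey p q; have := EA p q; rewrite ex ey.
  have [->|pi] := eqVneq p i.+1.
    rewrite Ei; have := mono q i.+1; have := mono i.+1 q; have := mono i.+2 q.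
    have := mono q i; have := mono i q; rewrite /= in py *.
    by move: py; case: (b) => /= py; rewrite ?ltnSn ?ltnn /=; lia.
  have E : (lo i < p)%N = (hi i < p)%N by move: pi => /=; lia.
  by rewrite Ed //; case: (b); rewrite E; lia.
case: b py main {Ha Ed Ei} => py main.
  rewrite /gen_e; have [A -> EA] := gen_move_orbit lohi py.
  by exists A => //; apply: main EA _ _.
rewrite eq_sym in lohi.
rewrite /gen_f; have [A -> EA] := gen_move_orbit lohi py.
by exists A => //; apply: main EA _ _.
Qed.

End GeneratorOrbits.

Section TropicalProduct.
Variables (n r : nat) (omul : orbmx n r -> orbmx n r -> Gnr n r).
Implicit Types (A B C : orbmx n r) (d : dcomp n r).

(** All that is used about the product of orbits from here on. *)
Record tropical : Prop := Tropical {
  omul_tprod : forall A B, composable A B -> exists2 C, tprod A B C & omul A B = orbit_elt C;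
  omul_eq0 : forall A B, ~ composable A B -> omul A B = 0 }.

Hypothesis TR : tropical.

Definition gmul : Gnr n r -> Gnr n r -> Gnr n r := locked (lext2 omul).

Lemma gmulE x y : gmul x y = lext2 omul x y.
Proof. by rewrite /gmul -lock. Qed.

Lemma gmulU A B : gmul (orbit_elt A) (orbit_elt B) = omul A B.
Proof. by rewrite gmulE !orbit_eltE; exact: lext2U. Qed.

Lemma gmulBl x x' y : gmul (x - x') y = gmul x y - gmul x' y.
Proof. by rewrite !gmulE lext2Bl. Qed.
Lemma gmulBr x y y' : gmul x (y - y') = gmul x y - gmul x y'.
Proof. by rewrite !gmulE lext2Br. Qed.
Lemma gmul0l y : gmul 0 y = 0.
Proof. by rewrite -{1}[0](subrr 0) gmulBl subrr. Qed.
Lemma gmul0r x : gmul x 0 = 0.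
Proof. by rewrite -{1}[0](subrr 0) gmulBr subrr. Qed.

HB.instance Definition _ x := GRing.isZmodMorphism.Build (Gnr n r) (Gnr n r)
  (gmul x) (gmulBr x).

Definition gmulr y x : Gnr n r := gmul x y.

HB.instance Definition _ y := GRing.isZmodMorphism.Build (Gnr n r) (Gnr n r)
  (gmulr y) (fun x x' => gmulBl x x' y).

Lemma composable_tprodl A B C D : tprod A B D -> composable A B ->
  composable D C <-> composable B C.
Proof.
by move=> P AB; split=> H m mn; have := H m mn; rewrite (tprod_col P AB mn).
Qed.

Lemma composable_tprodr A B C D : tprod B C D ->
  composable A D <-> composable A B.
Proof.
by move=> P; split=> H m mn; have := H m mn; rewrite (tprod_row P mn).
Qed.

(** By associativity of the tropical product, since the product of two orbits is
    composable with a third exactly if the factor next to it is. *)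
Lemma gmulA : associative gmul.
Proof.
move=> x y z.
apply: (@malg_additive_ext _ _ (gmulr (gmul y z)) (gmulr z \o gmulr y)) => A /=.
rewrite -(orbit_eltE A); pose h (x : Gnr n r) : {additive Gnr n r -> Gnr n r} := gmul x.
apply: (@malg_additive_ext _ _ (h (orbit_elt A) \o gmulr z) (gmulr z \o h (orbit_elt A))) => B /=.
rewrite -(orbit_eltE B).
apply: (@malg_additive_ext _ _ (h (orbit_elt A) \o h (orbit_elt B))
  (h (gmul (orbit_elt A) (orbit_elt B)))) => C /=.
rewrite -(orbit_eltE C) /gmulr.
rewrite (gmulU B C) (gmulU A B).
have [AB|nAB] := pselect (composable A B); last first.
  rewrite (omul_eq0 TR nAB) gmul0l; have [BC|nBC] := pselect (composable B C).
    have [D P ->] := omul_tprod TR BC; rewrite (gmulU A D) (omul_eq0 TR) //.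
    by move/(composable_tprodr _ P).
  by rewrite (omul_eq0 TR nBC) gmul0r.
have [D P ->] := omul_tprod TR AB; rewrite (gmulU D C).
have [BC|nBC] := pselect (composable B C); last first.
  rewrite (omul_eq0 TR nBC) gmul0r (omul_eq0 TR) //.
  by move/(composable_tprodl _ P AB).
have [D' P' ->] := omul_tprod TR BC; rewrite (gmulU A D').
have DC : composable D C by apply/(composable_tprodl C P AB).
have AD' : composable A D' by apply/(composable_tprodr A P').
have [E Q ->] := omul_tprod TR DC; have [E' Q' ->] := omul_tprod TR AD'.
by rewrite (tprod_assoc P Q P' Q').
Qed.

Lemma gen_k_mul d C :
  (forall i, (i <= n)%N -> ork C i n = psd d i) -> gmul (gen_k d) (orbit_elt C) = orbit_elt C.
Proof.
move=> rC; have [A -> EA] := gen_k_orbit d.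
have AC : composable A C by move=> m mn; rewrite EA psd_full rC //; apply/minn_idPr/psd_le.
have [D P] := omul_tprod TR AC; rewrite gmulU => ->.
rewrite (tprod_unique P (C' := C)) // => i j i_n jn; split; last first.
  by exists i => //; rewrite EA rC // minnn addnC.
move=> m mn; rewrite EA !rC //; case: (leqP m i) => mi.
  have : (psd d m <= psd d i)%N by apply: psum_le.
  by have : (ork C m j <= ork C i j)%N := rk_lel _ _ mi; lia.
have imn : (i <= m <= n)%N by rewrite mn ltnW.
have := rk_super (nmx C) imn jn; rewrite -!/(ork C _ _) !rC //.
have : (psd d i <= psd d m)%N by apply: psum_le; apply: ltnW.
by lia.
Qed.

Lemma gen_k_mul_neq d C :
  ~ (forall i, (i <= n)%N -> ork C i n = psd d i) -> gmul (gen_k d) (orbit_elt C) = 0.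
Proof.
move=> rC; have [A -> EA] := gen_k_orbit d; rewrite gmulU (omul_eq0 TR) // => AC.
by apply: rC => i i_n; rewrite -AC // EA psd_full; apply/minn_idPr/psd_le.
Qed.

Definition has_rank (x : Gnr n r) (rho : nat -> nat -> nat) := exists2 C, x = orbit_elt C &
  forall i j, (i <= n)%N -> (j <= n)%N -> ork C i j = rho i j.

Lemma has_rank_inj x y rho sigma : has_rank x rho -> has_rank y sigma ->
  (forall i j, (i <= n)%N -> (j <= n)%N -> rho i j = sigma i j) -> x = y.
Proof.
move=> [C -> EC] [D -> ED] rs; congr orbit_elt; apply: ork_inj => i j i_n jn.
by rewrite EC // ED // rs.
Qed.

(** Each row of the generator is generic relative to the middle flag, so that
    [tprod_generic_row] computes the product row by row. *)
Lemma agen_mul (a : sigma_arrow n r) C :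
  (forall i, (i <= n)%N -> ork C i n = psd (val a).1.2 i) ->
  has_rank (gmul (agen a) (orbit_elt C)) (op n (val a).1.1.1 (val a).1.1.2 (ork C)).
Proof.
move=> rC; have [A -> EA] := agen_orbit a.
have AC : composable A C.
  by move=> m mn; rewrite EA psd_full rC //; apply/minn_idPr/psd_le.
have [D P] := omul_tprod TR AC; rewrite gmulU => ->; exists D => // p j pn jn.
case: a rC EA => -[[[b i] d] d'] /= Ha rC EA; have [py Ed Ei] := psd_arrow Ha.
have i2n : (i.+2 <= n)%N by apply: (ltn_ord (hi i)).
have i1n : (i.+1 <= n)%N by apply: ltnW.
have slo := psumS (part d) (lo i); have shi := psumS (part d) (hi i).
rewrite -!/(psd _ _) /= in slo shi.
have row t u : psd d' p = t -> (u < n)%N -> (ork C u n <= t <= ork C u.+1 n)%N ->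
   (ork D p j + ork C u.+1 n = maxn (ork C u j + ork C u.+1 n) (ork C u.+1 j + t))%N.
  move=> et un ut; apply: (tprod_generic_row P) => // m mn.
  by rewrite EA et rC.
rewrite /op; case: eqP => [pE|/eqP pi]; last first.
  have := Ed p pi => {}Ed.
  have [pn'|pn'] := eqVneq p n; first by rewrite pn' (tprod_col P AC).
  have pn1 : (p < n)%N by rewrite ltn_neqAle pn'.
  have lep : (psd d p <= psd d p.+1)%N by apply: psum_le.
  have := row _ p Ed pn1; rewrite !rC // leqnn lep => /(_ isT).
  have pp : (p <= p.+1 <= n)%N by rewrite leqnSn.
  by have := rk_super (nmx C) pp jn; rewrite -!/(ork C _ _) !rC //; lia.
have E0 : psd d' p = (if b then (psd d i.+1).+1 else (psd d i.+1).-1) by rewrite pE.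
case: b py Ha Ed Ei E0 => py Ha Ed Ei E0 /=.
  have := row _ i.+1 E0 i2n; rewrite !rC // => /(_ ltac:(rewrite /= in py; lia)).
  by have := rk_lel (nmx C) j (leqnSn i.+1); rewrite -!/(ork C _ _); lia.
have := row _ i E0 i1n; rewrite !rC ?(ltnW i1n) // => /(_ ltac:(rewrite /= in py; lia)).
by move: py => /=; lia.
Qed.

End TropicalProduct.

(** * Evaluation of paths in the generic algebra *)

Section Evaluation.
Variables (n r : nat) (omul : orbmx n r -> orbmx n r -> Gnr n r).
Hypothesis TR : tropical omul.
Implicit Types (A B C : orbmx n r) (d : dcomp n r).
Local Notation gmul := (gmul omul).
Local Notation Sg := (Sigma n r).
Local Notation arr := (arrow Sg).

(** The arrows of a path are listed in the order in which they are traversed, so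
    the first of them acts first. *)
Definition gact (s : seq arr) (x : Gnr n r) : Gnr n r :=
  foldl (fun y (a : arr) => gmul (agen a) y) x s.

Definition path_eval (p : qpath Sg) : Gnr n r := gact (parrows p) (gen_k (pstart p)).

(** The homomorphism from the path algebra that induces [eta]. *)
Definition Phi : ZSigma n r -> Gnr n r := lext path_eval.

HB.instance Definition _ := GRing.Additive.on Phi.

Lemma PhiU p : Phi << p >> = path_eval p. Proof. exact: lextU. Qed.

Lemma gact_orbit (s : seq arr) (v : dcomp n r) C : chain (v : vertex Sg) s ->
  (forall i, (i <= n)%N -> ork C i n = psd v i) ->
  exists2 C', gact s (orbit_elt C) = orbit_elt C' &
    (forall j, (j <= n)%N -> ork C' n j = ork C n j) /\
    (forall i, (i <= n)%N ->
     ork C' i n = psd (last (v : vertex Sg) (map (@target Sg) s) : dcomp n r) i).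
Proof.
elim: s v C => [|a s IHs] v C /=; first by exists C.
case/andP=> /eqP av ch rC; have [A EA rA] := agen_orbit a.
have AC : composable A C.
  move=> m mn; rewrite rA psd_full rC // -av; apply/minn_idPr; exact: psd_le.
rewrite EA gmulU; have [D P ->] := omul_tprod TR AC.
have rD i : (i <= n)%N -> ork D i n = psd (val a).2 i.
  by move=> i_n; rewrite (tprod_row P) // rA psd_full; apply/minn_idPl/psd_le.
have [C' -> [colC' rowC']] := IHs _ _ ch rD; exists C' => //; split=> // j jn.
by rewrite colC' // (tprod_col P AC).
Qed.

Lemma path_eval_orbit p : exists2 C, path_eval p = orbit_elt C &
  (forall j, (j <= n)%N -> ork C n j = psd (pstart p : dcomp n r) j) /\
  (forall i, (i <= n)%N -> ork C i n = psd (pend p : dcomp n r) i).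
Proof.
have [A EA rA] := gen_k_orbit (pstart p : dcomp n r).
have row i : (i <= n)%N -> ork A i n = psd (pstart p : dcomp n r) i.
  by move=> i_n; rewrite rA psd_full; apply/minn_idPl/psd_le.
have [C EC [cC rC]] := gact_orbit (valP p) row.
exists C; first by rewrite /path_eval EA.
split=> // j jn; rewrite cC // rA psd_full; apply/minn_idPr; exact: psd_le.
Qed.

Lemma gact_mul (s : seq arr) x y : gact s (gmul x y) = gmul (gact s x) y.
Proof. by elim: s x => //= a s IHs x; rewrite gmulA // IHs. Qed.

Lemma PhiM x y : Phi (x * y) = gmul (Phi x) (Phi y).
Proof.
rewrite -[x * y]/(pa_mul x y).
apply: (@malg_additive_ext _ _ (Phi \o pa_mulr y) (gmulr omul (Phi y) \o Phi)) => p /=.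
apply: (@malg_additive_ext _ _ (Phi \o pa_mul << p >>) (gmul (Phi << p >>) \o Phi)) => q /=.
rewrite (pa_mulU p q) /pmul.
apply: (etrans _ (esym (f_equal2 gmul (PhiU p) (PhiU q)))).
case: eqP => [qp|nqp].
  have [C EC [_ rC]] := path_eval_orbit q.
  rewrite PhiU /path_eval pstart_comp // parrows_comp // /gact foldl_cat.
  rewrite -/(gact _ (gen_k _)) -/(path_eval q) EC -gact_mul gen_k_mul // -qp.
  exact: rC.
rewrite raddf0; have [C -> [cC _]] := path_eval_orbit p.
have [D -> [_ rD]] := path_eval_orbit q.
rewrite gmulU omul_eq0 // => CD; apply: nqp; apply: (@psd_inj n r) => i i_n.
by rewrite -cC // CD // rD.
Qed.

Lemma Phi_sK d : Phi (sK d) = gen_k d.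
Proof. exact: PhiU. Qed.

Lemma Phi1 : Phi 1 = gen_one n r.
Proof.
rewrite -[1]/(pa_one Sg) /pa_one raddf_sum; apply: eq_bigr => d _; exact: Phi_sK.
Qed.

Definition sX (b : bool) (i : 'I_n.-1) d : ZSigma n r :=
  \sum_(a : sigma_arrow n r | (val a).1 == (b, i, d)) << arrow_path (a : arr) >>.

Definition tX (b : bool) (i : 'I_n.-1) : ZSigma n r := \sum_d sX b i d.

Lemma target_uniq (a a' : sigma_arrow n r) : (val a).1 = (val a').1 -> a = a'.
Proof.
case: a a' => -[[[b i] d] d'] Ha [[[[b' i'] d1] d1'] Ha'] /= [eb ei ed].
apply: val_inj => /=; rewrite -eb -ei -ed; congr (_, _).
move: Ha Ha'; rewrite /= -eb -ei -ed => /eqP <- /eqP E.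
apply/val_inj/ffunP => a; apply/val_inj.
by have := congr1 (fun v : 'rV[int]_n => v 0 a) E; rewrite !mxE => -[].
Qed.

Lemma arrow_exists (b : bool) (i : 'I_n.-1) d :
  (0 < part d (if b then hi i else lo i))%N ->
  exists a : sigma_arrow n r, (val a).1 = (b, i, d).
Proof.
move=> py; pose x := if b then lo i else hi i; pose y := if b then hi i else lo i.
have xy : x != y.
  by apply/eqP => /(congr1 val); rewrite /x /y; case: (b) => /=; lia.
pose f a := (part d a + (a == x) - (a == y))%N.
have Ef a : (f a + (a == y) = part d a + (a == x))%N.
  rewrite /f subnK //; case: eqP => // ->; rewrite /y in py *.
  exact: leq_trans py (leq_addr _ _).
have sf : (\sum_a f a)%N = r.
  have : (\sum_a (f a + (a == y)) = \sum_a (part d a + (a == x)))%N by apply: eq_bigr.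
  rewrite !big_split /= -!psum_full !psum_delta !ltn_ord -/(psd d n) psd_full.
  by lia.
have [d' Ed'] := dcomp_of sf.
have Ha : is_arrow (b, i, d, d').
  apply/eqP/rowP => a; rewrite !mxE /alphaB /alpha Ed'; have := Ef a.
  by rewrite /x /y; case: (b) => /=; rewrite !mxE /=; lia.
by exists (Sub (b, i, d, d') Ha).
Qed.

Lemma arrow_part (a : sigma_arrow n r) b i d : (val a).1 = (b, i, d) ->
  (0 < part d (if b then hi i else lo i))%N.
Proof.
by case: a => -[[[b' i'] d1] d'] /= Ha [<- <- <-]; have [] := psd_arrow Ha.
Qed.

Lemma tX_mul_orbit b i C d : (forall m, (m <= n)%N -> ork C m n = psd d m) ->
  gmul (Phi (tX b i)) (orbit_elt C) =
  \sum_(a : sigma_arrow n r | (val a).1 == (b, i, d)) gmul (agen a) (orbit_elt C).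
Proof.
move=> rC; rewrite -[LHS]/(gmulr omul (orbit_elt C) (Phi (tX b i))).
rewrite /tX (raddf_sum Phi) raddf_sum /=.
have arrM d' (a : sigma_arrow n r) : (val a).1 = (b, i, d') ->
    gmulr omul (orbit_elt C) (Phi << arrow_path (a : arr) >>)
    = gmul (agen a) (gmul (gen_k d') (orbit_elt C)).
  move=> Ea; rewrite PhiU /path_eval /gact /= /gmulr -gmulA //.
  by rewrite /pstart /= Ea.
rewrite (bigD1 d) //= /sX (raddf_sum Phi) raddf_sum /= [X in _ + X]big1 ?addr0.
  by apply: eq_bigr => a /eqP Ea; rewrite (arrM _ _ Ea) gen_k_mul.
move=> d' d'd; rewrite (raddf_sum Phi) raddf_sum big1 //= => a /eqP Ea.
rewrite (arrM _ _ Ea) gen_k_mul_neq ?gmul0r // => rC'.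
case/eqP: d'd; apply: psd_inj => m mn; by rewrite -rC' // rC.
Qed.

Lemma row_lo d (i : 'I_n.-1) : psd d i.+1 = (psd d i + part d (lo i))%N.
Proof. exact: (psumS (part d) (lo i)). Qed.

Lemma row_hi d (i : 'I_n.-1) : psd d i.+2 = (psd d i.+1 + part d (hi i))%N.
Proof. exact: (psumS (part d) (hi i)). Qed.

(** Only the arrow that starts at the row sums of the orbit contributes. So the
    generators act on an orbit through its rank function, and words of
    generators can be compared by comparing operators on rank functions. *)
Lemma tX_mul b (i : 'I_n.-1) x rho : has_rank x rho ->
  if acts n b i rho then has_rank (gmul (Phi (tX b i)) x) (op n b i rho)
  else gmul (Phi (tX b i)) x = 0.
Proof.
move=> [C -> EC]; have [d Ed] := row_dcomp C.
have i2n : (i.+2 <= n)%N by apply: (ltn_ord (hi i)).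
have i1n : (i.+1 <= n)%N by apply: ltnW.
have i0n : (i <= n)%N by apply: ltnW.
rewrite (tX_mul_orbit b i (fun m _ => esym (Ed m))).
have Eact : acts n b i rho = (0 < part d (if b then hi i else lo i))%N.
  rewrite /acts; have := row_lo d i; have := row_hi d i; rewrite !Ed !EC //.
  by case: (b); lia.
rewrite Eact; case: ltnP => py.
  have [a Ea] := arrow_exists py.
  rewrite (big_pred1 a) => [|a']; last first.
    by apply/eqP/eqP => [Ea'|->//]; apply: target_uniq; rewrite Ea.
  have rC m : (m <= n)%N -> ork C m n = psd (val a).1.2 m by rewrite Ea.
  have [D -> ED] := agen_mul TR rC; exists D => // p j pn jn.
  rewrite ED // Ea /= /op; case: eqP => _; last exact: EC.
  by case: (b); rewrite !EC.
rewrite big1 // => a /eqP /arrow_part; lia.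
Qed.

End Evaluation.

(** * Words of generators with the same action *)

Section RankWords.
Variable n : nat.
Implicit Type rho : nat -> nat -> nat.

Fixpoint opw (w : seq (bool * nat)) rho : nat -> nat -> nat :=
  if w is x :: w' then op n x.1 x.2 (opw w' rho) else rho.

Fixpoint actsw (w : seq (bool * nat)) rho : bool :=
  if w is x :: w' then actsw w' rho && acts n x.1 x.2 (opw w' rho) else true.

Definition same_action w w' rho := actsw w rho = actsw w' rho /\
  (actsw w rho -> forall a j, (a <= n)%N -> (j <= n)%N -> opw w rho a j = opw w' rho a j).

Let t1 i : ((i == i.+1) = false) * ((i.+1 == i) = false). Proof. by split; lia. Qed.
Let t2 i : ((i == i.+2) = false) * ((i.+2 == i) = false). Proof. by split; lia. Qed.
Let t3 i : ((i == i.+3) = false) * ((i.+3 == i) = false). Proof. by split; lia. Qed.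
(* The new last column entry of a row raised by op. *)
Let raised x y : maxn x (y + x.+1 - y) = x.+1. Proof. by lia. Qed.
Let tests := (eqSS, eqxx, t1, t2, t3, raised).


(* The operators change at most the rows i.+1 and i.+2. In each of them the two
   sides are maxima of linear functions of the entries of rho in the columns j
   and n, whose order is decided by the inequalities in rank_fun. *)
Ltac split_max :=
  repeat match goal with
  | |- context [maxn ?a ?b] =>
      lazymatch a with context [maxn _ _] => fail | _ => idtac end;
      lazymatch b with context [maxn _ _] => fail | _ => idtac end;
      case: (leqP a b)
  end.

Ltac action i rho :=
  let mo := fresh "mo" in let li := fresh "li" in let i2n := fresh "i2n" in
  let i1n := fresh "i1n" in let i0n := fresh "i0n" in let N01 := fresh "N01" in
  let N12 := fresh "N12" in let N23 := fresh "N23" in let ac := fresh "ac" in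
  let a := fresh "a" in let j := fresh "j" in let jn := fresh "jn" in
  move=> i2n [mo li];
  have i1n : (i.+1 < n)%N := ltnW i2n;
  have i0n : (i < n)%N := ltnW i1n;
  have := mo i n i0n; have := mo i.+1 n i1n; have := mo i.+2 n i2n;
  rewrite /same_action /= /acts /op !tests;
  move=> N23 N12 N01; split;
  [ clear mo li i2n i1n i0n; move: N01 N12 N23;
    move: (rho i n) (rho i.+1 n) (rho i.+2 n) (rho i.+3 n); clear; lia
  | move=> ac a j _ jn; move: N01 N12 N23 ac;
    have := mo i j i0n; have := mo i.+1 j i1n; have := mo i.+2 j i2n;
    have := li i j i0n jn; have := li i.+1 j i1n jn; have := li i.+2 j i2n jn;
    (have : ~~ ((a == i.+1) && (a == i.+2)) by clear; lia);
    case: (a == i.+1); case: (a == i.+2) => //= _;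
    clear mo li i2n i1n i0n jn;
    move: (rho i n) (rho i.+1 n) (rho i.+2 n) (rho i.+3 n);
    move: (rho i j) (rho i.+1 j) (rho i.+2 j) (rho i.+3 j); clear;
    move=> x0 x1 x2 x3 N0 N1 N2 N3 l3 l2 l1 m3 m2 m1 N01 N12 N23 ac; split_max; lia ].

Lemma same_EEE1 i rho : (i.+2 < n)%N -> rank_fun n rho ->
  same_action [:: (true, i); (true, i); (true, i.+1)]
              [:: (true, i); (true, i.+1); (true, i)] rho.
Proof. action i rho. Qed.

Lemma same_EEE2 i rho : (i.+2 < n)%N -> rank_fun n rho ->
  same_action [:: (true, i.+1); (true, i); (true, i.+1)]
              [:: (true, i); (true, i.+1); (true, i.+1)] rho.
Proof. action i rho. Qed.

Lemma same_FFF1 i rho : (i.+2 < n)%N -> rank_fun n rho ->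
  same_action [:: (false, i.+1); (false, i); (false, i)]
              [:: (false, i); (false, i.+1); (false, i)] rho.
Proof. action i rho. Qed.

Lemma same_FFF2 i rho : (i.+2 < n)%N -> rank_fun n rho ->
  same_action [:: (false, i.+1); (false, i); (false, i.+1)]
              [:: (false, i.+1); (false, i.+1); (false, i)] rho.
Proof. action i rho. Qed.

Lemma same_EF_next i rho : (i.+2 < n)%N -> rank_fun n rho ->
  same_action [:: (true, i); (false, i.+1)] [:: (false, i.+1); (true, i)] rho.
Proof. action i rho. Qed.

Lemma same_EF_prev i rho : (i.+2 < n)%N -> rank_fun n rho ->
  same_action [:: (true, i.+1); (false, i)] [:: (false, i); (true, i.+1)] rho.
Proof. action i rho. Qed.

Lemma same_EF_swap i rho : (i.+1 < n)%N -> rank_fun n rho ->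
  (rho i n < rho i.+1 n)%N -> (rho i.+1 n < rho i.+2 n)%N ->
  same_action [:: (true, i); (false, i)] [:: (false, i); (true, i)] rho.
Proof.
move=> i_n [mo li] l1 l2; have i0 := ltnW i_n; rewrite /same_action /= /acts /op !tests; split.
  by have := mo i n i0; have := mo i.+1 n i_n; lia.
move=> _ a j _ jn; have := mo i j i0; have := mo i.+1 j i_n.
have := li i j i0 jn; have := li i.+1 j i_n jn.
by case: (a == i.+1) => //; split_max; lia.
Qed.

Lemma same_EF_id i rho : (i.+1 < n)%N -> rank_fun n rho ->
  (rho i n < rho i.+1 n)%N -> rho i.+1 n = rho i.+2 n ->
  same_action [:: (true, i); (false, i)] [::] rho.
Proof.
move=> i_n [mo li] l1 l2; have i0 := ltnW i_n; rewrite /same_action /= /acts /op !tests; split.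
  by lia.
move=> _ a j _ jn; case: (eqVneq a i.+1) => // ->.
have := mo i j i0; have := mo i.+1 j i_n.
by have := li i j i0 jn; have := li i.+1 j i_n jn; lia.
Qed.

Lemma same_FE_id i rho : (i.+1 < n)%N -> rank_fun n rho ->
  rho i n = rho i.+1 n -> (rho i.+1 n < rho i.+2 n)%N ->
  same_action [:: (false, i); (true, i)] [::] rho.
Proof.
move=> i_n [mo li] l1 l2; have i0 := ltnW i_n; rewrite /same_action /= /acts /op !tests; split.
  by lia.
move=> _ a j _ jn; case: (eqVneq a i.+1) => // ->.
have := mo i j i0; have := mo i.+1 j i_n.
by have := li i j i0 jn; have := li i.+1 j i_n jn; lia.
Qed.

Lemma same_far b c i j rho : (i.+1 < j)%N -> (j.+1 < n)%N -> rank_fun n rho ->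
  same_action [:: (b, i); (c, j)] [:: (c, j); (b, i)] rho.
Proof.
move=> ij jn [mo li]; rewrite /same_action /= /acts /op.
have -> : (i == j.+1) = false by lia.
have -> : (i.+1 == j.+1) = false by lia.
have -> : (i.+2 == j.+1) = false by lia.
have -> : (j.+1 == i.+1) = false by lia.
have -> : (j.+2 == i.+1) = false by lia.
have -> : (j == i.+1) = false by lia.
split; first by case: (b); case: (c); rewrite andbC.
move=> _ a m _ _; case: (eqVneq a i.+1) => [->|//].
by have -> : (i.+1 == j.+1) = false by lia.
Qed.

End RankWords.

(** * Weights in the path algebra *)

Lemma sum_if_eq (M : nmodType) (I : finType) (P : pred I) (i0 : I) (x : M) :
  \sum_(i | P i) (if i0 == i then x else 0) = if P i0 then x else 0.
Proof.
rewrite big_mkcond (bigD1 i0) //= eqxx big1 ?addr0 // => i ii0.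
by rewrite eq_sym (negPf ii0) if_same.
Qed.

Section PathIdempotents.
Variables n r : nat.
Implicit Types (d : dcomp n r) (i : 'I_n.-1).
Local Notation Sg := (Sigma n r).
Local Notation arr := (arrow Sg).

Local Notation elt a := (<< arrow_path (a : arr) >> : ZSigma n r).

Lemma sK_mul d d' : sK d * sK d' = if d == d' then sK d else 0.
Proof.
rewrite -[LHS]/(pa_mul _ _) pa_mulU /pmul.
have -> : (pend (trivial_path (d' : vertex Sg)) == pstart (trivial_path (d : vertex Sg)))
        = (d == d') by rewrite eq_sym.
case: eqP => [->|_]; last exact: erefl.
by congr << _ >>; apply: val_inj; rewrite val_pcomp.
Qed.

Lemma arrow_mul_sK (a : arr) d :
  elt a * sK d = if (val a).1.2 == d then elt a else 0.
Proof.
rewrite -[LHS]/(pa_mul _ _) pa_mulU /pmul.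
have -> : (pend (trivial_path (d : vertex Sg)) == pstart (arrow_path a))
        = ((val a).1.2 == d) by rewrite eq_sym.
case: eqP => [E|_]; last exact: erefl.
by congr << _ >>; apply: val_inj; rewrite val_pcomp /= ?E.
Qed.

Lemma sK_mul_arrow (a : arr) d :
  sK d * elt a = if (val a).2 == d then elt a else 0.
Proof.
rewrite -[LHS]/(pa_mul _ _) pa_mulU /pmul.
have -> : (pend (arrow_path a) == pstart (trivial_path (d : vertex Sg)))
        = ((val a).2 == d) by [].
case: eqP => [E|_]; last exact: erefl.
by congr << _ >>; apply: val_inj; rewrite val_pcomp /= ?E.
Qed.

Lemma sum_sK : \sum_d sK d = 1 :> ZSigma n r.
Proof. by []. Qed.

Lemma vec_inj : injective (@vec n r).
Proof.
move=> d d' /rowP E; apply/val_inj/ffunP => a; apply: val_inj.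
by have := E a; rewrite !mxE => -[].
Qed.

Lemma sKz_vec d : sKz r (vec d) = sK d.
Proof.
rewrite /sKz (big_pred1 d) // => d' /=; apply/eqP/eqP => [/vec_inj //|->//].
Qed.

Lemma sKz_out (w : 'rV[int]_n) : (forall d, vec d != w) -> sKz r w = 0.
Proof. by move=> H; rewrite /sKz big_pred0 // => d; apply/negbTE/H. Qed.

Definition sgn_alpha (b : bool) i : 'rV[int]_n := if b then alphaB i else - alphaB i.

(** For a homogeneous element the idempotent on the left in the generators of the
    ideal follows from the one on the right. *)
Definition of_weight (x : ZSigma n r) (p : 'rV[int]_n) :=
  forall w, x * sKz r w = sKz r (w + p) * x.

Lemma of_weight_arrow (a : sigma_arrow n r) :
  of_weight (elt a) (sgn_alpha (val a).1.1.1 (val a).1.1.2).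
Proof.
move=> w; rewrite /sKz mulr_sumr mulr_suml.
have Ha : vec (val a).2 = vec (val a).1.2 + sgn_alpha (val a).1.1.1 (val a).1.1.2.
  by have := valP a; case: (val a) => [[[b i] d] d'] /eqP.
apply: (etrans (eq_bigr _ (fun d _ => arrow_mul_sK a d))).
apply: (etrans _ (esym (eq_bigr _ (fun d _ => sK_mul_arrow a d)))).
apply: (etrans (sum_if_eq _ _ _)); apply: (etrans _ (esym (sum_if_eq _ _ _))).
by rewrite Ha (inj_eq (addIr _)).
Qed.

Lemma of_weight_sum (I : Type) (s : seq I) (P : pred I) (F : I -> ZSigma n r) p :
  (forall x, P x -> of_weight (F x) p) -> of_weight (\sum_(i <- s | P i) F i) p.
Proof.
by move=> HF w; rewrite mulr_suml mulr_sumr; apply: eq_bigr => i /HF ->.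
Qed.

Lemma of_weight_tX b i : of_weight (tX r b i) (sgn_alpha b i).
Proof.
apply: of_weight_sum => d _; apply: of_weight_sum => a /eqP Ea.
by have := of_weight_arrow a; rewrite Ea.
Qed.

Lemma of_weightM x y p q : of_weight x p -> of_weight y q -> of_weight (x * y) (q + p).
Proof.
by move=> hx hy w; rewrite -mulrA hy mulrA hx -mulrA addrA.
Qed.

Lemma of_weightN x p : of_weight x p -> of_weight (- x) p.
Proof. by move=> hx w; rewrite mulNr mulrN hx. Qed.

Lemma of_weightD x y p : of_weight x p -> of_weight y p -> of_weight (x + y) p.
Proof. by move=> hx hy w; rewrite mulrDl mulrDr hx hy. Qed.

Lemma of_weight_sK d : of_weight (sK d) 0.
Proof.
move=> w; rewrite addr0 /sKz mulr_sumr mulr_suml; apply: eq_bigr => d' _.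
apply: (etrans (sK_mul d d')); apply: (etrans _ (esym (sK_mul d' d))).
by rewrite eq_sym; case: eqP => [->|_].
Qed.

Lemma tX_sK b i d : tX r b i * sK d = sX b i d.
Proof.
rewrite /tX mulr_suml.
have E d' : sX b i d' * sK d = if d == d' then sX b i d else 0.
  rewrite /sX mulr_suml; have [<-|dd'] := eqVneq d d'.
    apply: eq_bigr => a /eqP Ea; apply: (etrans (arrow_mul_sK a d)).
    by rewrite Ea eqxx.
  apply: big1 => a /eqP Ea; apply: (etrans (arrow_mul_sK a d)).
  by rewrite Ea eq_sym (negPf dd').
exact: (etrans (eq_bigr _ (fun d' _ => E d')) (sum_if_eq xpredT _ _)).
Qed.

Lemma of_weight_cubic x y p q : of_weight x p -> of_weight y q ->
  [/\ of_weight (x * x * y) (p *+ 2 + q), of_weight (x * y * x) (p *+ 2 + q)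
    & of_weight (y * (x * x)) (p *+ 2 + q)].
Proof.
move=> hx hy; have E z s t : of_weight z s -> s = t -> of_weight z t by move=> H <-.
split.
- by apply: E (of_weightM (of_weightM hx hx) hy) _; rewrite mulr2n addrC.
- by apply: E (of_weightM (of_weightM hx hy) hx) _; rewrite mulr2n (addrC q) addrA.
- by apply: E (of_weightM hy (of_weightM hx hx)) _; rewrite mulr2n.
Qed.

Lemma of_weight_comm x y p q : of_weight x p -> of_weight y q ->
  of_weight (x * y - y * x) (p + q).
Proof.
move=> hx hy; apply: of_weightD; last by apply/of_weightN/of_weightM.
by rewrite addrC; apply: of_weightM.
Qed.

Lemma of_weight_relP i j : of_weight (relP r i j) (pvec i j).
Proof.
have hE c : of_weight (tE r c) (alphaB c) := of_weight_tX true c.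
rewrite /relP /pvec expr2; have [h1 h2 h3] := of_weight_cubic (hE i) (hE j).
case: eqP => _ /=; last case: eqP => _.
- by apply: of_weightD h1 (of_weightN h2).
- by apply: of_weightD (of_weightN h2) h3.
- exact: of_weight_comm (hE i) (hE j).
Qed.

Lemma of_weight_relN i j : of_weight (relN r i j) (- pvec i j).
Proof.
have hF c : of_weight (tF r c) (- alphaB c) := of_weight_tX false c.
rewrite /relN /pvec expr2; have [h1 h2 h3] := of_weight_cubic (hF i) (hF j).
rewrite mulNrn in h1 h2 h3.
case: eqP => _ /=; last case: eqP => _; rewrite opprD.
- by apply: of_weightD (of_weightN h2) h3.
- by apply: of_weightD h1 (of_weightN h2).
- exact: of_weight_comm (hF i) (hF j).
Qed.

Lemma of_weight_relC i j : of_weight (relC r i j) (alphaB i - alphaB j).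
Proof.
have hE c : of_weight (tE r c) (alphaB c) := of_weight_tX true c.
have hF c : of_weight (tF r c) (- alphaB c) := of_weight_tX false c.
rewrite /relC; apply: of_weightD; last apply: of_weightN.
  exact: of_weight_comm (hE i) (hF j).
case: eqP => [->|_]; last by move=> w; rewrite mul0r mulr0.
rewrite subrr; apply: of_weight_sum => d _ w.
by rewrite mulrzAl mulrzAr of_weight_sK.
Qed.

Lemma lam_sK i d : (\sum_d' sK d' *~ lam i d') * sK d = sK d *~ lam i d :> ZSigma n r.
Proof.
rewrite mulr_suml.
have E d' : (sK d' *~ lam i d') * sK d = if d == d' then sK d *~ lam i d else 0 :> ZSigma n r.
  rewrite mulrzAl; apply: (etrans (congr1 (fun x => x *~ lam i d') (sK_mul d' d))).
  by rewrite eq_sym; case: eqP => [->|_]; rewrite ?mul0rz.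
exact: (etrans (eq_bigr _ (fun d' _ => E d')) (sum_if_eq xpredT _ _)).
Qed.

End PathIdempotents.

(** * The relations hold in the generic algebra *)

Lemma mul3_BA (R : pzRingType) (a b c a' b' c' x : R) :
  (a * b * c - a' * b' * c') * x = a * (b * (c * x)) - a' * (b' * (c' * x)).
Proof. by rewrite mulrBl -!mulrA. Qed.

Lemma mul3_NA (R : pzRingType) (a b c a' b' c' x : R) :
  (- (a' * b' * c') + a * (b * c)) * x = a * (b * (c * x)) - a' * (b' * (c' * x)).
Proof. by rewrite addrC mulrBl -!mulrA. Qed.

Lemma mul2_BA (R : pzRingType) (a b a' b' x : R) :
  (a * b - a' * b') * x = a * (b * x) - a' * (b' * x).
Proof. by rewrite mulrBl -!mulrA. Qed.

Section EvaluationOfWords.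
Variables (n r : nat) (omul : orbmx n r -> orbmx n r -> Gnr n r).
Hypothesis TR : tropical omul.
Implicit Types (d : dcomp n r) (i j : 'I_n.-1) (w : seq (bool * 'I_n.-1)).
Local Notation gmul := (gmul omul).
Local Notation Phi := (Phi omul).

Definition tws w d : ZSigma n r := foldr (fun l y => tX r l.1 l.2 * y) (sK d) w.

Definition act_word w (x : Gnr n r) := foldr (fun l y => gmul (Phi (tX r l.1 l.2)) y) x w.

Definition natw w : seq (bool * nat) := map (fun l => (l.1, nat_of_ord l.2)) w.

Lemma PhiB x y : Phi (x - y) = Phi x - Phi y. Proof. exact: raddfB. Qed.
Lemma Phi0 : Phi 0 = 0. Proof. exact: raddf0. Qed.

Lemma Phi_tws w d : Phi (tws w d) = act_word w (gen_k d).
Proof.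
elim: w => [|l w IHw]; first exact: Phi_sK.
exact: (etrans (PhiM TR _ _) (congr1 (gmul _) IHw)).
Qed.

Lemma act_word_rank w x rho : has_rank x rho ->
  if actsw n (natw w) rho then has_rank (act_word w x) (opw n (natw w) rho)
  else act_word w x = 0.
Proof.
move=> Hx; elim: w => //= l w; case: ifP => _ IHw; last by rewrite IHw gmul0r.
exact: (tX_mul TR l.1 l.2 IHw).
Qed.

Lemma act_word_same w w' x rho : has_rank x rho ->
  same_action n (natw w) (natw w') rho -> act_word w x = act_word w' x.
Proof.
move=> Hx [ea eo]; have := act_word_rank w Hx; have := act_word_rank w' Hx.
rewrite -ea; case: ifP => [ac|_ -> ->] // H' H.
exact: has_rank_inj H H' (eo ac).
Qed.

Lemma gen_k_rank d : exists rho, [/\ has_rank (gen_k d) rho, rank_fun n rho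
  & forall m : nat, (m <= n)%N -> rho m n = psd d m].
Proof.
have [A -> EA] := gen_k_orbit d; exists (ork A); split.
- by exists A.
- exact: rank_fun_rk.
- by move=> i _; rewrite EA psd_full; apply/minn_idPl/psd_le.
Qed.

Lemma Phi_tws_same w w' d : (forall rho, rank_fun n rho ->
    (forall m : nat, (m <= n)%N -> rho m n = psd d m) ->
    same_action n (natw w) (natw w') rho) ->
  Phi (tws w d - tws w' d) = 0.
Proof.
move=> H; rewrite PhiB (Phi_tws w) (Phi_tws w'); have [rho [Hr Rr Er]] := gen_k_rank d.
by rewrite (act_word_same Hr (H rho Rr Er)) subrr.
Qed.

Lemma ord_bound i : (i.+1 < n)%N.
Proof. exact: ltn_ord (hi i). Qed.

Lemma same_action_sym w w' rho :
  same_action n (natw w) (natw w') rho -> same_action n (natw w') (natw w) rho.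
Proof. by move=> [a b]; split=> [|ac c m cn mn]; [rewrite a | rewrite b // a]. Qed.

(** Both terms are words that act on rank functions in the same way. *)
Lemma Phi_relP i j d : Phi (relP r i j * sK d) = 0.
Proof.
have ib := ord_bound i; have jb := ord_bound j.
rewrite /relP expr2; case: eqP => [ij|nij]; last case: eqP => [ij|nij'].
- rewrite mul3_BA.
  apply: (@Phi_tws_same [:: (true, i); (true, i); (true, j)]
    [:: (true, i); (true, j); (true, i)]) => rho Rr _.
  by rewrite /natw /= -ij; apply: same_EEE1; rewrite // ij.
- rewrite mul3_NA.
  apply: (@Phi_tws_same [:: (true, j); (true, i); (true, i)]
    [:: (true, i); (true, j); (true, i)]) => rho Rr _.
  have [|a b] := @same_EEE2 n j rho _ Rr; first by rewrite -ij.
  by rewrite /natw /= ij; split=> [|ac c m cn mn]; [rewrite a | rewrite b // a].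
- rewrite mul2_BA; have [<-|ij] := eqVneq i j; first by rewrite subrr Phi0.
  apply: (@Phi_tws_same [:: (true, i); (true, j)] [:: (true, j); (true, i)]) => rho Rr _.
  have {}ij : i <> j :> nat by move/val_inj => E; rewrite E eqxx in ij.
  case: (ltnP i.+1 j) => ij1; first exact: same_far.
  have ji : (j.+1 < i)%N by lia.
  by apply: same_action_sym; exact: (@same_far n true true j i rho ji ib Rr).
Qed.

Lemma Phi_relN i j d : Phi (relN r i j * sK d) = 0.
Proof.
have ib := ord_bound i; have jb := ord_bound j.
rewrite /relN expr2; case: eqP => [ij|nij]; last case: eqP => [ij|nij'].
- rewrite mul3_NA.
  apply: (@Phi_tws_same [:: (false, j); (false, i); (false, i)]
    [:: (false, i); (false, j); (false, i)]) => rho Rr _.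
  by rewrite /natw /= -ij; apply: same_FFF1; rewrite // ij.
- rewrite mul3_BA.
  apply: (@Phi_tws_same [:: (false, i); (false, i); (false, j)]
    [:: (false, i); (false, j); (false, i)]) => rho Rr _.
  apply: same_action_sym; rewrite /natw /= ij.
  by apply: same_FFF2; rewrite // -ij.
- rewrite mul2_BA; have [<-|ij] := eqVneq i j; first by rewrite subrr Phi0.
  apply: (@Phi_tws_same [:: (false, i); (false, j)] [:: (false, j); (false, i)]) => rho Rr _.
  have {}ij : i <> j :> nat by move/val_inj => E; rewrite E eqxx in ij.
  case: (ltnP i.+1 j) => ij1; first exact: same_far.
  have ji : (j.+1 < i)%N by lia.
  by apply: same_action_sym; exact: (@same_far n false false j i rho ji ib Rr).
Qed.

(** For [i = j] the sign depends on which of [d_i] and [d_{i+1}] vanish: a word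
    that takes a unit where there is none is zero, and a word that returns the
    unit to the place where it took it is the identity if the other place is
    empty. *)
Lemma Phi_relC i j d : Phi (relC r i j * sK d) = 0.
Proof.
have ib := ord_bound i; have jb := ord_bound j.
rewrite /relC mulrBl mul2_BA; case: eqP => [<-|ij]; last first.
  rewrite mul0r subr0.
  apply: (@Phi_tws_same [:: (true, i); (false, j)] [:: (false, j); (true, i)]) => rho Rr _.
  have {}ij : i <> j :> nat by move/val_inj.
  case: (ltngtP i.+1 j) => ij1; last 1 first.
  - by rewrite /natw /= -ij1; apply: same_EF_next; rewrite // ij1.
  - exact: same_far.
  have [ji|ji] : (j.+1 < i)%N \/ i = j.+1 :> nat by lia.
    by apply: same_action_sym; exact: (@same_far n false true j i rho ji ib Rr).
  by rewrite /natw /= ji; apply: same_EF_prev; rewrite // -ji.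
rewrite lam_sK; have El := row_lo d i; have Eh := row_hi d i.
have Elow w w' : (forall rho, rank_fun n rho ->
    (forall m : nat, (m <= n)%N -> rho m n = psd d m) ->
    same_action n (natw w) (natw w') rho) ->
    Phi (tws w d) = Phi (tws w' d).
  by move=> /Phi_tws_same; rewrite PhiB => /eqP; rewrite subr_eq0 => /eqP.
have kill w : (forall rho, rank_fun n rho ->
    (forall m : nat, (m <= n)%N -> rho m n = psd d m) -> actsw n (natw w) rho = false) ->
    Phi (tws w d) = 0.
  move=> H; rewrite Phi_tws; have [rho [Hr Rr Er]] := gen_k_rank d.
  by have := act_word_rank w Hr; rewrite H.
pose EF := [:: (true, i); (false, i)]; pose FE := [:: (false, i); (true, i)].
rewrite !PhiB -[tE r i * _]/(tws EF d) -[tF r i * _]/(tws FE d).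
have i2 : (i.+1 <= n)%N by apply: ltnW.
have i3 : (i <= n)%N by apply: ltnW.
have EK : Phi (sK d *~ lam i d) = Phi (tws [::] d) *~ lam i d by exact: raddfMz.
suff H A B K : A = Phi (tws EF d) -> B = Phi (tws FE d) -> K = Phi (tws [::] d) ->
    A - B - K *~ lam i d = 0.
  exact: (etrans (congr1 (fun x => _ - x) EK) (H _ _ _ erefl erefl erefl)).
move=> EA EB {}EK; rewrite /lam.
have [l0|l0] := posnP (part d (lo i)); have [h0|h0] := posnP (part d (hi i)) => /=.
- have -> : A = 0.
    by rewrite EA; apply: kill => rho _ Er; rewrite /actsw /acts /= !Er //; lia.
  have -> : B = 0.
    by rewrite EB; apply: kill => rho _ Er; rewrite /actsw /acts /= !Er //; lia.
  by rewrite mulr0z !subrr.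
- have -> : A = 0.
    by rewrite EA; apply: kill => rho _ Er; rewrite /actsw /acts /= !Er //; lia.
  have -> : B = K.
    rewrite EB EK; apply: Elow => rho Rr Er.
    by apply: (@same_FE_id n i) => //; rewrite !Er //; lia.
  by rewrite mulrN1z opprK sub0r addNr.
- have -> : B = 0.
    by rewrite EB; apply: kill => rho _ Er; rewrite /actsw /acts /= !Er //; lia.
  have -> : A = K.
    rewrite EA EK; apply: Elow => rho Rr Er.
    by apply: (@same_EF_id n i) => //; rewrite !Er //; lia.
  by rewrite mulr1z subr0 subrr.
- have -> : A = B.
    rewrite EA EB; apply: Elow => rho Rr Er.
    by apply: (@same_EF_swap n i) => //; rewrite !Er //; lia.
  by rewrite mulr0z subr0 subrr.
Qed.

Lemma Phi_ideal x : gen_ideal (@I0_gen n r) x -> Phi x = 0.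
Proof.
elim=> [|y Hy|y z _ Ey _ Ez|a y b _ Ey].
- exact: Phi0.
- have kill a b d : Phi (b * sK d) = 0 -> Phi (a * b * sK d) = 0.
    move=> E; apply: (etrans (congr1 Phi (esym (mulrA _ _ _)))).
    by apply: (etrans (PhiM TR _ _)); rewrite E gmul0r.
  case: Hy => i j d; apply: kill; [exact: Phi_relP | exact: Phi_relN | exact: Phi_relC].
- by rewrite PhiB Ey Ez subrr.
- apply: (etrans (PhiM TR _ _)).
  by rewrite (_ : Phi (a * y) = 0) ?gmul0l // (PhiM TR) Ey gmul0r.
Qed.

End EvaluationOfWords.

(** * The quotient of the path algebra *)

Section RingRelations.
Variables (R S : pzRingType) (f : R -> S).
Hypotheses (fM : forall x y, f (x * y) = f x * f y) (fB : forall x y, f (x - y) = f x - f y).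

Lemma morph_rel3 a b c a' b' c' : f (a * b * c - a' * b' * c') = 0 ->
  f a * f b * f c = f a' * f b' * f c'.
Proof. by rewrite fB !fM => /eqP; rewrite subr_eq0 => /eqP. Qed.

Lemma morph_rel3N a b c a' b' c' : f (- (a' * b' * c') + a * (b * c)) = 0 ->
  f a * f b * f c = f a' * f b' * f c'.
Proof. by rewrite mulrA addrC => /morph_rel3. Qed.

Lemma morph_rel2 a b a' b' : f (a * b - a' * b') = 0 -> f a * f b = f a' * f b'.
Proof. by rewrite fB !fM => /eqP; rewrite subr_eq0 => /eqP. Qed.

Lemma morph_rel_lam a b a' b' l x y : f (a * b - a' * b' - l) = 0 -> l * x = y ->
  f a * f b * f x - f a' * f b' * f x = f y.
Proof. by rewrite !fB !fM => /eqP; rewrite subr_eq0 => /eqP E <-; rewrite fM -E mulrBl. Qed.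

Lemma mul_zero3 (x : S) : (0 * x * x = x * 0 * x) * ((x * x * 0 = x * 0 * x)
  * ((0 * x * 0 = x * 0 * 0) * (0 * x * 0 = 0 * 0 * x))).
Proof. by rewrite !(mulr0, mul0r). Qed.

Lemma swap_of_lam (e g x : S) (l : int) :
  e * g * x - g * e * x = x *~ l -> l = 0 -> e * g * x = g * e * x.
Proof. by move=> E l0; move/eqP: E; rewrite l0 mulr0z subr_eq0 => /eqP. Qed.

Lemma cancel_of_lam1 (e g x : S) (l : int) :
  e * g * x - g * e * x = x *~ l -> l = 1 -> e * x = 0 -> e * g * x = x.
Proof. by move=> E l1 ex; move: E; rewrite l1 -(mulrA g) ex mulr0 subr0. Qed.

Lemma cancel_of_lamN1 (e g x : S) (l : int) :
  e * g * x - g * e * x = x *~ l -> l = -1 -> g * x = 0 -> g * e * x = x.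
Proof.
move=> E l1 gx; move: E; rewrite l1 -(mulrA e) gx mulr0 sub0r mulrN1z.
exact: oppr_inj.
Qed.

End RingRelations.

Section Quotient.
Variables n r : nat.
Implicit Types (d : dcomp n r) (i j : 'I_n.-1).
Local Notation Q := (ZSigma_mod_I0 n r).
Local Notation Sg := (Sigma n r).
Local Notation arr := (arrow Sg).

Lemma clsM (x y : ZSigma n r) : cls (x * y) = cls x * cls y.
Proof. by symmetry; exact: qmulE. Qed.

Lemma clsB (x y : ZSigma n r) : cls (x - y) = cls x - cls y.
Proof. exact: (raddfB (\pi_(Quotient.quot (idealp (@I0_gen n r))))%qT). Qed.

Lemma clsMz (x : ZSigma n r) (c : int) : cls (x *~ c) = cls x *~ c.
Proof. exact: (raddfMz (\pi_(Quotient.quot (idealp (@I0_gen n r))))%qT). Qed.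

Lemma cls_eq0 (x : ZSigma n r) : gen_ideal (@I0_gen n r) x -> cls x = 0.
Proof.
move=> Ix; have E : cls (x - 0) = 0; last by rewrite subr0 in E.
by rewrite clsB; apply/eqP; rewrite subr_eq0; apply/eqP/qpi_eq; rewrite subr0.
Qed.

Lemma cls0 : cls (0 : ZSigma n r) = 0.
Proof. by apply: cls_eq0; apply: gen_ideal0. Qed.

Lemma gen_ideal_sum (I : finType) (F : I -> ZSigma n r) :
  (forall x, gen_ideal (@I0_gen n r) (F x)) -> gen_ideal (@I0_gen n r) (\sum_x F x).
Proof.
move=> HF; apply: big_ind => [|x y Ix Iy|//]; first exact: gen_ideal0.
have -> : x + y = x - (0 - y) by rewrite sub0r opprK.
exact: gen_idealB Ix (gen_idealB (gen_ideal0 _) Iy).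
Qed.

(** The ideal is generated by the pieces [K R K_d] of the relations; a homogeneous
    [R] is the sum of its pieces. *)
Lemma cls_relation (x : ZSigma n r) p : of_weight x p ->
  (forall d, gen_ideal (@I0_gen n r) (sKz r (vec d + p) * x * sK d)) -> cls x = 0.
Proof.
move=> hx Hd; apply: cls_eq0.
have -> : x = \sum_d x * sK d by rewrite -mulr_sumr sum_sK mulr1.
apply: gen_ideal_sum => d; have := Hd d; rewrite -hx sKz_vec -mulrA.
by rewrite sK_mul eqxx.
Qed.

Lemma cls_relP i j : cls (relP r i j) = 0.
Proof. apply: (cls_relation (@of_weight_relP n r i j)) => d; apply/gen_ideal_gen/I0_P. Qed.

Lemma cls_relN i j : cls (relN r i j) = 0.
Proof. apply: (cls_relation (@of_weight_relN n r i j)) => d; apply/gen_ideal_gen/I0_N. Qed.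

Lemma cls_relC i j : cls (relC r i j) = 0.
Proof.
apply: (cls_relation (@of_weight_relC n r i j)) => d; apply/gen_ideal_gen.
by rewrite addrA; apply: I0_C.
Qed.

(** Extended by zero to all natural numbers, as [presented] asks for. *)
Definition QX (b : bool) (i : nat) : Q :=
  if insub i : option 'I_n.-1 is Some i' then cls (tX r b i') else 0.

Definition QK (w : nat -> int) : Q := cls (sKz r (\row_a w a)).

Lemma QX_ord b i : QX b i = cls (tX r b i).
Proof. by rewrite /QX valK. Qed.

Lemma QX_out b (i : nat) : (n.-1 <= i)%N -> QX b i = 0.
Proof. by move=> ni; rewrite /QX insubF // ltnNge ni. Qed.

Lemma QK_vec d : QK (fun a => (if insub a : option 'I_n is Some a' then part d a' else 0%N)%:Z)
  = cls (sK d).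
Proof.
rewrite -sKz_vec /QK; congr (cls (sKz _ _)); apply/rowP => a.
by rewrite !mxE valK.
Qed.

Lemma QEEE1 (i : nat) :
  QX true i * QX true i * QX true i.+1
  = QX true i * QX true i.+1 * QX true i.
Proof.
have [j1|j1] := ltnP i.+1 n.-1; last first.
  by rewrite (QX_out _ j1); exact: (mul_zero3 (QX true i)).2.1.
pose i' := Ordinal (ltnW j1); pose j := Ordinal j1.
rewrite (QX_ord true i') (QX_ord true j).
apply: (morph_rel3 clsM clsB).
by have := cls_relP i' j; rewrite /relP eqxx expr2.
Qed.

Lemma QEEE2 (i : nat) :
  QX true i.+1 * QX true i * QX true i.+1
  = QX true i * QX true i.+1 * QX true i.+1.
Proof.
have [j1|j1] := ltnP i.+1 n.-1; last first.
  by rewrite (QX_out _ j1); exact: (mul_zero3 (QX true i)).2.2.1.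
pose i' := Ordinal (ltnW j1); pose j := Ordinal j1.
rewrite (QX_ord true i') (QX_ord true j); symmetry.
apply: (morph_rel3N clsM clsB).
have := cls_relP j i'; rewrite /relP eqxx expr2.
by have -> : (j.+1 == i' :> nat) = false by rewrite /=; lia.
Qed.

Lemma QFFF1 (i : nat) :
  QX false i.+1 * QX false i * QX false i
  = QX false i * QX false i.+1 * QX false i.
Proof.
have [j1|j1] := ltnP i.+1 n.-1; last first.
  by rewrite (QX_out _ j1); exact: (mul_zero3 (QX false i)).1.
pose i' := Ordinal (ltnW j1); pose j := Ordinal j1.
rewrite (QX_ord false i') (QX_ord false j).
apply: (morph_rel3N clsM clsB).
by have := cls_relN i' j; rewrite /relN eqxx expr2.
Qed.

Lemma QFFF2 (i : nat) :
  QX false i.+1 * QX false i * QX false i.+1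
  = QX false i.+1 * QX false i.+1 * QX false i.
Proof.
have [j1|j1] := ltnP i.+1 n.-1; last first.
  by rewrite (QX_out _ j1); exact: (mul_zero3 (QX false i)).2.2.2.
pose i' := Ordinal (ltnW j1); pose j := Ordinal j1.
rewrite (QX_ord false i') (QX_ord false j); symmetry.
apply: (morph_rel3 clsM clsB).
have := cls_relN j i'; rewrite /relN eqxx expr2.
by have -> : (j.+1 == i' :> nat) = false by rewrite /=; lia.
Qed.

Lemma Qfar b (i j : nat) : (i.+1 < j)%N -> QX b i * QX b j = QX b j * QX b i.
Proof.
move=> ij; have [j1|j1] := ltnP j n.-1; last by rewrite (QX_out _ j1) mulr0 mul0r.
have i1 : (i < n.-1)%N by lia.
pose i' := Ordinal i1; pose j' := Ordinal j1.
rewrite -[i]/(nat_of_ord i') -[j]/(nat_of_ord j').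
rewrite (QX_ord b i') (QX_ord b j'); apply: (morph_rel2 clsM clsB).
have e1 : (i'.+1 == j' :> nat) = false by rewrite /=; lia.
have e2 : (i' == j'.+1 :> nat) = false by rewrite /=; lia.
case: b; first by have := cls_relP i' j'; rewrite /relP e1 e2.
by have := cls_relN i' j'; rewrite /relN e1 e2.
Qed.

Lemma Qswap_neq b (i j : nat) : i != j -> QX b i * QX (~~ b) j = QX (~~ b) j * QX b i.
Proof.
wlog: b i j / b => [H ij|-> ij] /=.
  by case: b; [exact: H | symmetry; apply: (H true); rewrite // eq_sym].
have [i1|i1] := ltnP i n.-1; last by rewrite (QX_out _ i1) mulr0 mul0r.
have [j1|j1] := ltnP j n.-1; last by rewrite (QX_out _ j1) mulr0 mul0r.
pose i' := Ordinal i1; pose j' := Ordinal j1.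
rewrite -[i]/(nat_of_ord i') -[j]/(nat_of_ord j').
rewrite (QX_ord true i') (QX_ord false j'); apply: (morph_rel2 clsM clsB).
have := cls_relC i' j'; rewrite /relC; case: eqP => [/(congr1 val) /= E|_].
  by rewrite E eqxx in ij.
by rewrite subr0.
Qed.

Lemma QK_ext w w' : (forall a, (a < n)%N -> w a = w' a) -> QK w = QK w'.
Proof. by move=> ww; congr (cls (sKz _ _)); apply/rowP => a; rewrite !mxE ww. Qed.

Lemma QK_neg w a : (a < n)%N -> w a < 0 -> QK w = 0.
Proof.
move=> an wa; rewrite /QK sKz_out ?cls0 // => d; apply/eqP => /rowP/(_ (Ordinal an)).
by rewrite !mxE /= => E; rewrite -E in wa.
Qed.

Lemma Qshift b (i : nat) w : QX b i * QK w = QK (shift b i w) * QX b i.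
Proof.
have [i1|i1] := ltnP i n.-1; last by rewrite (QX_out _ i1) mulr0 mul0r.
pose i' := Ordinal i1; rewrite -[i]/(nat_of_ord i') (QX_ord b i') /QK.
have E : \row_a shift b i' w a = \row_a w a + sgn_alpha b i' :> 'rV[int]_n.
  apply/rowP => a; rewrite !mxE /shift /sgn_alpha /alphaB /alpha.
  have e1 : (a == lo i') = (a == i :> nat) by [].
  have e2 : (a == hi i') = (a == i.+1 :> nat) by [].
  by case: (b); rewrite !mxE /= e1 e2; case: (a == i :> nat); case: (a == i.+1 :> nat).
rewrite E; apply: (etrans (esym (clsM _ _))); apply: (etrans _ (clsM _ _)).
exact: (congr1 (@cls n r) (@of_weight_tX n r b i' (\row_a w a))).
Qed.

Lemma QK_cases w : QK w = 0 \/ exists2 d, QK w = cls (sK d) &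
  forall a : 'I_n, (part d a)%:Z = w a.
Proof.
have [[d Ed]|no] := pselect (exists d : dcomp n r, vec d = \row_a w a).
  right; exists d => [|a]; first by rewrite /QK -Ed sKz_vec.
  by have /rowP/(_ a) := Ed; rewrite !mxE.
left; rewrite /QK sKz_out ?cls0 // => d; apply/eqP => E; apply: no; by exists d.
Qed.

Lemma QC_diag i d : QX true i * QX false i * cls (sK d) - QX false i * QX true i * cls (sK d)
  = cls (sK d *~ lam i d).
Proof.
rewrite !QX_ord; apply: (morph_rel_lam clsM clsB _ (lam_sK i d)).
by have := cls_relC i i; rewrite /relC eqxx.
Qed.

End Quotient.

(** * Normal forms span the quotient *)

Section Spanning.
Variables n r : nat.
Hypothesis n_gt0 : (0 < n)%N.
Implicit Types (d : dcomp n r).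
Local Notation Q := (ZSigma_mod_I0 n r).
Local Notation Sg := (Sigma n r).
Local Notation arr := (arrow Sg).
Local Notation X := (@QX n r).
Local Notation K := (@QK n r).

Lemma E_F_diag (i : nat) w : (i.+1 < n)%N -> K w = 0 \/
  exists l : int, X true i * X false i * K w - X false i * X true i * K w = K w *~ l /\
   [/\ 0 < w i -> 0 < w i.+1 -> l = 0, 0 < w i -> w i.+1 = 0 -> l = 1
     & w i = 0 -> 0 < w i.+1 -> l = -1].
Proof.
move=> i_n; have [->|[d -> dw]] := QK_cases n r w; [by left|right].
have i1 : (i < n.-1)%N by lia.
pose i' := Ordinal i1; exists (lam i' d).
have := dw (lo i'); have := dw (hi i'); rewrite /= => wh wl.
split; first by have := QC_diag i' d; rewrite clsMz.
rewrite -wl -wh /lam; split.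
- by rewrite !ltz_nat => l0 h0; rewrite !gtn_eqF ?andbF.
- by rewrite ltz_nat => l0 [->]; rewrite l0.
- by move=> [->]; rewrite ltz_nat => h0; rewrite h0.
Qed.

Lemma Q_neg_step b (i : nat) w : (i.+1 < n)%N -> w (taken b i) <= 0 -> X b i * K w = 0.
Proof.
move=> i_n wi; rewrite Qshift (@QK_neg _ _ _ (taken b i)) ?mul0r //.
  by case: b {wi} => //=; apply: ltnW.
by rewrite /shift; case: b wi => /=; lia.
Qed.

Lemma Q_presented : presented n X K.
Proof.
split.
- exact: QK_ext.
- exact: QK_neg.
- exact: Qshift.
- exact: Qswap_neq.
- move=> b i w i_n w0 w1; have [->|[l [E [l0 _ _]]]] := E_F_diag w i_n.
    exact: (etrans (mulr0 _) (esym (mulr0 _))).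
  have H := swap_of_lam E (l0 w0 w1); by case: b; [exact: H | exact: (esym H)].
- move=> b i w i_n w0 w1; have [->|[l [E [_ l1 l2]]]] := E_F_diag w i_n.
    exact: mulr0 (X b i * X (~~ b) i).
  case: b w0 w1 => /= w0 w1.
    by apply: cancel_of_lam1 E (l1 w0 w1) (@Q_neg_step true _ _ i_n _); rewrite /= w1.
  by apply: cancel_of_lamN1 E (l2 w1 w0) (@Q_neg_step false _ _ i_n _); rewrite /= w1.
- exact: QEEE1.
- exact: QEEE2.
- exact: QFFF1.
- exact: QFFF2.
- exact: Qfar.
Qed.

Definition entries (B : orbmx n r) (i j : nat) : nat :=
  if (insub i : option 'I_n, insub j : option 'I_n) is (Some a, Some b) then nmx B a b
  else 0%N.

(** The normal form of the matrix [B] starting at the weight of its column sums,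
    the vertex of the second flag of the orbit. *)
Definition normal_form (B : orbmx n r) : Q :=
  nform X n.-1 (entries B) * K (fun j => (\sum_(i < n) entries B i j)%N%:Z).

Lemma cls_tws w d : cls (tws w d) =
  word X (natw w)
  * K (fun a => (if insub a : option 'I_n is Some a' then part d a' else 0%N)%:Z).
Proof.
rewrite QK_vec; elim: w => [|[b i] w IHw]; first by rewrite word_nil mul1r.
rewrite [natw _]/= word_cons -mulrA -IHw QX_ord; exact: clsM.
Qed.

Lemma natw_idx (w : seq (bool * 'I_n.-1)) : idx_lt n.-1 (natw w).
Proof. by apply/allP => x /mapP[y _ ->] /=; apply: ltn_ord. Qed.

Theorem tws_normal w d : cls (tws w d) = 0 \/ exists B, cls (tws w d) = normal_form B.
Proof.
rewrite cls_tws; set f := fun a => _.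
have n1 : (n.-1 < n)%N by lia.
case: (word_nform Q_presented f n1 (natw_idx w)) => [->|[A [_ cA ->]]]; [by left|right].
pose M : 'M[nat]_n := \matrix_(i, j) A i j.
have sM : (\sum_i \sum_j M i j)%N = r.
  rewrite exchange_big /= -[RHS](psd_full d) /psd psum_full; apply: eq_bigr => j _.
  have := cA j (ltn_ord j); rewrite /f valK => -[->].
  by apply: eq_bigr => i _; rewrite mxE.
have [B EB] := orbmx_of sM; exists B.
have EA i j : (i < n)%N -> (j < n)%N -> entries B i j = A i j.
  by move=> i_n jn; rewrite /entries !insubT EB mxE.
rewrite /normal_form; congr (_ * _).
  by apply: eq_nform => i j i_n jn; rewrite EA //; lia.
apply: QK_ext => j jn; rewrite cA //; congr Posz.
by apply: eq_bigr => i _; rewrite EA.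
Qed.

Lemma path_tws (v : dcomp n r) (s : seq arr) (ch : chain (v : vertex Sg) s) :
  exists w, << (Sub (v : vertex Sg, s) ch : qpath Sg) >> = tws w v.
Proof.
elim/last_ind: s ch => [|s a IHs] ch.
  exists [::]; rewrite /tws /= /sK; congr << _ >>; exact: val_inj.
have ch1 : chain (v : vertex Sg) s by move: ch; rewrite -cats1 chain_cat => /andP[].
have [w Ew] := IHs ch1; pose p : qpath Sg := Sub (v : vertex Sg, s) ch1.
have ap : (val a).1.2 = pend p.
  by move: ch; rewrite -cats1 chain_cat /= andbT => /andP[_ /eqP].
pose b := (val a).1.1.1; pose i := (val a).1.1.2.
exists ((b, i) :: w); rewrite [RHS]/= -Ew -/p.
have pK : sK (pend p : dcomp n r) * << p >> = << p >> :> ZSigma n r.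
  apply: (etrans (pa_mulU _ _)); rewrite /pmul eqxx; congr << _ >>; apply: val_inj.
  by rewrite val_pcomp // cats0.
have aX : tX r b i * sK (pend p : dcomp n r) = << arrow_path a >> :> ZSigma n r.
  apply: (etrans (tX_sK _ _ _)); rewrite /sX; apply: big_pred1 => a' /=.
  apply/eqP/eqP => [E|->]; last by rewrite -ap /b /i -!surjective_pairing.
  by apply: target_uniq; rewrite E /b /i -ap -!surjective_pairing.
transitivity (tX r b i * (sK (pend p : dcomp n r) * << p >>) : ZSigma n r); last by rewrite pK.
have E3 : tX r b i * (sK (pend p : dcomp n r) * << p >>)
    = (<< arrow_path a >> : ZSigma n r) * << p >> :> ZSigma n r.
  by apply: (etrans (mulrA _ _ _)); exact: (congr1 (fun x => x * (<< p >> : ZSigma n r)) aX).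
apply: (etrans _ (esym E3)).
apply: (etrans _ (esym (pa_mulU _ _))); rewrite /pmul.
have -> : pend p == pstart (arrow_path a) by apply/eqP; rewrite -ap.
congr << _ >>; apply: val_inj; rewrite val_pcomp; last by rewrite -ap.
by rewrite /= cats1.
Qed.

(** A path is a word in the generators started at a vertex, hence zero or a normal
    form; and the paths span. *)
Theorem spanned (P : Q -> Prop) : P 0 -> (forall x y, P x -> P y -> P (x - y)) ->
  (forall B, P (normal_form B)) -> forall x, P x.
Proof.
move=> P0 PB HP x; have [y ->] := qpi_surj x.
have PN z : P z -> P (- z) by rewrite -sub0r; apply: PB.
have PD z t : P z -> P t -> P (z + t) by move=> Pz Pt; rewrite -[t]opprK; apply/PB/PN.
have PM z (c : int) : P z -> P (z *~ c).
  move=> Pz; have Pn m : P (z *+ m).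
    by elim: m => [|m IHm]; rewrite ?mulr0n // mulrS; apply: PD.
  by case: c => m; [exact: Pn | apply/PN/(Pn m.+1)].
have Pp p : P (cls (<< p >> : ZSigma n r)).
  case: p => -[v s] ch; have [w Ew] := path_tws ch.
  have -> : (exist _ (v, s) ch : qpath Sg) = Sub (v, s) ch by apply: val_inj.
  rewrite Ew; case: (tws_normal w v) => [->|[B ->]]; [exact: P0 | exact: HP].
rewrite [y]monalgE -/(cls _).
apply: (big_ind (fun z => P (cls z))) => [|a b Pa Pb|p _].
- by rewrite cls0.
- have -> : a + b = a - (0 - b) by rewrite sub0r opprK.
  by rewrite !clsB cls0 sub0r; apply/PB/PN.
have -> : << y@_p *g p >> = << p >> *~ y@_p :> ZSigma n r by rewrite -raddfMz intz.
by rewrite clsMz; apply: PM.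
Qed.

End Spanning.

(** * The isomorphism *)

Section Isomorphism.
Variables (n r : nat) (omul : orbmx n r -> orbmx n r -> Gnr n r).
Hypothesis TR : tropical omul.
Implicit Types (A B C : orbmx n r) (d : dcomp n r) (i : 'I_n.-1).
Local Notation Q := (ZSigma_mod_I0 n r).
Local Notation gmul := (gmul omul).
Local Notation Phi := (Phi omul).

Lemma agen_gen_k (a : sigma_arrow n r) :
  gmul (agen a) (gen_k (val a).1.2) = agen a.
Proof.
have [A -> EA] := agen_orbit a; have [B -> EB] := gen_k_orbit (val a).1.2.
have rB m : ork B m n = psd (val a).1.2 m.
  by rewrite EB psd_full; apply/minn_idPl/psd_le.
have AB : composable A B.
  by move=> m mn; rewrite EA rB psd_full; apply/minn_idPr/psd_le.
have [C P EC] := omul_tprod TR AB; rewrite gmulU EC; congr orbit_elt.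
apply: tprod_unique P _ => p q pn qn; split.
  by move=> m mn; rewrite !EA rB EB; lia.
by exists q => //; rewrite !EA rB EB; lia.
Qed.

Lemma Phi_sX b i d : (0 < part d (if b then hi i else lo i))%N ->
  Phi (sX b i d) = if b then gen_e i d else gen_f i d.
Proof.
move=> py; have [a Ea] := arrow_exists py.
have -> : sX b i d = << arrow_path (a : arrow (Sigma n r)) >>.
  rewrite /sX; apply: big_pred1 => a' /=.
  by apply/eqP/eqP => [Ea'|->//]; apply: target_uniq; rewrite Ea'.
apply: (etrans (PhiU _ _)); rewrite /path_eval /gact /=.
apply: (etrans (agen_gen_k a)); rewrite /agen.
by case: a Ea => -[[[b' i'] d'] d''] /= _ [-> -> ->].
Qed.

Definition eta (x : Q) : Gnr n r := Phi (generic_quotient.repr x).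

Lemma eta_cls x : eta (cls x) = Phi x.
Proof.
apply/eqP; rewrite -subr_eq0 /eta -PhiB; apply/eqP.
by apply: (Phi_ideal TR); apply/qpi_eq; rewrite /qpi reprK.
Qed.

Lemma eta_zmod_morphism : zmod_morphism eta.
Proof.
move=> x y; have [x' ->] := qpi_surj x; have [y' ->] := qpi_surj y.
by rewrite -!/(cls _) -clsB !eta_cls PhiB.
Qed.

Lemma eta_mul x y : eta (x * y) = gmul (eta x) (eta y).
Proof.
have [x' ->] := qpi_surj x; have [y' ->] := qpi_surj y.
by rewrite -!/(cls _) -clsM !eta_cls (PhiM TR).
Qed.

Lemma orbit_elt_neq0 A : orbit_elt A <> 0.
Proof.
pose f C : int := (C == A)%:R.
have lf : lext f (orbit_elt A) = 1 by rewrite orbit_eltE lextU /f eqxx.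
by move=> E; move: lf; rewrite E raddf0.
Qed.

(** Induction on the distance from the diagonal: by [descent] the orbit is a
    generator times an orbit closer to the diagonal, and diagonal orbits are the
    images of the vertices. *)
Lemma words_reach_orbits B : exists w d, Phi (tws w d) = orbit_elt B.
Proof.
have [N] := ubnP (spread (nmx B)); elim: N B => // N IHN B; rewrite ltnS => sB.
have [[d Ed]|[b [i [A [sA acA EB]]]]] := descent B.
  exists [::], d; rewrite Phi_tws //=; have [A -> EA] := gen_k_orbit d.
  by congr orbit_elt; apply: ork_inj => i j _ _; rewrite EA Ed.
have [w [d Ew]] := IHN A (leq_trans sA sB).
exists ((b, i) :: w), d; rewrite /= (PhiM TR) Ew.
have hA : has_rank (orbit_elt A) (ork A) by exists A.
have := tX_mul TR b i hA; rewrite acA => H.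
have hB : has_rank (orbit_elt B) (ork B) by exists B.
by apply: (has_rank_inj H hB) => p q pn qn; rewrite EB.
Qed.

(** By [words_reach_orbits] every basis element is the image of some normal form.
    As orbit matrices index the normal forms as well as the basis, and there are
    finitely many of them, this sets up a bijection between the normal forms and
    the basis; its inverse extends linearly to the inverse of [eta]. *)
Lemma eta_bijective (n_gt0 : (0 < n)%N) : bijective eta.
Proof.
have /choice[al Hal] B : exists C, eta (normal_form C) = orbit_elt B.
  have [w [d Ew]] := words_reach_orbits B.
  case: (tws_normal n_gt0 w d) => [E|[C EC]]; last by exists C; rewrite -EC eta_cls.
  by case: (@orbit_elt_neq0 B); rewrite -Ew -eta_cls E -cls0 eta_cls Phi0.
have al_inj : injective al.
  by move=> B B' E; apply: orbit_elt_inj; rewrite -!Hal E.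
have [be _ alK] := injF_bij al_inj.
pose g := lext (fun B => normal_form (al B)) : Gnr n r -> Q.
have gU B : g (orbit_elt B) = normal_form (al B) by rewrite orbit_eltE; exact: lextU.
have gB x y : g (x - y) = g x - g y by exact: raddfB.
have g0 : g 0 = 0 by exact: raddf0.
have etaB := eta_zmod_morphism.
have eta0 : eta 0 = 0 by rewrite -cls0 eta_cls Phi0.
exists g.
  apply: (spanned n_gt0) => [|x y Ex Ey|C]; first by rewrite eta0.
    by rewrite etaB gB Ex Ey.
  by rewrite -(alK C) Hal gU.
pose etaM := GRing.isZmodMorphism.Build Q (Gnr n r) eta etaB.
pose etaA : {additive Q -> Gnr n r} := HB.pack eta etaM.
pose gM := GRing.isZmodMorphism.Build (Gnr n r) Q g gB.
pose gA : {additive Gnr n r -> Q} := HB.pack g gM.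
apply: (@malg_additive_ext _ _ (etaA \o gA) idfun) => B.
apply: (etrans (congr1 (fun x => eta (g x)) (esym (orbit_eltE B)))).
by rewrite gU Hal orbit_eltE.
Qed.

End Isomorphism.

Lemma orb_mul_tropical (n r : nat) (k : closedFieldType) (V : vectType k) :
  \dim {: V} = r -> tropical (@orb_mul n r k V).
Proof.
move=> dimV; split=> A B; last exact: orb_mul_eq0.
by case/(orb_mul_tprod dimV) => C P ->; exists C; rewrite ?orbit_eltE.
Qed.

Theorem theorem7p2 (n r : nat) (k : closedFieldType) (V : vectType k)
    (n_gt0 : (0 < n)%N) (r_gt0 : (0 < r)%N) (dimV : \dim {:V} = r) :
  exists eta : {additive ZSigma_mod_I0 n r -> Gnr n r},
    [/\ (forall (i : 'I_n.-1) (d : dcomp n r), (0 < part d (hi i))%N ->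
           eta (cls (sE i d)) = gen_e i d)
          /\ (forall (i : 'I_n.-1) (d : dcomp n r), (0 < part d (lo i))%N ->
           eta (cls (sF i d)) = gen_f i d)
          /\ (forall d : dcomp n r, eta (cls (sK d)) = gen_k d),
        forall x y, eta (x * y) = gen_mul V (eta x) (eta y),
        eta 1 = gen_one n r
      & bijective eta].
Proof.
have TR := orb_mul_tropical n dimV.
pose etaM := GRing.isZmodMorphism.Build (ZSigma_mod_I0 n r) (Gnr n r)
  (eta (@orb_mul n r k V)) (eta_zmod_morphism TR).
exists (HB.pack (eta (@orb_mul n r k V)) etaM : {additive ZSigma_mod_I0 n r -> Gnr n r}).
split=> /=.
- split=> [i d py|]; first by rewrite (eta_cls TR); exact: (Phi_sX TR (b := true) py).
  split=> [i d py|d]; first by rewrite (eta_cls TR); exact: (Phi_sX TR (b := false) py).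
  by rewrite (eta_cls TR) Phi_sK.
- by move=> x y; rewrite (eta_mul TR) gmulE.
- by rewrite -[1]/(cls 1) (eta_cls TR) Phi1.
- exact: (eta_bijective TR n_gt0).
Qed.
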